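(* Let $p$ be a prime, $d\ge1$ an integer, $\Gamma=\mathbb{Z}_p^d$, and let $(X_n)_{n\ge0}$ be a $\mathbb{Z}_p^d$-tower of strongly connected digraphs over $X=X_0$, with associated voltage assignment $\alpha:\mathbb{E}(X)\to\Gamma$. Let $\ell\ne p$ be a prime number. Then $$\mathrm{ord}_\ell(|\mathrm{Pic}_\ell(X_n)_{\mathrm{tor}}|)=p^{nd}\mu_\ell(L_p(X,\alpha))+O(p^{(d-1)n}).$$ If $\omega(\mathcal{L}_p(X,\alpha))\ne0$ for all but finitely many $\omega\in\Gamma^\vee$, then $$\mathrm{ord}_\ell(|\mathcal{BF}_\ell(X_n)_{\mathrm{tor}}|)=p^{nd}\mu_\ell(\mathcal{L}_p(X,\alpha))+O(p^{(d-1)n}).$$ (The $O$-terms are as $n\to\infty$, with implied constants independent of $n$.)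
   Context: **Digraphs.** A digraph $X$ consists of finite sets $V(X)$ (vertices) and $\mathbb{E}(X)$ (directed edges) with an incidence map $e\mapsto(o(e),t(e))\in V(X)\times V(X)$ (origin, terminus). It is strongly connected if for all $(v,v')$ there is a directed path from $v$ to $v'$. A morphism of digraphs is a pair of maps on vertices and edges commuting with incidence. A covering $Y\to X$ is a surjective morphism $f$ which for each $v\in V(Y)$ induces bijections from the incoming (resp. outgoing) edges at $v$ to those at $f(v)$. It is $m$-sheeted if each vertex of $X$ has $m$ preimages, and Galois if it is $m$-sheeted with $|\mathrm{Deck}(Y/X)|=m$ for some $m$, where $\mathrm{Deck}(Y/X)$ is the group of automorphisms of $Y$ over $X$; then $\mathrm{Gal}(Y/X)=\mathrm{Deck}(Y/X)$. **Towers.** A $\mathbb{Z}_p^d$-tower over $X$ is a sequence of coverings $X=X_0\leftarrow X_1\leftarrow X_2\leftarrow\cdots$ such that each $X_n/X$ is Galois with group isomorphic to $(\mathbb{Z}/p^n\mathbb{Z})^d$. ''Tower of strongly connected digraphs'' means all $X_n$ are strongly connected. Put $\Gamma=\mathbb{Z}_p^d$ (written multiplicatively), $\Gamma_n=\Gamma/\Gamma^{p^n}$. Such a tower comes from a voltage assignment $\alpha:\mathbb{E}(X)\to\Gamma$: $X_n$ is (compatibly with the coverings) the derived digraph $X(\Gamma_n,\alpha_n)$ with vertices $V(X)\times\Gamma_n$, edges $\mathbb{E}(X)\times\Gamma_n$, and $(e,\sigma)$ going from $(o(e),\sigma)$ to $(t(e),\sigma\alpha_n(e))$, where $\alpha_n=\alpha$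 modulo $\Gamma^{p^n}$. Fix such an $\alpha$. **Groups.** For a digraph $Y$ with vertices $v_1,\dots,v_s$, let $D_Y$ be the diagonal matrix of out-degrees and $A_Y$ the matrix whose $(i,j)$-entry is the number of edges from $v_j$ to $v_i$. Set $\mathrm{Pic}(Y)=\mathbb{Z}^s/(D_Y-A_Y)\mathbb{Z}^s$, $\mathcal{BF}(Y)=\mathbb{Z}^s/(\mathrm{Id}-A_Y)\mathbb{Z}^s$ (Bowen–Franks group), $\mathrm{Pic}_\ell(Y)=\mathrm{Pic}(Y)\otimes\mathbb{Z}_\ell$, $\mathcal{BF}_\ell(Y)=\mathcal{BF}(Y)\otimes\mathbb{Z}_\ell$. The subscript ''tor'' denotes the $\mathbb{Z}_\ell$-torsion submodule. **$p$-adic functions.** $\Phi_{p,d}=\mathbb{Z}[T_1,\dots,T_d;\mathbb{Z}_p]$ is the ring of finite $\mathbb{Z}$-linear combinations of monomials $T_1^{a_1}\cdots T_d^{a_d}$ with $a_i\in\mathbb{Z}_p$; it is the group ring $\mathbb{Z}[\Gamma]$, with $T_1^{a_1}\cdots T_d^{a_d}$ corresponding to $(a_1,\dots,a_d)\in\mathbb{Z}_p^d$. Let $r=|V(X)|$, $V(X)=\{v_1,\dots,v_r\}$, $\pi_i:\Gamma\to\mathbb{Z}_p$ the $i$-th projection, and let $A_\alpha$ be the $r\times r$ matrix whose $(i,j)$-entry is $\sum_e\prod_{k=1}^dT_k^{\pi_k(\alpha(e))}$, the sum over edges $e$ from $v_j$ to $v_i$. Define $L_p(X,\alpha)=\det(D_X-A_\alpha)$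 and $\mathcal{L}_p(X,\alpha)=\det(\mathrm{Id}-A_\alpha)$ in $\Phi_{p,d}$. $\Gamma^\vee$ is the set of finite-order $\overline{\mathbb{Q}}_\ell^\times$-valued characters of $\Gamma$. For $\omega\in\Gamma^\vee$ and $F\in\Phi_{p,d}=\mathbb{Z}[\Gamma]$, $\omega(F)$ is obtained by extending $\omega$ linearly. For nonzero $F=\sum_{i=1}^kb_iT_1^{a_{i,1}}\cdots T_d^{a_{i,d}}\in\Phi_{p,d}$ (distinct monomials, $b_i\in\mathbb{Z}$), $\mu_\ell(F)=\min_i\mathrm{ord}_\ell(b_i)$. *)

(* Defs.v *)
From HB Require Import structures.
From mathcomp Require Import all_boot all_order all_fingroup all_algebra finmap.
From mathcomp Require Import boolp classical_sets functions cardinality.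
From mathcomp.multinomials Require Import monalg.

Set Implicit Arguments.
Unset Strict Implicit.
Unset Printing Implicit Defensive.

Import GRing.Theory.
Local Open Scope ring_scope.

(* Z/kZ for k > 0; unlike 'Z_k this is the trivial group for k = 1. *)
Notation Zmod k := 'I_(k.-1.+1).

Lemma inZp_modn (m k : nat) (a : nat) :
  (m.+1 %| k.+1)%N -> inZp (inZp a : 'I_k.+1) = inZp a :> 'I_m.+1.
Proof. by move=> mk; apply: val_inj; rewrite /= modn_dvdm. Qed.

(* The ring structure below needs p prime, hence the phantom parameter p_pr. *)
Record padic_int (p : nat) (p_pr : prime p) : predArgType := PadicInt {
  padic_res :> forall n, Zmod (p ^ n);
  padic_resP : `[< forall n, inZp (padic_res n.+1) = padic_res n >]
}.

Section PadicInt.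
Variables (p : nat) (p_pr : prime p).

Lemma ppow_prednK n : (p ^ n).-1.+1 = (p ^ n)%N.
Proof. by rewrite prednK // expn_gt0 prime_gt0. Qed.

Lemma ppow_dvd n m : (n <= m)%N -> ((p ^ n).-1.+1 %| (p ^ m).-1.+1)%N.
Proof. by move=> nm; rewrite !ppow_prednK dvdn_exp2l. Qed.

Local Notation padic_int := (padic_int p_pr).

HB.instance Definition _ := [isSub for @padic_res p p_pr].
HB.instance Definition _ := [Choice of padic_int by <:].

Implicit Types x y z : padic_int.

Lemma padicP x y : (forall n, x n = y n) -> x = y.
Proof. by move=> xy; apply: val_inj; apply: functional_extensionality_dep. Qed.

Lemma padic_resS x n : inZp (x n.+1) = x n.
Proof. by have /asboolP := padic_resP x. Qed.

Lemma padic_res_le x n m : (n <= m)%N -> inZp (x m) = x n.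
Proof.
move=> /subnK <-; elim: (m - n)%N => [|k IHk]; first by rewrite valZpK.
rewrite -{}IHk addSn -(padic_resS x (k + n)).
by apply/esym/inZp_modn/ppow_dvd/leq_addl.
Qed.

Fact padic0_subproof :
  `[< forall n, inZp (0%R : Zmod (p ^ n.+1)) = 0 :> Zmod (p ^ n) >].
Proof. by apply/asboolP => n; apply: val_inj; rewrite /= mod0n. Qed.
Definition padic0 := PadicInt p_pr padic0_subproof.

Fact padic1_subproof :
  `[< forall n, inZp (Zp1 : Zmod (p ^ n.+1)) = Zp1 :> Zmod (p ^ n) >].
Proof. by apply/asboolP => n; exact/inZp_modn/ppow_dvd. Qed.
Definition padic1 := PadicInt p_pr padic1_subproof.

Fact padic_add_subproof x y :
  `[< forall n, inZp (x n.+1 + y n.+1)%R = x n + y n >].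
Proof.
apply/asboolP => n; rewrite -(padic_resS x n) -(padic_resS y n); apply: val_inj => /=.
by rewrite modn_dvdm ?ppow_dvd // modnDm.
Qed.
Definition padic_add x y := PadicInt p_pr (padic_add_subproof x y).

Fact padic_mul_subproof x y :
  `[< forall n, inZp (Zp_mul (x n.+1) (y n.+1)) = Zp_mul (x n) (y n) >].
Proof.
apply/asboolP => n; rewrite -(padic_resS x n) -(padic_resS y n); apply: val_inj => /=.
by rewrite modn_dvdm ?ppow_dvd // modnMm.
Qed.
Definition padic_mul x y := PadicInt p_pr (padic_mul_subproof x y).

Fact padic_opp_subproof x : `[< forall n, inZp (- x n.+1)%R = - x n >].
Proof.
apply/asboolP => n; apply/eqP; rewrite -subr_eq0 opprK; apply/eqP.
rewrite -(padic_resS x n); apply: val_inj => /=.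
rewrite modn_dvdm ?ppow_dvd // modnDm subnK ?(ltnW (ltn_ord _)) //.
by apply/eqP; exact: ppow_dvd.
Qed.
Definition padic_opp x := PadicInt p_pr (padic_opp_subproof x).

Fact padic_addA : associative padic_add.
Proof. by move=> x y z; apply: padicP => n /=; rewrite addrA. Qed.
Fact padic_addC : commutative padic_add.
Proof. by move=> x y; apply: padicP => n /=; rewrite addrC. Qed.
Fact padic_add0 : left_id padic0 padic_add.
Proof. by move=> x; apply: padicP => n /=; rewrite add0r. Qed.
Fact padic_addN : left_inverse padic0 padic_opp padic_add.
Proof. by move=> x; apply: padicP => n /=; rewrite addNr. Qed.
HB.instance Definition _ := GRing.isZmodule.Build padic_int
  padic_addA padic_addC padic_add0 padic_addN.

Fact padic_mulA : associative padic_mul.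
Proof. by move=> x y z; apply: padicP => n; exact: Zp_mulA. Qed.
Fact padic_mulC : commutative padic_mul.
Proof. by move=> x y; apply: padicP => n; exact: Zp_mulC. Qed.
Fact padic_mul1 : left_id padic1 padic_mul.
Proof. by move=> x; apply: padicP => n; exact: Zp_mul1z. Qed.
Fact padic_mulDl : left_distributive padic_mul +%R.
Proof. by move=> x y z; apply: padicP => n; exact: Zp_mul_addl. Qed.
Fact padic_oner_neq0 : padic1 != 0.
Proof.
apply/eqP => /(congr1 (fun x : padic_int => val (x 1%N))) /=.
by rewrite ppow_prednK expn1 modn_small // prime_gt1.
Qed.
HB.instance Definition _ := GRing.Zmodule_isComNzRing.Build padic_int
  padic_mulA padic_mulC padic_mul1 padic_mulDl padic_oner_neq0.

Definition padic_unit : pred padic_int := fun x => `[< exists y, y * x = 1 >].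
Definition padic_inv x := xget x [set y | y * x = 1]%classic.

Fact padic_mulV : {in padic_unit, left_inverse 1 padic_inv *%R}.
Proof. by move=> x /asboolP [y yx1]; exact: (@xgetI _ x [set y | y * x = 1]%classic y). Qed.
Fact padic_unitPl x y : y * x = 1 -> padic_unit x.
Proof. by move=> yx1; apply/asboolP; exists y. Qed.
Fact padic_inv_out : {in [predC padic_unit], padic_inv =1 id}.
Proof.
move=> x; rewrite inE => /negP xNu; apply: xgetPN => y yx1.
by apply: xNu; exact: padic_unitPl yx1.
Qed.
HB.instance Definition _ := GRing.ComNzRing_hasMulInverse.Build padic_int
  padic_mulV padic_unitPl padic_inv_out.

Lemma padic_neq0P x : x != 0 -> exists n, (0 < x n)%N.
Proof.
move=> /eqP x0; apply: contrapT => xn0; apply: x0; apply: padicP => n.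
apply: val_inj; apply/eqP; rewrite /= -leqn0 leqNgt; apply/negP => lt0.
by apply: xn0; exists n.
Qed.

Lemma padic_res_modn x n m : (n <= m)%N -> (x m %% p ^ n)%N = x n.
Proof.
by move=> nm; rewrite -(padic_res_le x nm) /=; congr modn; rewrite ppow_prednK.
Qed.

Fact padic_idomain x y : x * y = 0 -> (x == 0) || (y == 0).
Proof.
move=> xy0; apply/norP => -[/padic_neq0P[m xm] /padic_neq0P[n yn]].
have resE (z : padic_int) k l : (k <= l)%N -> (0 < z k)%N ->
    (0 < z l)%N && (logn p (z l) < k)%N.
  move=> kl zk; have zE := padic_res_modn z kl; apply/andP; split.
    by rewrite lt0n; apply: contraTneq zk => zl0; rewrite -zE zl0 mod0n.
  rewrite ltnNge; apply/negP => kle.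
  move: zk; rewrite -zE lt0n => /negP; apply.
  by apply: dvdn_trans (pfactor_dvdnn p _); exact: dvdn_exp2l.
have /andP[xN lx] := resE x m (m + n)%N (leq_addr _ _) xm.
have /andP[yN ly] := resE y n (m + n)%N (leq_addl _ _) yn.
have /(congr1 (fun z : padic_int => val (z (m + n)%N))) := xy0.
move=> /= /eqP; rewrite -/(dvdn _ _) => xy_dvd.
have: (p ^ (m + n) %| x (m + n) * y (m + n))%N.
  by apply: dvdn_trans xy_dvd; rewrite ppow_prednK.
rewrite pfactor_dvdn // ?muln_gt0 ?xN // lognM //.
by rewrite leqNgt (leq_trans _ (leq_add lx ly)) // addSn addnS leqnSn.
Qed.
HB.instance Definition _ :=
  GRing.ComUnitRing_isIntegral.Build padic_int padic_idomain.

End PadicInt.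

Section GroupRing.
Variable G : zmodType.

Definition grpring : Type := {malg int[G]}.
HB.instance Definition _ := GRing.Zmodule.on grpring.

Implicit Types (F : {malg int[G]}) (g : G).

Definition grp_mul (F1 F2 : grpring) : grpring :=
  \sum_(g1 <- msupp F1) \sum_(g2 <- msupp F2) << F1@_g1 * F2@_g2 *g (g1 + g2) >>.

Definition grp_elt g : grpring := << 1 *g g >>.

Lemma grp_mulw (d1 d2 : {fset G}) F1 F2 :
    (msupp F1 `<=` d1)%fset -> (msupp F2 `<=` d2)%fset ->
  grp_mul F1 F2 =
  \sum_(g1 <- d1) \sum_(g2 <- d2) << F1@_g1 * F2@_g2 *g (g1 + g2) >>.
Proof.
move=> le_d1 le_d2; rewrite /grp_mul (big_fset_incl _ le_d1) /=.
  apply/eq_bigr=> k1 _; apply/big_fset_incl => // k _ /mcoeff_outdom ->.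
  by rewrite mulr0 monalgU0.
move=> k _ /mcoeff_outdom g1k.
by rewrite big1 => // k' _; rewrite g1k mul0r monalgU0.
Qed.

Lemma grp_mulC : commutative grp_mul.
Proof.
move=> F1 F2; rewrite /grp_mul exchange_big /=; apply: eq_bigr => k1 _.
by apply: eq_bigr => k2 _; rewrite mulrC addrC.
Qed.

Lemma grp_mulDl : left_distributive grp_mul +%R.
Proof.
move=> F1 F2 F; have le := fsubset_refl (msupp F).
rewrite [in RHS](grp_mulw (fsubsetUl _ (msupp F2)) le).
rewrite [in RHS](grp_mulw (fsubsetUr (msupp F1) _) le).
rewrite (grp_mulw (msuppD_le _ _) le).
rewrite -big_split /=; apply/eq_bigr=> k1 _.
rewrite -big_split /=; apply/eq_bigr=> k2 _.
by rewrite mcoeffD mulrDl monalgUD.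
Qed.

Lemma grp_mulDr : right_distributive grp_mul +%R.
Proof. by move=> F F1 F2; rewrite grp_mulC grp_mulDl !(grp_mulC F). Qed.

Lemma grp_mul0 : left_zero 0 grp_mul.
Proof. by move=> F; rewrite /grp_mul msupp0 big_seq_fset0. Qed.

Lemma grp_mulr0 : right_zero 0 grp_mul.
Proof. by move=> F; rewrite grp_mulC grp_mul0. Qed.

Lemma grp_mulUU c1 c2 g1 g2 :
  grp_mul << c1 *g g1 >> << c2 *g g2 >> = << c1 * c2 *g (g1 + g2) >>.
Proof. by rewrite (grp_mulw msuppU_le msuppU_le) !big_seq_fset1 !mcoeffUU. Qed.

Lemma grp_ind (P : grpring -> Prop) :
  P 0 -> (forall F1 F2, P F1 -> P F2 -> P (F1 + F2)) ->
  (forall c g, P << c *g g >>) -> forall F, P F.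
Proof. by move=> P0 PD PU F; rewrite [F]monalgE; elim/big_ind: _. Qed.

Lemma grp_mulA : associative grp_mul.
Proof.
move=> F1 F2 F3.
elim/grp_ind: F1 => [|F F' IH IH'|c1 g1]; rewrite ?grp_mul0 ?grp_mulDl ?IH ?IH' //.
elim/grp_ind: F2 => [|F F' IH IH'|c2 g2].
- by rewrite !(grp_mul0, grp_mulr0).
- by rewrite !(grp_mulDl, grp_mulDr) IH IH'.
elim/grp_ind: F3 => [|F F' IH IH'|c3 g3]; rewrite ?grp_mulr0 ?grp_mulDr ?IH ?IH' //.
by rewrite !grp_mulUU mulrA addrA.
Qed.

Lemma grp_mul1 : left_id (grp_elt 0) grp_mul.
Proof.
elim/grp_ind => [|F F' IH IH'|c g]; rewrite ?grp_mulr0 ?grp_mulDr ?IH ?IH' //.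
by rewrite grp_mulUU mul1r add0r.
Qed.

Lemma grp_oner_neq0 : grp_elt 0 != 0.
Proof. by rewrite monalgU_eq0. Qed.

HB.instance Definition _ := GRing.Zmodule_isComNzRing.Build grpring
  grp_mulA grp_mulC grp_mul1 grp_mulDl grp_oner_neq0.

Lemma grp_eltD g1 g2 : grp_elt (g1 + g2) = grp_elt g1 * grp_elt g2.
Proof. by rewrite [RHS]grp_mulUU mulr1. Qed.

Lemma grp_elt0 : grp_elt 0 = 1.
Proof. by []. Qed.

End GroupRing.

(* Gamma is written additively, so Gamma^(p^n) becomes p^n Gamma.  Coordinatewise
   reduction modulo p^n identifies the quotient Gamma_n with (Z/p^n)^d. *)
Notation Gam p_pr d := 'rV[padic_int p_pr]_d.
Notation Gamq p n d := 'rV[Zmod (p ^ n)]_d.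

Section Gamma.
Variables (p : nat) (p_pr : prime p) (d : nat).

Definition Gam_red n (g : Gam p_pr d) : Gamq p n d :=
  map_mx (fun x : padic_int p_pr => x n) g.

Definition Gamq_red n (g : Gamq p n.+1 d) : Gamq p n d :=
  map_mx (fun x : Zmod (p ^ n.+1) => inZp x) g.

Lemma Gamq_redD n : {morph @Gamq_red n : g h / g + h}.
Proof.
move=> g h; apply/rowP => i; rewrite !mxE; apply: val_inj => /=.
by rewrite modn_dvdm ?ppow_dvd // modnDm.
Qed.

Lemma Gamq_redK n g : Gamq_red (Gam_red n.+1 g) = Gam_red n g.
Proof. by apply/rowP => i; rewrite !mxE padic_resS. Qed.

Definition Phi := grpring (Gam p_pr d).
HB.instance Definition _ := GRing.ComNzRing.on Phi.

(* T_k^a is the element of Gamma with k-th coordinate a and all others 0. *)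
Definition Tpow (k : 'I_d) (a : padic_int p_pr) : Phi :=
  grp_elt (a *: delta_mx 0 k).

Lemma prod_Tpow (g : Gam p_pr d) :
  \prod_k Tpow k (g 0 k) = grp_elt g :> Phi.
Proof.
rewrite [in RHS](row_sum_delta g).
by apply/esym; apply: (big_morph _ (@grp_eltD _) (@grp_elt0 _)).
Qed.

(* Meaningful for F != 0 only; mu_l 0 is set to 0. *)
Definition mu (l : nat) (F : Phi) : nat :=
  let s := [seq logn l `|F@_g|%N | g <- msupp F] in
  \big[minn/head 0%N s]_(m <- s) m.

Section Characters.
Variable K : fieldType.

(* A homomorphism Gamma -> K takes values in K^* since w 0 = 1. *)
Definition is_fin_character (w : Gam p_pr d -> K) : Prop :=
  [/\ w 0 = 1,
      forall g h, w (g + h) = w g * w h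
    & exists2 m, (0 < m)%N & forall g, w g ^+ m = 1].

Definition char_eval (w : Gam p_pr d -> K) (F : Phi) : K :=
  \sum_(g <- msupp F) (F@_g)%:~R * w g.

End Characters.
End Gamma.

Definition is_algebraic_closure (F : fieldType) (K : closedFieldType)
  (iota : {rmorphism F -> K}) : Prop := forall x : K, algebraicOver iota x.

Record digraph := Digraph {
  vertex : finType;
  edge : finType;
  org : edge -> vertex;
  ter : edge -> vertex
}.

Definition strongly_connected (X : digraph) : Prop :=
  forall v w : vertex X,
    connect [rel a b | [exists e : edge X, (org e == a) && (ter e == b)]] v w.

Record dmorph (Y X : digraph) := DMorph {
  vmap : vertex Y -> vertex X;
  emap : edge Y -> edge X;
  vmap_org : forall e, vmap (org e) = org (emap e);
  vmap_ter : forall e, vmap (ter e) = ter (emap e)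
}.

Definition dmorph_eq Y X (f g : dmorph Y X) : Prop :=
  vmap f =1 vmap g /\ emap f =1 emap g.

Definition dmorph_id X : dmorph X X :=
  @DMorph X X id id (fun=> erefl) (fun=> erefl).

Section Comp.
Variables (Z Y X : digraph) (g : dmorph Y X) (f : dmorph Z Y).
Fact dmorph_comp_org e : (vmap g \o vmap f) (org e) = org ((emap g \o emap f) e).
Proof. by rewrite /= !vmap_org. Qed.
Fact dmorph_comp_ter e : (vmap g \o vmap f) (ter e) = ter ((emap g \o emap f) e).
Proof. by rewrite /= !vmap_ter. Qed.
Definition dmorph_comp : dmorph Z X := DMorph dmorph_comp_org dmorph_comp_ter.
End Comp.

Definition is_iso Y X (f : dmorph Y X) : Prop :=
  bijective (vmap f) /\ bijective (emap f).

Definition is_covering Y X (f : dmorph Y X) : Prop :=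
  [/\ forall v, exists w, vmap f w = v,
      forall e, exists e', emap f e' = e
    & forall v,
        set_bij [set e | ter e = v]%classic
                [set e | ter e = vmap f v]%classic (emap f) /\
        set_bij [set e | org e = v]%classic
                [set e | org e = vmap f v]%classic (emap f)].

Definition is_sheeted m Y X (f : dmorph Y X) : Prop :=
  forall v, #|[set w | vmap f w == v]| = m.

Section Deck.
Variables (Y X : digraph) (f : dmorph Y X).

(* An automorphism of Y over X, as the pair of its actions on vertices and on
   edges. *)
Definition Deck : {set {perm vertex Y} * {perm edge Y}} :=
  [set g : {perm vertex Y} * {perm edge Y} |
           [&& [forall e, g.1 (org e) == org (g.2 e)],
               [forall e, g.1 (ter e) == ter (g.2 e)],
               [forall v, vmap f (g.1 v) == vmap f v]
             & [forall e, emap f (g.2 e) == emap f e]]].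

Lemma Deck_group_set : group_set Deck.
Proof.
apply/group_setP; split=> [|g h].
  by rewrite inE /=; apply/and4P; split; apply/forallP => ?; rewrite !perm1.
rewrite !inE => /and4P[/forallP g1 /forallP g2 /forallP g3 /forallP g4].
move=> /and4P[/forallP h1 /forallP h2 /forallP h3 /forallP h4].
apply/and4P; split; apply/forallP => a; rewrite /= !permM.
- by rewrite (eqP (g1 _)) (eqP (h1 _)).
- by rewrite (eqP (g2 _)) (eqP (h2 _)).
- by rewrite (eqP (h3 _)) (eqP (g3 _)).
- by rewrite (eqP (h4 _)) (eqP (g4 _)).
Qed.
Canonical Deck_group := Group Deck_group_set.

End Deck.

Definition is_galois Y X (f : dmorph Y X) : Prop :=
  is_covering f /\ exists m, is_sheeted m f /\ #|Deck f| = m.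

Record tower := Tower {
  tow :> nat -> digraph;
  tow_step : forall n, dmorph (tow n.+1) (tow n)
}.

Fixpoint tow_proj (T : tower) n : dmorph (T n) (T 0%N) :=
  if n is m.+1 then dmorph_comp (tow_proj T m) (tow_step T m)
  else dmorph_id (T 0%N).

Definition is_Zpd_tower (p d : nat) (T : tower) : Prop :=
  (forall n, is_covering (tow_step T n)) /\
  (forall n, is_galois (tow_proj T n) /\
             Deck (tow_proj T n) \isog [set: Gamq p n d]).

Section Derived.
Variables (p : nat) (p_pr : prime p) (d : nat).
Variables (X : digraph) (alpha : edge X -> Gam p_pr d).

Definition derived n : digraph :=
  @Digraph (vertex X * Gamq p n d)%type (edge X * Gamq p n d)%type
    (fun es => (org es.1, es.2))
    (fun es => (ter es.1, es.2 + Gam_red n (alpha es.1))).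

Definition derived_base n : dmorph (derived n) X :=
  @DMorph (derived n) X fst fst (fun=> erefl) (fun=> erefl).

Definition derived_stepv n (vs : vertex (derived n.+1)) : vertex (derived n) :=
  (vs.1, Gamq_red vs.2).
Definition derived_stepe n (es : edge (derived n.+1)) : edge (derived n) :=
  (es.1, Gamq_red es.2).

Fact derived_step_org n e : derived_stepv (org e) = org (@derived_stepe n e).
Proof. by []. Qed.
Fact derived_step_ter n e : derived_stepv (ter e) = ter (@derived_stepe n e).
Proof. by rewrite /derived_stepv /= (Gamq_redD p_pr) Gamq_redK. Qed.
Definition derived_step n : dmorph (derived n.+1) (derived n) :=
  DMorph (@derived_step_org n) (@derived_step_ter n).

End Derived.

Definition is_voltage_of p (p_pr : prime p) d (T : tower)
    (alpha : edge (T 0%N) -> Gam p_pr d) : Prop :=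
  exists phi : forall n, dmorph (T n) (derived alpha n),
    [/\ forall n, is_iso (phi n),
        dmorph_eq (dmorph_comp (derived_base alpha 0) (phi 0%N))
                  (dmorph_id (T 0%N))
      & forall n, dmorph_eq (dmorph_comp (derived_step alpha n) (phi n.+1))
                            (dmorph_comp (phi n) (tow_step T n))].

Section Matrices.
Variable Y : digraph.

(* The vertices are listed by enum_val : 'I_#|vertex Y| -> vertex Y. *)
Definition deg_mx : 'M[int]_#|vertex Y| :=
  diag_mx (\row_i #|[set e : edge Y | org e == enum_val i]|%:R).

Definition adj_mx : 'M[int]_#|vertex Y| :=
  \matrix_(i, j)
    #|[set e : edge Y | (org e == enum_val j) && (ter e == enum_val i)]|%:R.

End Matrices.

Section Cokernel.
Variables (s : nat) (M : 'M[int]_s).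

Definition mx_image (v : 'cV[int]_s) : bool := `[< exists w, v = M *m w >].

Fact mx_image_zmod_closed : zmod_closed mx_image.
Proof.
split=> [|u v]; first by apply/asboolP; exists 0; rewrite mulmx0.
move=> /asboolP[u' ->] /asboolP[v' ->].
by apply/asboolP; exists (u' - v'); rewrite mulmxBr.
Qed.
Definition mx_imageZ : zmodClosed 'cV[int]_s :=
  HB.pack mx_image (GRing.isZmodClosed.Build _ mx_image mx_image_zmod_closed).

Definition coker : zmodType := {ideal_quot mx_imageZ}.

End Cokernel.

Definition Pic (Y : digraph) : zmodType := coker (deg_mx Y - adj_mx Y).
Definition BF (Y : digraph) : zmodType := coker (1%:M - adj_mx Y).

(* M (x)_Z R is the free abelian group on M * R modulo biadditivity; the
   Z-balancing relations follow.  R acts through the second factor. *)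
Section Tensor.
Variables (M : zmodType) (R : comNzRingType).

Local Notation free := {malg int[(M * R)%type]}.

Inductive tensor_rel : free -> Prop :=
| tensor_rel0 : tensor_rel 0
| tensor_relB u v : tensor_rel u -> tensor_rel v -> tensor_rel (u - v)
| tensor_relDl m m' r : tensor_rel
    (<< 1 *g (m + m', r) >> - << 1 *g (m, r) >> - << 1 *g (m', r) >>)
| tensor_relDr m r r' : tensor_rel
    (<< 1 *g (m, r + r') >> - << 1 *g (m, r) >> - << 1 *g (m, r') >>).

Definition tensor_relb (u : free) : bool := `[< tensor_rel u >].

Fact tensor_zmod_closed : zmod_closed tensor_relb.
Proof.
split=> [|u v]; first by apply/asboolP; exact: tensor_rel0.
by move=> /asboolP ru /asboolP rv; apply/asboolP; exact: tensor_relB.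
Qed.
Definition tensor_relZ : zmodClosed free :=
  HB.pack tensor_relb (GRing.isZmodClosed.Build _ tensor_relb tensor_zmod_closed).

Definition tensor : Type := {ideal_quot tensor_relZ}.
HB.instance Definition _ := GRing.Zmodule.on tensor.

Definition tensor_pi (u : free) : tensor := \pi_({ideal_quot tensor_relZ})%qT u.

Definition tensor_repr (x : tensor) : free :=
  generic_quotient.repr (x : {ideal_quot tensor_relZ}).

Fact tensor_pi_is_zmod_morphism : zmod_morphism tensor_pi.
Proof. by move=> u v; rewrite /tensor_pi raddfB. Qed.
HB.instance Definition _ :=
  GRing.isZmodMorphism.Build free tensor tensor_pi tensor_pi_is_zmod_morphism.

Definition tens (m : M) (r : R) : tensor := tensor_pi << 1 *g (m, r) >>.

Lemma tensor_piP u : tensor_pi u = 0 <-> tensor_rel u.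
Proof.
rewrite -(raddf0 tensor_pi); split=> [/eqP|ru].
  by rewrite /tensor_pi -Quotient.idealrBE subr0 => /asboolP.
by apply/eqP; rewrite /tensor_pi -Quotient.idealrBE subr0; apply/asboolP.
Qed.

Lemma tensor_piK (x : tensor) : tensor_pi (tensor_repr x) = x.
Proof. exact: generic_quotient.reprK. Qed.

Lemma tensor_piU m r (c : int) : tensor_pi << c *g (m, r) >> = tens m r *~ c.
Proof. by rewrite /tens -raddfMz -(raddfMz (mkmalgU (m, r))) intz. Qed.

Lemma tensDl m m' r : tens (m + m') r = tens m r + tens m' r.
Proof.
have /tensor_piP/eqP := tensor_relDl m m' r.
by rewrite !raddfB /= -addrA -opprD subr_eq0 => /eqP.
Qed.

Lemma tensDr m r r' : tens m (r + r') = tens m r + tens m r'.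
Proof.
have /tensor_piP/eqP := tensor_relDr m r r'.
by rewrite !raddfB /= -addrA -opprD subr_eq0 => /eqP.
Qed.

Section FreeLift.
Variables (V : zmodType) (h : M * R -> V).

Definition free_lift (u : free) : V := \sum_(k <- msupp u) h k *~ u@_k.

Lemma free_liftw (d : {fset (M * R)%type}) u : (msupp u `<=` d)%fset ->
  free_lift u = \sum_(k <- d) h k *~ u@_k.
Proof.
move=> le; rewrite [LHS](big_fset_incl _ le) => //= x xd /mcoeff_outdom ->.
by rewrite mulr0z.
Qed.

Fact free_lift_is_zmod_morphism : zmod_morphism free_lift.
Proof.
move=> u v.
rewrite (free_liftw (msuppB_le u v)) (free_liftw (fsubsetUl _ (msupp v))).
rewrite (free_liftw (fsubsetUr (msupp u) _)) -sumrB.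
by apply: eq_bigr => k _; rewrite raddfB /= mulrzBr.
Qed.
HB.instance Definition _ :=
  GRing.isZmodMorphism.Build free V free_lift free_lift_is_zmod_morphism.

Lemma free_liftU k : free_lift << 1 *g k >> = h k.
Proof. by rewrite (free_liftw msuppU_le) big_seq_fset1 mcoeffUU. Qed.

End FreeLift.

Definition tensor_scale_gen (a : R) (u : free) : tensor :=
  free_lift (fun k => tens k.1 (a * k.2)) u.
Definition tensor_scale (a : R) (x : tensor) : tensor :=
  tensor_scale_gen a (tensor_repr x).

Lemma tensor_scale_pi a u : tensor_scale a (tensor_pi u) = tensor_scale_gen a u.
Proof.
apply/eqP; rewrite -subr_eq0 /tensor_scale /tensor_scale_gen -raddfB /=.
have: tensor_rel (tensor_repr (tensor_pi u) - u).
  by apply/tensor_piP; rewrite raddfB /= tensor_piK subrr.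
elim=> [|v w _ /eqP v0 _ /eqP w0|m m' r|m r r'].
- by rewrite raddf0.
- by rewrite raddfB /= v0 w0 subrr.
- by rewrite !raddfB /= !free_liftU /= tensDl addrAC addrK subrr.
- by rewrite !raddfB /= !free_liftU /= mulrDr tensDr addrAC addrK subrr.
Qed.

Lemma tensor_scaleE a m r : tensor_scale a (tens m r) = tens m (a * r).
Proof. by rewrite tensor_scale_pi /tensor_scale_gen free_liftU. Qed.

Lemma tensor_ind (P : tensor -> Prop) :
  (forall x y, P x -> P y -> P (x - y)) -> (forall m r, P (tens m r)) ->
  forall x, P x.
Proof.
move=> PB Pt x; have P0: P 0 by rewrite -(subrr (tens 0 0)); apply: PB.
have PN y : P y -> P (- y) by rewrite -sub0r; apply: PB.
have PD y z : P y -> P z -> P (y + z).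
  by move=> Py /PN Pz; rewrite -(opprK z); apply: PB.
rewrite -(tensor_piK x) [tensor_repr x]monalgE raddf_sum.
elim/big_ind: _ => // -[m r] _; move: (_@__) => c.
change (P (tensor_pi << c *g (m, r) >>)); rewrite tensor_piU.
have Pn n : P (tens m r *+ n) by elim: n => // n IHn; rewrite mulrS; apply: PD.
by case: c => n; rewrite ?NegzE ?mulrNz -?pmulrn //; apply: PN.
Qed.

Fact tensor_scaleBr a : {morph tensor_scale a : x y / x - y}.
Proof.
move=> x y; rewrite -(tensor_piK x) -(tensor_piK y) -raddfB !tensor_scale_pi.
by rewrite /tensor_scale_gen raddfB.
Qed.

Fact tensor_scaleDr : right_distributive tensor_scale +%R.
Proof.
move=> a x y; have scale0 : tensor_scale a 0 = 0.
  by rewrite -[in LHS](subrr 0) tensor_scaleBr subrr.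
rewrite -[in LHS](opprK y) tensor_scaleBr -[in X in _ - X](sub0r y).
by rewrite tensor_scaleBr scale0 sub0r opprK.
Qed.

Fact tensor_scaleA a b x :
  tensor_scale a (tensor_scale b x) = tensor_scale (a * b) x.
Proof.
elim/tensor_ind: x => [x y IHx IHy|m r]; first by rewrite !tensor_scaleBr IHx IHy.
by rewrite !tensor_scaleE mulrA.
Qed.

Fact tensor_scale1 : left_id 1 tensor_scale.
Proof.
elim/tensor_ind => [x y IHx IHy|m r]; first by rewrite !tensor_scaleBr IHx IHy.
by rewrite !tensor_scaleE mul1r.
Qed.

Fact tensor_scaleDl x : {morph tensor_scale^~ x : a b / a + b}.
Proof.
move=> a b /=; elim/tensor_ind: x => [x y IHx IHy|m r].
  by rewrite !tensor_scaleBr IHx IHy opprD addrACA.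
by rewrite !tensor_scaleE mulrDl tensDr.
Qed.

HB.instance Definition _ := GRing.Zmodule_isLmodule.Build R tensor
  tensor_scaleA tensor_scale1 tensor_scaleDr tensor_scaleDl.

End Tensor.

Definition torsion (R : idomainType) (V : lmodType R) : set V :=
  [set x : V | exists2 a : R, a != 0 & a *: x = 0]%classic.

(* |(M (x)_Z Z_l)_tor|; the torsion submodule is finite for M finitely
   generated (fset_set of an infinite set is empty). *)
Definition card_tensor_tor l (l_pr : prime l) (M : zmodType) : nat :=
  #|` fset_set (@torsion (padic_int l_pr) (tensor M (padic_int l_pr))) |%fset.

Section Lfunctions.
Variables (p : nat) (p_pr : prime p) (d : nat).
Variables (X : digraph) (alpha : edge X -> Gam p_pr d).

Definition volt_adj_mx : 'M[Phi p_pr d]_#|vertex X| :=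
  \matrix_(i, j)
    \sum_(e : edge X | (org e == enum_val j) && (ter e == enum_val i))
      \prod_(k < d) Tpow k (alpha e 0 k).

Definition Lp : Phi p_pr d := \det (map_mx intr (deg_mx X) - volt_adj_mx).
Definition Lp_BF : Phi p_pr d := \det (1%:M - volt_adj_mx).

End Lfunctions.

Definition bigO_oo (f : nat -> int) (g : nat -> nat) : Prop :=
  exists C N : nat, forall n, (N <= n)%N -> (`|f n|%N <= C * g n)%N.

(* Main.v *)
(** Write S for Gamma_n and T for Gamma_(n0), where n0 bounds the levels of the
    characters killing the L-function F (n0 = 0 for Pic, by strong connectivity).
    As l does not divide #|S|, the l-part of the torsion of the cokernel of the
    matrix M of size r over Z[S] splits into a constant part coming from Z[T] and
    the valuation of the determinant of M on I^r, where I is the kernel of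
    Z[S] -> Z[T]; this determinant is that of F = \det M on I.

    Write F = l^mu F0 with F0 nonzero modulo l, say with an invertible
    coefficient at g1.  If F0 x = 0 modulo l then F0^(l^k) x = 0, and F0^(l^k) is
    obtained from F0 modulo l by multiplying every group element by l^k.  The
    powers of l that are 1 modulo p^m fill the classes 1 + p^m t, so summing over
    them replaces each other [g - g1] by a multiple of the sum of the subgroup
    generated by h_g = p^m (g - g1).  Hence x = 0 modulo l as soon as its images
    in the rings Z[S / <h_g>] vanish, and the valuation of the determinant of F0
    on I is at most the sum of those of the analogous determinants for
    S / <h_g>.  These have size O(p^((d-1)n)) and bounded entries, whence the
    error term. *)

From HB Require Import structures.
Require Import Defs.
From mathcomp Require Import all_boot all_order all_fingroup all_algebra finmap.
From mathcomp Require Import boolp classical_sets functions cardinality.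
From mathcomp.multinomials Require Import monalg.
From mathcomp Require Import cyclic separable cyclotomic zify ring.

Set Implicit Arguments.
Unset Strict Implicit.
Unset Printing Implicit Defensive.

Import Order.TTheory GRing.Theory Num.Theory.
Local Open Scope ring_scope.

(** * Determinants of block matrices *)

(** Factoring the determinant over the characters would call for l-adic bounds on the values of F at
    roots of unity. Everything is kept over Z instead, and only kernels over Z/l^k are counted. For
    large k such a kernel has order l^(t + k z), with t the torsion exponent and z the corank, so
    that growth in k separates torsion from rank and no sequence of cokernels has to be shown exact.
    Frobenius offers only exponents that are powers of l, and a single power gives a single linear
    relation. Hence the averaging over the powers of one element 1 + p^m w, which become
    equidistributed in 1 + p^m Z modulo p^n. Neither m nor the support of F0 depends on n: the
    number of quotients to compare with stays fixed, while the order of h_g in Gamma_n is p^n up to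
    a bounded factor. This is what saves one dimension in the exponent of the error term. *)

Lemma poly_int_eq0 (f : {poly int}) : (forall t : nat, f.[t%:Z] = 0) -> f = 0.
Proof.
move=> f0; apply/eqP; apply: contraT => fn0.
have := @max_poly_roots _ f [seq t%:Z | t <- iota 0 (size f)] fn0.
rewrite size_map size_iota ltnn => -> //.
  by apply/allP => _ /mapP[t _ ->]; rewrite /root f0.
by rewrite map_inj_uniq ?iota_uniq // => x y [].
Qed.

Section PairIndex.
Variables (r m : nat).

Fact pair_ord_subproof (i : 'I_r) (j : 'I_m) : (i * m + j < r * m)%N.
Proof. by case: i j => [i ir] [j jm] /=; nia. Qed.
Definition pair_ord i j : 'I_(r * m) := Ordinal (pair_ord_subproof i j).

Fact ord_fst_subproof (k : 'I_(r * m)) : (k %/ m < r)%N.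
Proof. by case: k => k km /=; rewrite ltn_divLR //; nia. Qed.
Definition ord_fst k : 'I_r := Ordinal (ord_fst_subproof k).

Fact ord_snd_subproof (k : 'I_(r * m)) : (k %% m < m)%N.
Proof. by case: k => k km /=; rewrite ltn_mod; nia. Qed.
Definition ord_snd k : 'I_m := Ordinal (ord_snd_subproof k).

Lemma ord_fstK i j : ord_fst (pair_ord i j) = i.
Proof.
apply: val_inj => /=; have jm := ltn_ord j.
by rewrite divnMDl ?(leq_ltn_trans _ jm) // divn_small // addn0.
Qed.

Lemma ord_sndK i j : ord_snd (pair_ord i j) = j.
Proof. by apply: val_inj; rewrite /= modnMDl modn_small. Qed.

Lemma pair_ordK k : pair_ord (ord_fst k) (ord_snd k) = k.
Proof. by apply: val_inj; rewrite /= -divn_eq. Qed.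

Lemma sum_pair_ord (V : nmodType) (F : 'I_(r * m) -> V) :
  \sum_k F k = \sum_i \sum_j F (pair_ord i j).
Proof.
rewrite pair_bigA /= (reindex (fun ij : 'I_r * 'I_m => pair_ord ij.1 ij.2)) //=.
exists (fun k => (ord_fst k, ord_snd k)) => [[i j]|k] _ /=.
  by rewrite ord_fstK ord_sndK.
exact: pair_ordK.
Qed.

End PairIndex.

Section Blow.
Variables (A : comNzRingType) (m : nat) (rho : {rmorphism A -> 'M[int]_m}).

(** The action of [M] on r copies of the representation [rho]. For the permutation module of Gamma_n
    and the voltage matrices of X it yields the integral matrices of X_n. *)
Definition blow (r : nat) (M : 'M[A]_r) : 'M[int]_(r * m) :=
  \matrix_(i, j) rho (M (ord_fst i) (ord_fst j)) (ord_snd i) (ord_snd j).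

Lemma blowM r (M N : 'M[A]_r) : blow (M *m N) = blow M *m blow N.
Proof.
apply/matrixP => i j; rewrite !mxE (rmorph_sum rho) summxE sum_pair_ord.
apply: eq_bigr => k _. rewrite (rmorphM rho) mxE; apply: eq_bigr => k' _.
by rewrite !mxE !ord_fstK !ord_sndK.
Qed.

(** The cast is accepted because [r.+1 * m] computes to [m + r * m]. *)
Lemma blow_block r (M : 'M[A]_r.+1) :
  blow M = block_mx (rho (M 0 0))
    (\matrix_(i, j) rho (M 0 (lift 0 (ord_fst j))) i (ord_snd j))
    (\matrix_(i, j) rho (M (lift 0 (ord_fst i)) 0) (ord_snd i) j)
    (blow (\matrix_(i, j) M (lift 0 i) (lift 0 j))) :> 'M_(m + r * m).
Proof.
have lE (k : 'I_m) : ord_fst (lshift (r * m) k : 'I_(r.+1 * m)) = 0.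
  by apply: val_inj; rewrite /= divn_small.
have lE2 (k : 'I_m) : ord_snd (lshift (r * m) k : 'I_(r.+1 * m)) = k.
  by apply: val_inj; rewrite /= modn_small.
have rE (k : 'I_(r * m)) : ord_fst (rshift m k : 'I_(r.+1 * m)) = lift 0 (ord_fst k).
  apply: val_inj; rewrite /= -[X in ((X + _) %/ _)%N]mul1n divnMDl //.
  by case: (m) k => [|//] [k]; rewrite muln0.
have rE2 (k : 'I_(r * m)) : ord_snd (rshift m k : 'I_(r.+1 * m)) = ord_snd k.
  by apply: val_inj; rewrite /= modnDl.
apply/matrixP => i j.
case: (splitP i) => i' iE; case: (splitP j) => j' jE.
- have -> : i = lshift (r * m) i' by apply: val_inj.
  have -> : j = lshift (r * m) j' by apply: val_inj.
  by rewrite block_mxEul mxE !lE !lE2.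
- have -> : i = lshift (r * m) i' by apply: val_inj.
  have -> : j = rshift m j' by apply: val_inj.
  by rewrite block_mxEur !mxE lE rE lE2 rE2.
- have -> : i = rshift m i' by apply: val_inj.
  have -> : j = lshift (r * m) j' by apply: val_inj.
  by rewrite block_mxEdl !mxE lE rE lE2 rE2.
- have -> : i = rshift m i' by apply: val_inj.
  have -> : j = rshift m j' by apply: val_inj.
  by rewrite block_mxEdr !mxE !rE !rE2.
Qed.

Lemma det_blow_lower r (M : 'M[A]_r.+1) : (forall j, M 0 (lift 0 j) = 0) ->
  \det (blow M) =
  \det (rho (M 0 0)) * \det (blow (\matrix_(i, j) M (lift 0 i) (lift 0 j))).
Proof.
move=> M0; rewrite blow_block (_ : (\matrix_(i, j) _) = 0); first exact: det_lblock.
by apply/matrixP => i j; rewrite !mxE M0 raddf0 mxE.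
Qed.

Lemma det_blow_upper r (M : 'M[A]_r.+1) : (forall i, M (lift 0 i) 0 = 0) ->
  \det (blow M) =
  \det (rho (M 0 0)) * \det (blow (\matrix_(i, j) M (lift 0 i) (lift 0 j))).
Proof.
move=> M0; rewrite blow_block.
rewrite [X in block_mx _ _ X _](_ : _ = 0); first exact: det_ublock.
by apply/matrixP => i j; rewrite !mxE M0 raddf0 mxE.
Qed.

End Blow.

Lemma det_lower (A : comNzRingType) r (M : 'M[A]_r.+1) :
  (forall j, M 0 (lift 0 j) = 0) ->
  \det M = M 0 0 * \det (\matrix_(i, j) M (lift 0 i) (lift 0 j)).
Proof.
move=> M0; rewrite (expand_det_row _ 0) (bigD1 ord0) //= big1 ?addr0; last first.
  by move=> j j0; case: (unliftP ord0 j) j0 => [j' ->|->] //; rewrite M0 mul0r.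
rewrite /cofactor addn0 expr0 mul1r; congr (_ * \det _).
by apply/matrixP => i j; rewrite !mxE.
Qed.

Lemma det_upper (A : comNzRingType) r (M : 'M[A]_r.+1) :
  (forall i, M (lift 0 i) 0 = 0) ->
  \det M = M 0 0 * \det (\matrix_(i, j) M (lift 0 i) (lift 0 j)).
Proof.
move=> M0; rewrite -det_tr det_lower => [|j]; last by rewrite mxE M0.
by rewrite mxE -det_tr; congr (_ * \det _); apply/matrixP => i j; rewrite !mxE.
Qed.

Section DetBlow.
Variables (A : comNzRingType) (m : nat) (rho : {rmorphism A -> 'M[int]_m}).

Let det_rhoM x y : \det (rho (x * y)) = \det (rho x) * \det (rho y).
Proof. by rewrite (rmorphM rho); exact: det_mulmx. Qed.

Let det_rho1 : \det (rho 1) = 1.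
Proof. by rewrite (rmorph1 rho); exact: det1. Qed.

Let det_rhoX x n : \det (rho (x ^+ n)) = \det (rho x) ^+ n.
Proof.
by elim: n => [|n IHn]; rewrite ?det_rho1 // !exprS det_rhoM IHn.
Qed.

(** One step of elimination without division: [N] clears the first row outside the pivot a =
    [M 0 0], at the price of scaling the other columns by a. This is the origin of the r-th power on
    both sides. *)
Let det_blow_pivot r (M : 'M[A]_r.+1) :
  (forall N : 'M[A]_r, \det (blow rho N) = \det (rho (\det N))) ->
  \det (blow rho M) * \det (rho (M 0 0)) ^+ r =
  \det (rho (\det M)) * \det (rho (M 0 0)) ^+ r.
Proof.
move=> IH; set a := M 0 0.
pose N : 'M[A]_r.+1 := \matrix_(i, j)
  if unlift 0 j is Some j' then
    if unlift 0 i is Some i' then a *+ (i' == j') else - M 0 j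
  else (i == 0)%:R.
have N0 i : N (lift 0 i) 0 = 0 by rewrite mxE unlift_none.
have N00 : N 0 0 = 1 by rewrite mxE unlift_none eqxx.
have NE : (\matrix_(i, j) N (lift 0 i) (lift 0 j)) = a%:M.
  by apply/matrixP => i j; rewrite !mxE !liftK.
have MN00 : (M *m N) 0 0 = a.
  rewrite mxE big_ord_recl N00 mulr1 big1 ?addr0 // => i _.
  by rewrite N0 mulr0.
have MN0 j : (M *m N) 0 (lift 0 j) = 0.
  rewrite mxE big_ord_recl (bigD1 j) //= big1 ?addr0; last first.
    by move=> i /negPf ij; rewrite !mxE !liftK ij mulr0.
  by rewrite !mxE !liftK unlift_none eqxx mulr1n mulrN mulrC addrC subrr.
have dN : \det N = a ^+ r by rewrite det_upper // N00 NE mul1r det_scalar.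
have dbN : \det (blow rho N) = \det (rho a) ^+ r.
  by rewrite det_blow_upper // N00 NE IH det_scalar det_rhoX det_rho1 mul1r.
rewrite -[in LHS]dbN -[in RHS]det_rhoX -dN -det_rhoM.
rewrite -(det_mulmx (blow rho M)) -blowM -det_mulmx det_blow_lower // IH.
by rewrite MN00 -det_rhoM (det_lower MN0) MN00.
Qed.

(* The pivot M 0 0 need not be a non-zero-divisor, so it is first shifted by an
   integer t; both sides are polynomials in t. *)
Lemma det_blow r (M : 'M[A]_r) : \det (blow rho M) = \det (rho (\det M)).
Proof.
elim: r M => [|r IHr] M; first by rewrite !det_mx00 det_rho1.
pose E : 'M[A]_r.+1 := delta_mx 0 0.
(* The shift changes only the first row, so the determinant is affine in t, and its slope is the
   determinant of [M']. *)
pose M' : 'M[A]_r.+1 := \matrix_(i, j) if i == 0 then (j == 0)%:R else M i j.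
pose Mt (t : nat) := M + t%:R *: E.
have detMt t : \det (Mt t) = \det M + t%:R * \det M'.
  rewrite -[X in X + _]mul1r; apply: (@determinant_multilinear _ _ _ _ _ 0).
  - by apply/rowP => j; rewrite !mxE eqxx mul1r.
  - by apply/matrixP => i j; rewrite !mxE /= ?mulr0 ?addr0.
  - by apply/matrixP => i j; rewrite !mxE /= mulr0 addr0.
pose cst n (B : 'M[int]_n) : 'M[{poly int}]_n := map_mx polyC B.
pose G1 := \det (cst _ (blow rho M) + 'X *: cst _ (blow rho E)).
pose G2 := \det (cst _ (rho (\det M)) + 'X *: cst _ (rho (\det M'))).
pose H := \det (cst _ (rho (M 0 0)) + 'X%:M).
have evalE n (B : 'M[{poly int}]_n) (t : int) :
    (\det B).[t] = \det (map_mx (horner_eval t) B).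
  by rewrite det_map_mx.
have rho_t x y (t : nat) : rho (x + t%:R * y) = rho x + t%:R *: rho y.
  by rewrite (rmorphD rho) mulr_natl (rmorphMn rho) scaler_nat.
have G1E t : G1.[t%:Z] = \det (blow rho (Mt t)).
  rewrite evalE; congr (\det _); apply/matrixP => i j.
  rewrite !mxE rho_t !mxE /horner_eval /= !hornerE; ring.
have G2E t : G2.[t%:Z] = \det (rho (\det (Mt t))).
  rewrite evalE detMt rho_t; congr (\det _); apply/matrixP => i j.
  rewrite !mxE /horner_eval /= !hornerE; ring.
have HE t : H.[t%:Z] = \det (rho (Mt t 0 0)).
  rewrite evalE !mxE eqxx rho_t (rmorph1 rho); congr (\det _).
  apply/matrixP => i j; rewrite !mxE /horner_eval /= !hornerE.
  by case: (i == j); rewrite ?hornerE; ring.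
(* [H] is a characteristic polynomial, hence monic and cancellable, whereas the determinant of
   [rho (M 0 0)] itself may vanish. *)
have Hn0 : H != 0.
  suff -> : H = char_poly (- rho (M 0 0)) by rewrite monic_neq0 ?char_poly_monic.
  rewrite /char_poly /char_poly_mx; congr (\det _).
  by rewrite addrC; congr (_ + _); apply/matrixP => i j; rewrite !mxE polyCN opprK.
suff : (G1 - G2) * H ^+ r = 0.
  move/eqP; rewrite mulf_eq0 expf_eq0 (negPf Hn0) andbF orbF subr_eq0 => /eqP G12.
  by have := G1E 0%N; rewrite G12 G2E /Mt scale0r addr0.
apply: poly_int_eq0 => t; rewrite !hornerE G1E G2E HE; apply/eqP.
by rewrite mulrBl subr_eq0; apply/eqP; exact: det_blow_pivot.
Qed.

End DetBlow.

(** * Kernels modulo a prime power *)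

Notation zmx R M := (map_mx (fun c : int => c%:~R : R) M).

(* Over Z/q kernel and cokernel have the same cardinality; kernels are easier to
   split. *)
Definition kercount q n (M : 'M[int]_n) : nat :=
  #|[set x : 'cV['Z_q]_n | zmx 'Z_q M *m x == 0]|.

Definition ordz (l : nat) (c : int) : nat := logn l `|c|%N.

Lemma ltn_exp1 l k : prime l -> (0 < k)%N -> (1 < l ^ k)%N.
Proof. by move=> l_pr k0; rewrite -(exp1n k) ltn_exp2r // prime_gt1. Qed.

Lemma Zq_intr_eq0 q (c : int) : (1 < q)%N -> (c%:~R == 0 :> 'Z_q) = (q %| `|c|)%N.
Proof.
move=> q1; have nat0 n : (n%:R == 0 :> 'Z_q) = (q %| n)%N.
  by rewrite -val_eqE /= val_Zp_nat.
by case: c => n; rewrite ?NegzE ?mulrNz ?oppr_eq0 -pmulrn nat0 // abszN.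
Qed.

Lemma card_Zl_ann l k (c : int) : prime l -> (0 < k)%N -> c != 0 ->
  (ordz l c <= k)%N ->
  #|[set y : 'Z_(l ^ k) | c%:~R * y == 0]| = (l ^ ordz l c)%N.
Proof.
move=> l_pr k0 c0 vk; set v := ordz l c; have q1 := ltn_exp1 l_pr k0.
have lv0 : (0 < l ^ (k - v))%N by rewrite expn_gt0 prime_gt0.
have qE : (Zp_trunc (l ^ k)).+2 = (l ^ k)%N by rewrite Zp_cast.
have lt_t (t : 'I_(l ^ v)) : (t * l ^ (k - v) < (Zp_trunc (l ^ k)).+2)%N.
  by rewrite qE -{2}(subnK vk) expnD mulnC ltn_pmul2l.
(* Write c = l^v c' with c' prime to l: the annihilator consists of the multiples of l^(k - v),
   which [f] lists. *)
pose f (t : 'I_(l ^ v)) : 'Z_(l ^ k) := Ordinal (lt_t t).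
have f_inj : injective f.
  move=> s t /(congr1 val) /= /eqP; rewrite eqn_pmul2r // => /eqP st.
  exact: val_inj.
rewrite -[RHS]card_ord -cardsT -(card_imset _ f_inj); apply: eq_card => y.
rewrite !inE; have -> : c%:~R * y = (c * y%:Z)%:~R.
  by rewrite intrM -[X in _ = _ * X]pmulrn natr_Zp.
rewrite Zq_intr_eq0 // abszM /=.
have [c' lc' cE] := pfactor_coprime l_pr (etrans (absz_gt0 c) c0).
have -> : (l ^ k %| `|c| * y)%N = (l ^ (k - v) %| y)%N.
  rewrite cE -/(ordz l c) -/v -{1}(subnK vk) expnD mulnAC.
  by rewrite dvdn_pmul2r ?expn_gt0 ?prime_gt0 // Gauss_dvdr // coprimeXl.
apply/idP/imsetP => [/dvdnP[t yE]|[t _ ->]]; last by rewrite /= dvdn_mull.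
have tlt : (t < l ^ v)%N.
  have := ltn_ord y; rewrite [X in (X < _)%N]yE [X in (_ < X)%N]qE -{2}(subnK vk) expnD.
  by rewrite mulnC ltn_pmul2l.
by exists (Ordinal tlt) => //; apply: val_inj.
Qed.

Lemma kercount_diag q n (D : 'M[int]_n) : is_diag_mx D ->
  kercount q D = (\prod_i #|[set y : 'Z_q | ((D i i)%:~R * y == 0)%R]|)%N.
Proof.
move=> Ddiag; pose F i := [set y : 'Z_q | (D i i)%:~R * y == 0].
change (kercount q D = \prod_i #|F i|)%N.
have -> : (\prod_i #|F i| = #|(family F : pred {ffun 'I_n -> 'Z_q})|)%N.
  by rewrite card_family foldrE big_map big_enum.
rewrite -(card_imset _ (f := fun x : {ffun 'I_n -> 'Z_q} => (\col_i x i) : 'cV_n)).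
  apply: eq_card => x; rewrite inE; apply/eqP/imsetP => [Dx|[y /familyP yF ->]].
    exists [ffun i => x i 0]; last by apply/colP => i; rewrite mxE ffunE.
    apply/familyP => i; rewrite inE ffunE; move/colP/(_ i): Dx.
    rewrite !mxE (bigD1 i) //= big1 ?addr0 => [|j ji].
      by rewrite !mxE => ->.
    by rewrite !mxE (is_diag_mxP Ddiag) ?mul0r // eq_sym.
  apply/colP => i; rewrite !mxE (bigD1 i) //= big1 ?addr0 => [|j ji].
    by have := yF i; rewrite inE !mxE => /eqP.
  by rewrite !mxE (is_diag_mxP Ddiag) ?mul0r // eq_sym.
by move=> x y /colP xy; apply/ffunP => i; have := xy i; rewrite !mxE.
Qed.

Lemma zmx_mul (R : pzRingType) m n p (M : 'M[int]_(m, n)) (N : 'M[int]_(n, p)) :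
  zmx R (M *m N) = zmx R M *m zmx R N.
Proof. exact: map_mxM. Qed.

Lemma zmx1 (R : pzRingType) n : zmx R (1%:M : 'M[int]_n) = 1%:M.
Proof. exact: map_mx1. Qed.

Lemma kercount_unim q n (L M R : 'M[int]_n) : L \in unitmx -> R \in unitmx ->
  kercount q (L *m M *m R) = kercount q M.
Proof.
move=> Lu Ru; pose f (x : 'cV['Z_q]_n) := zmx 'Z_q R *m x.
have fK : cancel f (fun x => zmx 'Z_q (invmx R) *m x).
  by move=> x; rewrite /f mulmxA -zmx_mul mulVmx // zmx1 mul1mx.
have fK' : cancel (fun x => zmx 'Z_q (invmx R) *m x) f.
  by move=> x; rewrite /f mulmxA -zmx_mul mulmxV // zmx1 mul1mx.
rewrite /kercount -(card_imset _ (can_inj fK)); apply: eq_card => x; rewrite inE.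
apply/imsetP/eqP => [[y + ->]|Mx].
  rewrite inE !zmx_mul -!mulmxA => /eqP LMR; rewrite /f.
  rewrite -[LHS]mul1mx -(zmx1 _ n) -(mulVmx Lu) zmx_mul -mulmxA.
  by rewrite LMR mulmx0.
exists (zmx 'Z_q (invmx R) *m x); last by rewrite fK'.
have := fK' x; rewrite /f /= => fE.
rewrite inE !zmx_mul -!mulmxA. by rewrite fE Mx mulmx0.
Qed.

(** * Division of p-adic integers *)

Section PadicDivision.
Variables (p : nat) (p_pr : prime p).
Implicit Types x : padic_int p_pr.

Lemma padic_nat_res (c n : nat) : ((c%:R : padic_int p_pr) n = c %% p ^ n :> nat)%N.
Proof.
elim: c => [|c IHc]; first by rewrite mod0n.
rewrite -[c.+1]addn1 natrD /=; move: IHc; set y := nat_of_ord _ => IHc.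
clearbody y; by rewrite (ppow_prednK p_pr) IHc modnDml modnDmr.
Qed.

Lemma padicMn_res x (c n : nat) : ((x *+ c) n = c * x n %% p ^ n :> nat)%N.
Proof.
rewrite -mulr_natl /=; have := padic_nat_res c n; set y := nat_of_ord _ => ->.
set z := nat_of_ord (x n); by rewrite (ppow_prednK p_pr) modnMml.
Qed.

Lemma padic_of_seq (z : nat -> nat) :
  (forall n, z n.+1 = z n %[mod p ^ n])%N ->
  exists y : padic_int p_pr, forall n, y n = (z n %% p ^ n)%N :> nat.
Proof.
move=> zS.
have y_res : `[< forall n, inZp (inZp (z n.+1) : Zmod (p ^ n.+1)) = inZp (z n) :> Zmod (p ^ n) >].
  apply/asboolP => n; apply: val_inj => /=; rewrite modn_dvdm ?ppow_dvd //.
  by rewrite !(ppow_prednK p_pr) zS.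
by exists (PadicInt p_pr y_res) => n /=; rewrite (ppow_prednK p_pr).
Qed.

Lemma padic_res_modn0 x n m : (n <= m)%N -> (x n = 0 :> nat) ->
  (p ^ n %| x m)%N.
Proof. by move=> nm xn0; rewrite /dvdn padic_res_modn // xn0. Qed.

Lemma padic_div_ppow x v : x v = 0 :> nat -> exists y, x = y *+ p ^ v.
Proof.
move=> xv0; pose z n := (x (n + v) %/ p ^ v)%N.
have zE n : (z n * p ^ v = x (n + v))%N.
  by rewrite divnK // (padic_res_modn0 _ xv0) // leq_addl.
have pv0 : (0 < p ^ v)%N by rewrite expn_gt0 prime_gt0.
have zS n : (z n.+1 = z n %[mod p ^ n])%N.
  apply/eqP; rewrite -(eqn_pmul2r pv0) !muln_modl // -expnD !zE.
  by rewrite !padic_res_modn // leq_add2r.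
have [y yE] := padic_of_seq zS; exists y; apply: padicP => n; apply: val_inj.
rewrite [RHS]padicMn_res yE modnMmr mulnC zE.
by rewrite padic_res_modn // leq_addr.
Qed.

Lemma padic_div_coprime x u : coprime p u -> exists y, x = y *+ u.
Proof.
move=> pu; pose inv n := (egcdn u (p ^ n)).1.
have u0 : (0 < u)%N.
  by rewrite lt0n; apply: contraTneq pu => ->; rewrite /coprime gcdn0 neq_ltn prime_gt1 ?orbT.
have invE n : (inv n * u = 1 %[mod p ^ n])%N.
  rewrite /inv; case: egcdnP => // km kn -> _; rewrite modnMDl.
  by have := coprimeXl n pu; rewrite coprime_sym => /eqP ->.
pose z n := (inv n * x n)%N.
have zE n : (z n * u = x n %[mod p ^ n])%N.
  by rewrite /z mulnAC -modnMml invE modnMml mul1n.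
have zS n : (z n.+1 = z n %[mod p ^ n])%N.
  have: (z n.+1 * u = z n * u %[mod p ^ n])%N.
    rewrite zE -[in RHS](padic_res_modn x (leqnSn n)) modn_mod.
    have := congr1 (modn^~ (p ^ n))%N (zE n.+1); rewrite !modn_dvdm //; exact: dvdn_exp2l.
  have invK w : (w * u * inv n = w %[mod p ^ n])%N.
    by rewrite -mulnA (mulnC u) -modnMmr invE modnMmr muln1.
  by move=> zu; rewrite -(invK (z n.+1)) -modnMml zu modnMml invK.
have [y yE] := padic_of_seq zS; exists y; apply: padicP => n; apply: val_inj.
rewrite [RHS]padicMn_res yE modnMmr mulnC zE.
by rewrite padic_res_modn.
Qed.

Lemma padic_divn x c : (0 < c)%N -> x (logn p c) = 0 :> nat ->
  exists y, x = y *+ c.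
Proof.
move=> c0 xv; have [u pu ->] := pfactor_coprime p_pr c0.
have [y ->] := padic_div_ppow xv; have [z ->] := padic_div_coprime y pu.
by exists z; rewrite mulrnA.
Qed.

Lemma padic_natr_neq0 c : (0 < c)%N -> (c%:R : padic_int p_pr) != 0.
Proof.
move=> c0; apply/eqP => cE.
have := padic_nat_res c c; rewrite cE (modn_small (ltn_expl c (prime_gt1 p_pr))).
by move=> /esym c00; rewrite c00 ltnn in c0.
Qed.

Lemma padicB_natr_res x m : (x - (nat_of_ord (x m))%:R) m = 0 :> nat.
Proof.
have -> : (x - (nat_of_ord (x m))%:R) m = x m - ((nat_of_ord (x m))%:R : padic_int p_pr) m.
  by [].
suff -> : ((nat_of_ord (x m))%:R : padic_int p_pr) m = x m by rewrite subrr.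
apply: val_inj; rewrite [LHS]padic_nat_res modn_small //.
by have := ltn_ord (x m); rewrite [X in (_ < X)%N](ppow_prednK p_pr).
Qed.

End PadicDivision.

(** * Torsion of the l-adic cokernel *)

(** Universal property of the tensor product: biadditive maps respect its defining relations. It
    serves to prove that tensors are nonzero. *)
Lemma free_lift_rel0 (N : zmodType) (R : comNzRingType) (V : zmodType)
    (h : (N * R)%type -> V) :
  (forall m m' r, h (m + m', r) = h (m, r) + h (m', r)) ->
  (forall m r r', h (m, r + r') = h (m, r) + h (m, r')) ->
  forall u, tensor_rel u -> free_lift h u = 0.
Proof.
move=> hl hr u; elim=> [|v w _ v0 _ w0|m m' r|m r r'].
- exact: raddf0.
- by rewrite raddfB /= v0 w0 subrr.
- by rewrite !raddfB /= !free_liftU hl addrAC addrK subrr.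
- by rewrite !raddfB /= !free_liftU hr addrAC addrK subrr.
Qed.

Section TensorCoker.
Variables (l : nat) (l_pr : prime l) (n : nat) (L D R : 'M[int]_n).
Hypotheses (Lu : L \in unitmx) (Ru : R \in unitmx) (Ddiag : is_diag_mx D).
Let M := L *m D *m R.
Let d i := D i i.
Local Notation Zl := (padic_int l_pr).
Local Notation tensM := (tensor (coker M) Zl).

Let cl (x : 'cV[int]_n) : coker M := \pi_(coker M)%qT x.

Let clB : {morph cl : x y / x - y}.
Proof. by move=> x y; rewrite /cl raddfB. Qed.

HB.instance Definition _ := GRing.isZmodMorphism.Build _ _ cl clB.

Let cl_eq0 x : (cl x == 0) = mx_image M x.
Proof. by rewrite -(raddf0 cl) /cl -Quotient.idealrBE subr0. Qed.

(** The image of [M] is that of [L *m D], so the i-th column of [L] generates a cyclic summand Z/(d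
    i) of the cokernel. *)
Let basis i : coker M := cl (L *m delta_mx i 0).

Let basis_ann i : basis i *~ d i = 0.
Proof.
rewrite /basis -raddfMz; apply/eqP; rewrite cl_eq0; apply/asboolP.
exists (invmx R *m delta_mx i 0); rewrite /M -!mulmxA (mulmxA R) mulmxV // mul1mx.
rewrite -(raddfMz (mulmx L)); congr (_ *m _); apply/colP => j.
rewrite [RHS]mxE (bigD1 i) //= big1 ?addr0 => [|k ki].
  rewrite !mxE eqxx mulr1 -scaler_int !mxE; case: eqVneq => [->|ji] /=.
    by rewrite mulr1 intz.
  by rewrite mulr0 (is_diag_mxP Ddiag) // eq_sym.
by rewrite !mxE (negPf ki) mulr0.
Qed.

(* Every tensor is of this form, the coordinate i being unique modulo d i. *)
Let nf (a : 'I_n -> Zl) : tensM := \sum_i tens (basis i) (a i).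

Let tensBr (m : coker M) r r' : tens m (r - r') = tens m r - tens m r' :> tensM.
Proof. by apply/esym/eqP; rewrite subr_eq -tensDr subrK. Qed.

Let tens0r (m : coker M) : tens m 0 = 0 :> tensM.
Proof. by rewrite -(subrr 0) tensBr subrr. Qed.

Let tensBl (m m' : coker M) r : tens (m - m') r = tens m r - tens m' r :> tensM.
Proof. by apply/esym/eqP; rewrite subr_eq -tensDl subrK. Qed.

Let tens0l r : tens 0 r = 0 :> tensM.
Proof. by rewrite -(subrr 0) tensBl subrr. Qed.

Let tensMnl (m : coker M) r k : tens (m *+ k) r = tens m (r *+ k) :> tensM.
Proof.
elim: k => [|k IHk]; first by rewrite tens0l tens0r.
by rewrite !mulrS tensDl tensDr IHk.
Qed.

Let tensMzl (m : coker M) r c : tens (m *~ c) r = tens m (r *~ c) :> tensM.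
Proof.
case: c => k; first exact: tensMnl.
rewrite NegzE !mulrNz -[X in tens X _ = _]sub0r -[X in _ = tens _ X]sub0r.
by rewrite tensBl tensBr tens0l tens0r tensMnl.
Qed.

Let nfB a b : nf (fun i => a i - b i) = nf a - nf b.
Proof. by rewrite /nf -sumrB; apply: eq_bigr => i _; rewrite tensBr. Qed.

Let nfP (t : tensM) : exists a, t = nf a.
Proof.
elim/tensor_ind: t => [x y [a ->] [b ->]|m r].
  by exists (fun i => a i - b i); rewrite nfB.
have [x ->] : exists x, m = cl x.
  by exists (generic_quotient.repr m); rewrite /cl generic_quotient.reprK.
pose y := invmx L *m x.
have -> : cl x = \sum_i basis i *~ y i 0.
  rewrite -[x in LHS]mul1mx -(mulmxV Lu) -mulmxA -/y [y in LHS]matrix_sum_delta.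
  rewrite mulmx_sumr raddf_sum /=; apply: eq_bigr => i _.
  by rewrite big_ord1 -(raddfMz cl) -(raddfMz (mulmx L)) -scaler_int intz.
exists (fun i => r *~ y i 0); rewrite /nf.
elim/big_ind2: _ => [|m1 t1 m2 t2 <- <-|i _]; rewrite ?tens0l ?tensDl ?tensMzl //.
Qed.

Let nf_scale c a : c *: nf a = nf (fun i => c * a i).
Proof. by rewrite /nf scaler_sumr; apply: eq_bigr => i _; exact: tensor_scaleE. Qed.

Let term_eq0 i (a : Zl) : a (ordz l (d i)) = 0 :> nat -> d i != 0 -> tens (basis i) a = 0 :> tensM.
Proof.
move=> a0 di0; have := @padic_divn l l_pr a `|d i|%N; rewrite absz_gt0 => /(_ di0 a0).
move=> [b ->].
have: tens (basis i *~ d i) b = 0 :> tensM by rewrite basis_ann tens0l.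
rewrite (tensMzl (basis i) b (d i)); move: (d i) => [] k; first by [].
rewrite NegzE abszN mulrNz -[- _]sub0r tensBr tens0r sub0r => /eqP.
by rewrite oppr_eq0 => /eqP.
Qed.

(** Computed on a chosen representative, hence meaningful only modulo [d i]. *)
Let coord (i : 'I_n) (q : coker M) : int := (invmx L *m generic_quotient.repr q) i 0.

Let coord_cl i x : exists c, coord i (cl x) = (invmx L *m x) i 0 + d i * c.
Proof.
have: cl (generic_quotient.repr (cl x) - x) == 0.
  by rewrite raddfB /= /cl generic_quotient.reprK subrr.
rewrite cl_eq0 => /asboolP[w wE].
exists ((R *m w) i 0); rewrite /coord -[generic_quotient.repr _](subrK x) wE.
have -> : invmx L *m (M *m w + x) = invmx L *m x + D *m (R *m w).
  by rewrite mulmxDr addrC /M -!mulmxA (mulmxA (invmx L)) mulVmx // mul1mx.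
rewrite mxE; congr (_ + _); rewrite mxE (bigD1 i) //= big1 ?addr0 // => j ji.
by rewrite (is_diag_mxP Ddiag) ?mul0r // eq_sym.
Qed.

Section Detect.
Variables (i : 'I_n) (m : nat).
Hypothesis mP : d i = 0 \/ (m <= ordz l (d i))%N.

(** Biadditive since l^m divides [d i], which absorbs the ambiguity of [coord]. If [d i] is 0, every
    m is allowed and the whole l-adic coordinate is detected. *)
Let h (k : (coker M * Zl)%type) : Zmod (l ^ m) := (k.2 m) *~ coord i k.1.

Let d_ann (x : Zmod (l ^ m)) c : x *~ (d i * c) = 0.
Proof.
have: (l ^ m %| `|(d i * c)%R|)%N.
  case: mP => [->|mv]; first by rewrite mul0r dvdn0.
  rewrite abszM dvdn_mulr //; have [->|di0] := eqVneq (d i) 0; first exact: dvdn0.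
  by rewrite pfactor_dvdn // absz_gt0.
move: (d i * c) => e /dvdnP[k eE].
have xn : x *+ (l ^ m) = 0.
  apply: val_inj; by rewrite /= Zp_mulrn /= -[X in (_ * X)%N](ppow_prednK l_pr) modnMl.
have xe : x *+ `|e| = 0 by rewrite eE mulnC mulrnA xn mul0rn.
case: e {eE} xe => e xe; first exact: xe.
by rewrite -[LHS]/(- (x *+ e.+1)) [x *+ _]xe oppr0.
Qed.

Let h_cl x a : h (cl x, a) = a m *~ (invmx L *m x) i 0.
Proof. by rewrite /h /=; have [c ->] := coord_cl i x; rewrite mulrzDr d_ann addr0. Qed.

Let clP q : exists x, q = cl x.
Proof. by exists (generic_quotient.repr q); rewrite /cl generic_quotient.reprK. Qed.

Let free_lift_rel u : tensor_rel u -> free_lift h u = 0.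
Proof.
apply: free_lift_rel0 => [q q' r|q r r'].
  have [x ->] := clP q; have [x' ->] := clP q'.
  have -> : cl x + cl x' = cl (x + x') by exact/esym/raddfD.
  by rewrite !h_cl mulmxDr mxE mulrzDr.
have [x ->] := clP q.
by rewrite !h_cl [(r + r') m]/(r m + r' m) mulrzDl.
Qed.

Let nf_eq0_res a : nf a = 0 -> a i m = 0 :> nat.
Proof.
move=> nfa0; have /free_lift_rel : tensor_rel (\sum_j << 1 *g (basis j, a j) >>).
  by apply/tensor_piP; rewrite raddf_sum.
rewrite raddf_sum /= (bigD1 i) //= big1 ?addr0 => [|j ji].
  rewrite free_liftU h_cl mulmxA mulVmx // mul1mx !mxE !eqxx mulr1z.
  by move/(congr1 val).
by rewrite free_liftU h_cl mulmxA mulVmx // mul1mx !mxE eq_sym (negPf ji) mulr0z.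
Qed.

Lemma nf_inj_res a b : nf a = nf b -> a i m = b i m :> nat.
Proof.
move=> ab; have := @nf_eq0_res (fun i => a i - b i).
rewrite nfB ab subrr => /(_ erefl) abm.
suff /eqP : a i m - b i m = 0 by rewrite subr_eq0 => /eqP ->.
exact: val_inj.
Qed.

End Detect.

(** The number of values of the i-th coordinate on torsion elements: a free summand contributes only
    0. The common bound [bdmax] serves to place all coordinates in one finite type. *)
Let bd i := if d i == 0 then 1%N else (l ^ ordz l (d i))%N.
Let bdmax := (\sum_i bd i)%N.

Let bd_le i : (bd i <= bdmax)%N.
Proof. by rewrite /bdmax (bigD1 i) //= leq_addr. Qed.

Let box : {pred {ffun 'I_n -> 'I_bdmax}} := family (fun i => [set c : 'I_bdmax | (c < bd i)%N]).

Let boxP (c : {ffun 'I_n -> 'I_bdmax}) :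
  reflect (forall i, (c i < bd i)%N) (c \in box).
Proof. by apply: (iffP familyP) => cB i; have := cB i; rewrite inE. Qed.

Let nfc (c : {ffun 'I_n -> 'I_bdmax}) : tensM := nf (fun i => (c i)%:R).

Let nfc_inj : {in box &, injective nfc}.
Proof.
move=> a b /boxP aB /boxP bB ab; apply/ffunP => i; apply: val_inj.
have := aB i; have := bB i; rewrite /bd.
case: (eqVneq (d i) 0) => [di0|di0].
  by rewrite !ltnS !leqn0 => /eqP bi0 /eqP ai0; rewrite [LHS]ai0 [RHS]bi0.
move=> bi ai; have := @nf_inj_res i _ (or_intror (leqnn _)) _ _ ab.
by rewrite !padic_nat_res !modn_small.
Qed.

Let torsionE : torsion (V := tensM) = [set` [fset nfc c | c in box]%fset]%classic.
Proof.
apply/seteqP; split => [t [s s0]|_ /imfsetP[/= c /boxP cB ->]].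
  have [a -> sa0] := nfP t; rewrite nf_scale in sa0.
  pose c0 i := if d i == 0 then 0%N else nat_of_ord (a i (ordz l (d i))).
  have c0_lt i : (c0 i < bd i)%N.
    rewrite /c0 /bd; case: ifP => // _.
    by have := ltn_ord (a i (ordz l (d i))); rewrite [X in (_ < X)%N](ppow_prednK l_pr).
  have c0_lt' i : (c0 i < bdmax)%N by exact: leq_trans (c0_lt i) (bd_le i).
  pose c : {ffun 'I_n -> 'I_bdmax} := [ffun i => Ordinal (c0_lt' i)].
  have cB : c \in box by apply/boxP => i; rewrite ffunE; exact: c0_lt.
  apply/imfsetP; exists c; first exact: cB.
  apply/eqP; rewrite -subr_eq0 -nfB /nf big1 // => i _; rewrite ffunE /= /c0.
  case: (eqVneq (d i) 0) => [di0|di0]; last first.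
    by apply: term_eq0 => //; exact: padicB_natr_res.
  (* A free summand has no torsion: the coordinate of the multiple by s vanishes at every level, and
     Z_l is a domain. *)
  suff -> : a i = 0 by rewrite mulr0n subrr tens0r.
  suff : s * a i == 0 by rewrite mulf_eq0 (negPf s0) => /eqP.
  apply/eqP/padicP => m; apply: val_inj.
  have := @nf_inj_res i m (or_introl di0) (fun i => s * a i) (fun=> 0).
  by rewrite sa0; apply; rewrite /nf big1 // => j _; exact: tens0r.
pose s := (\prod_i if d i == 0%R then 1 else `|d i|)%N.
have s0 : (0 < s)%N.
  by rewrite prodn_gt0 // => i; case: (eqVneq (d i) 0) => // di0; rewrite absz_gt0.
exists s%:R; first exact: padic_natr_neq0.
rewrite nf_scale /nf big1 // => i _; have := cB i; rewrite /bd.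
case: (eqVneq (d i) 0) => [di0|di0].
  by case: (nat_of_ord _) => // _; rewrite mulr0 tens0r.
move=> _; rewrite /s (bigD1 i) //= (negPf di0) -natrM; apply: term_eq0 => //.
rewrite padic_nat_res; apply/eqP; rewrite -/(dvdn _ _) -mulnA dvdn_mulr //.
by rewrite pfactor_dvdn // absz_gt0.
Qed.

Lemma card_tensor_tor_smith :
  card_tensor_tor l_pr (coker M) = (\prod_(i | D i i != 0) l ^ ordz l (D i i))%N.
Proof.
rewrite /card_tensor_tor torsionE set_fsetK card_in_imfset //=.
rewrite -cardE card_family foldrE big_map big_enum /= [RHS]big_mkcond /=.
apply: eq_bigr => i _; rewrite -[RHS]if_neg negbK -/(bd i).
rewrite -[in RHS](card_ord (bd i)) -!sum1_card (big_ord_widen _ (fun=> 1%N) (bd_le i)).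
by apply: eq_bigl => c; rewrite inE.
Qed.

End TensorCoker.

Definition tor_ord l (l_pr : prime l) n (M : 'M[int]_n) : nat :=
  logn l (card_tensor_tor l_pr (coker M)).

Lemma ordzM l c d : c != 0 -> d != 0 -> ordz l (c * d) = (ordz l c + ordz l d)%N.
Proof. by move=> c0 d0; rewrite /ordz abszM lognM ?absz_gt0. Qed.

Lemma ordz_prod l (I : finType) (P : pred I) (c : I -> int) :
  (forall i, P i -> c i != 0) -> ordz l (\prod_(i | P i) c i) = (\sum_(i | P i) ordz l (c i))%N.
Proof.
move=> c0; suff [] : \prod_(i | P i) c i != 0 /\
  ordz l (\prod_(i | P i) c i) = (\sum_(i | P i) ordz l (c i))%N by [].
elim/big_ind2: _ => [|x1 n1 x2 n2 [x10 <-] [x20 <-]|i Pi]; last by split; rewrite ?c0.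
  by split; rewrite // /ordz logn1.
by rewrite mulf_neq0 // ordzM.
Qed.

Lemma ordz_unit l (c : int) : c \is a GRing.unit -> ordz l c = 0%N.
Proof. by rewrite /ordz => /pred2P[] ->; rewrite ?abszN logn1. Qed.

(** In Smith form the kernel is a product of annihilators. A nonzero elementary divisor c
    contributes l^(ord c) as soon as k is at least ord c, a zero one contributes l^k, and z counts
    the zero ones. *)
Lemma kercount_tor_ord l (l_pr : prime l) n (M : 'M[int]_n) : exists z k0,
  [/\ (0 < k0)%N,
      forall k, (k0 <= k)%N -> kercount (l ^ k) M = (l ^ (tor_ord l_pr M + k * z))%N
    & \det M != 0 -> z = 0%N /\ tor_ord l_pr M = ordz l (\det M)].
Proof.
have [L Lu [R Ru [d _ ME]]] := int_Smith_normal_form M.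
set D := \matrix_(i, j) _ in ME.
have Ddiag : is_diag_mx D by apply/is_diag_mxP => i j /negPf ij; rewrite mxE ij mulr0n.
have tor_ordE : tor_ord l_pr M = (\sum_(i | D i i != 0%R) ordz l (D i i))%N.
  rewrite /tor_ord ME card_tensor_tor_smith // -expn_sum pfactorK //.
exists #|[pred i | D i i == 0]|, (\max_i ordz l (D i i)).+1; split=> // [k kD|].
  have k0 : (0 < k)%N by exact: leq_trans kD.
  rewrite ME kercount_unim // kercount_diag // (bigID (fun i => D i i != 0)) /=.
  rewrite -ME tor_ordE expnD expn_sum; congr (_ * _)%N.
    apply: eq_bigr => i Di0; apply: card_Zl_ann => //.
    by apply: leq_trans (ltnW kD); exact: leq_bigmax.
  rewrite (eq_bigr (fun=> l ^ k)%N) => [|i]; last first.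
    rewrite negbK => /eqP ->; rewrite -[RHS](Zp_cast (ltn_exp1 l_pr k0)) -[RHS]card_ord -cardsT.
    by apply: eq_card => y; rewrite !inE mul0r eqxx.
  rewrite prod_nat_const -expnM; congr (_ ^ (_ * _))%N.
  by apply: eq_card => i; rewrite !inE [LHS]unfold_in negbK.
have detE : \det M = \det L * (\prod_i D i i) * \det R.
  rewrite {1}ME !det_mulmx; congr (_ * _ * _).
  have DE : D = diag_mx (\row_i D i i).
    apply/matrixP => i j; rewrite [RHS]mxE; case: eqVneq => [->|ij].
      by rewrite !mxE eqxx mulr1n.
    by rewrite mxE (negPf (_ : i != j :> nat)) ?mulr0n.
  by rewrite [in LHS]DE det_diag; apply: eq_bigr => i _; rewrite mxE.
rewrite detE !mulf_eq0 !negb_or => /andP[/andP[L0 /prodf_neq0 D0] R0].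
split; first by rewrite eq_card0 // => i; rewrite inE; apply/negbTE/D0.
have pD0 : \prod_i D i i != 0 by apply/prodf_neq0.
rewrite !ordzM ?mulf_neq0 // (ordz_unit _ Lu) (ordz_unit _ Ru) addn0 add0n tor_ordE.
rewrite ordz_prod //.
by apply: eq_bigl => i; rewrite D0.
Qed.

(** * Permutation representations of group rings *)

Section GroupRingLift.
Variables (G : zmodType) (B : pzRingType) (phi : G -> B).
Hypotheses (phi0 : phi 0 = 1) (phiD : forall g h, phi (g + h) = phi g * phi h).

Definition glift (F : grpring G) : B := \sum_(g <- msupp F) phi g *~ F@_g.

Lemma gliftw (D : {fset G}) F : (msupp F `<=` D)%fset ->
  glift F = \sum_(g <- D) phi g *~ F@_g.
Proof.
move=> le; rewrite [LHS](big_fset_incl _ le) => //= x xd /mcoeff_outdom ->.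
by rewrite mulr0z.
Qed.

Lemma glift_is_zmod_morphism : zmod_morphism glift.
Proof.
move=> u v.
rewrite (gliftw (msuppB_le u v)) (gliftw (fsubsetUl _ (msupp v))).
rewrite (gliftw (fsubsetUr (msupp u) _)) -sumrB.
by apply: eq_bigr => k _; rewrite mcoeffB mulrzBr.
Qed.

Lemma gliftU c g : glift << c *g g >> = phi g *~ c.
Proof. by rewrite (gliftw msuppU_le) big_seq_fset1 mcoeffUU. Qed.

Let gliftD u v : glift (u + v) = glift u + glift v.
Proof.
have B0 : glift 0 = 0 by rewrite -(subrr 0) glift_is_zmod_morphism subrr.
rewrite -{1}(opprK v) glift_is_zmod_morphism -[- v]sub0r glift_is_zmod_morphism B0 sub0r.
by rewrite opprK.
Qed.

Lemma glift_is_monoid_morphism : monoid_morphism glift.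
Proof.
have B0 : glift 0 = 0 by rewrite -(subrr 0) glift_is_zmod_morphism subrr.
split; first by rewrite -[1]/(grp_elt (0 : G)) gliftU phi0.
move=> u v; elim/grp_ind: u => [|u u' IH IH'|c g].
- by rewrite mul0r B0 mul0r.
- by rewrite mulrDl !gliftD IH IH' mulrDl.
elim/grp_ind: v => [|v v' IH IH'|c' g'].
- by rewrite mulr0 B0 mulr0.
- by rewrite mulrDr !gliftD IH IH' mulrDr.
have -> : (<< c *g g >> : grpring G) * << c' *g g' >> = << c * c' *g (g + g') >>.
  exact: grp_mulUU.
by rewrite !gliftU phiD mulrzAl mulrzAr -mulrzA [c' * c]mulrC.
Qed.

Definition glift_rmorph : {rmorphism grpring G -> B} :=
  HB.pack glift (GRing.isZmodMorphism.Build _ _ glift glift_is_zmod_morphism)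
    (GRing.isMonoidMorphism.Build _ _ glift glift_is_monoid_morphism).

End GroupRingLift.

Section Push.
Implicit Types S T U : finType.

(** The induced map Z[S] -> Z[T]. Its transpose sends a point of T to the sum of its fiber. *)
Definition push S T (f : S -> T) : 'M[int]_(#|T|, #|S|) :=
  \matrix_(i, j) (f (enum_val j) == enum_val i)%:R.

Lemma push_comp S T U (f : T -> U) (g : S -> T) : push (f \o g) = push f *m push g.
Proof.
apply/matrixP => i j; rewrite !mxE (bigD1 (enum_rank (g (enum_val j)))) //= big1.
  by rewrite !mxE enum_rankK eqxx mulr1 addr0.
move=> k kj; rewrite !mxE; have /negPf -> : g (enum_val j) != enum_val k.
  by apply: contraNneq kj => ->; rewrite enum_valK.
by rewrite mulr0.
Qed.

Lemma eq_push S T (f g : S -> T) : f =1 g -> push f = push g.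
Proof. by move=> fg; apply/matrixP => i j; rewrite !mxE fg. Qed.

Lemma push_id S : push (@id S) = 1%:M.
Proof. by apply/matrixP => i j; rewrite !mxE (inj_eq enum_val_inj) eq_sym. Qed.

Lemma sum_enum_val (V : nmodType) T (F : T -> V) : \sum_(i < #|T|) F (enum_val i) = \sum_t F t.
Proof.
rewrite [RHS](reindex (@enum_val T T)) //; exists (@enum_rank T) => i _.
  exact: enum_valK.
exact: enum_rankK.
Qed.

End Push.

Record gset (G : zmodType) := GSet {
  gset_sort :> finType;
  gact : G -> gset_sort -> gset_sort;
  gact0 : gact 0 =1 id;
  gactD : forall g h s, gact (g + h) s = gact g (gact h s)
}.

Section GSetRep.
Variables (G : zmodType).
Implicit Types S T : gset G.

Let push_act0 S : push (@gact G S 0) = 1 :> 'M[int]_#|S|.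
Proof. by rewrite (eq_push (@gact0 _ S)) push_id. Qed.

Let push_actD S g h : push (@gact G S (g + h)) = push (gact g) * push (gact h) :> 'M[int]_#|S|.
Proof. by rewrite (eq_push (@gactD _ S g h)) [LHS]push_comp. Qed.

Definition rho S : {rmorphism grpring G -> 'M[int]_#|S|} :=
  glift_rmorph (push_act0 S) (@push_actD S).

Lemma rhoE S F : rho S F = \sum_(g <- msupp F) F@_g *: push (@gact G S g).
Proof. by apply: eq_bigr => g _; rewrite -scaler_int intz. Qed.

Section Equivariant.
Variables (S T : gset G) (f : S -> T).
Hypothesis fP : forall g s, f (gact g s) = gact g (f s).

Lemma push_rho F : push f *m rho S F = rho T F *m push f.
Proof.
rewrite !rhoE mulmx_sumr mulmx_suml; apply: eq_bigr => g _.
by rewrite -scalemxAr -scalemxAl -!push_comp; congr (_ *: _); apply: eq_push => s; rewrite /= fP.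
Qed.

Lemma pull_act U g : push (@gact G U g) = (push (@gact G U (- g)))^T.
Proof.
apply/matrixP => i j; rewrite !mxE; congr (nat_of_bool _)%:R.
apply/eqP/eqP => <-; rewrite -gactD; first by rewrite addNr gact0.
by rewrite subrr gact0.
Qed.

(** Permutation matrices are orthogonal, so equivariance of [f] for [- g] transposes to equivariance
    of the pullback for g. *)
Lemma pull_rho F : rho S F *m (push f)^T = (push f)^T *m rho T F.
Proof.
rewrite !rhoE mulmx_sumr mulmx_suml; apply: eq_bigr => g _.
rewrite -scalemxAr -scalemxAl !(pull_act _ g) -!trmx_mul -!push_comp.
by congr (_ *: _^T); apply: eq_push => s; rewrite /= fP.
Qed.

End Equivariant.
End GSetRep.

(** * Kernels of equivariant quotient maps *)

Section SplitRep.
Variables (A : comNzRingType) (n n' t : nat).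
Variables (rS : {rmorphism A -> 'M[int]_n}) (rT : {rmorphism A -> 'M[int]_n'}).
Variables (Res : 'M[int]_(t, n)) (Iota : 'M[int]_(n, t)).
Variables (Q : 'M[int]_(n', n)) (J : 'M[int]_(n, n')).
Hypotheses (ResIota : Res *m Iota = 1%:M) (QJ : Q *m J = 1%:M).
Hypothesis split1 : Iota *m Res + J *m Q = 1%:M.
Hypothesis Qrho : forall F, Q *m rS F = rT F *m Q.

Lemma QIota : Q *m Iota = 0.
Proof.
have /(congr1 (mulmx Q)) := split1; rewrite mulmx1 mulmxDr (mulmxA _ J) QJ mul1mx.
move/eqP; rewrite -subr_eq0 addrK => /eqP/(congr1 (mulmx^~ Iota)).
by rewrite mul0mx -!mulmxA ResIota mulmx1.
Qed.

(** The kernel of [Q] as a representation, in the basis [Iota]. The splitting given by [Res] and [J]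
    is only Z-linear; multiplicativity comes from the stability of this kernel under [rS]. *)
Definition rhoI F := Res *m rS F *m Iota.

Lemma Iota_rhoI F : Iota *m rhoI F = rS F *m Iota.
Proof.
have IR : Iota *m Res = 1%:M - J *m Q by rewrite -split1 addrK.
rewrite /rhoI !mulmxA IR !mulmxBl mul1mx -[J *m Q *m _]mulmxA Qrho -!mulmxA.
by rewrite QIota !mulmx0 subr0.
Qed.

Lemma rhoI_is_zmod_morphism : zmod_morphism rhoI.
Proof. by move=> x y; rewrite /rhoI raddfB mulmxBr mulmxBl. Qed.

Lemma rhoI_is_monoid_morphism : monoid_morphism rhoI.
Proof.
split; first by rewrite /rhoI (rmorph1 rS) mulmx1.
move=> x y; rewrite {1}/rhoI (rmorphM rS) -[rS x * rS y]/(rS x *m rS y).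
rewrite -!mulmxA -Iota_rhoI -[RHS]/(rhoI x *m rhoI y) {2}/rhoI.
by rewrite -!mulmxA.
Qed.

Definition repI : {rmorphism A -> 'M[int]_t} :=
  HB.pack rhoI (GRing.isZmodMorphism.Build _ _ rhoI rhoI_is_zmod_morphism)
    (GRing.isMonoidMorphism.Build _ _ rhoI rhoI_is_monoid_morphism).

Lemma Iota_repI F : Iota *m repI F = rS F *m Iota.
Proof. exact: Iota_rhoI. Qed.

Lemma Iota_Res (R : pzRingType) r (x : 'M[R]_(n, r)) :
  zmx R Q *m x = 0 -> zmx R Iota *m (zmx R Res *m x) = x.
Proof.
move=> Qx; rewrite mulmxA -zmx_mul -(addrK (J *m Q) (Iota *m Res)) split1.
by rewrite (map_mxB) zmx1 zmx_mul mulmxBl mul1mx -mulmxA Qx mulmx0 subr0.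
Qed.

End SplitRep.

Section BlockKernel.
Variables (R : comPzRingType) (A : comNzRingType) (m r : nat).
Variables (rep : {rmorphism A -> 'M[int]_m}) (M : 'M[A]_r).

Definition bker (x : {ffun 'I_r -> 'cV[R]_m}) : bool :=
  [forall i, \sum_j zmx R (rep (M i j)) *m x j == 0].

Lemma bkerP (x : {ffun 'I_r -> 'cV[R]_m}) :
  reflect (forall i, \sum_j zmx R (rep (M i j)) *m x j = 0) (bker x).
Proof. by apply: (iffP forallP) => xK i; apply/eqP. Qed.

Definition bvec (y : 'cV[R]_(r * m)) : {ffun 'I_r -> 'cV[R]_m} :=
  [ffun i => \col_k y (pair_ord i k) 0].

Lemma bker_blow y : (zmx R (blow rep M) *m y == 0) = bker (bvec y).
Proof.
have E i k : (zmx R (blow rep M) *m y) (pair_ord i k) 0 =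
    (\sum_j zmx R (rep (M i j)) *m bvec y j) k 0.
  rewrite mxE sum_pair_ord summxE; apply: eq_bigr => j _; rewrite mxE.
  by apply: eq_bigr => k' _; rewrite !mxE !ord_fstK !ord_sndK ffunE mxE.
apply/eqP/bkerP => [y0 i|yK]; first by apply/colP => k; rewrite -E y0 !mxE.
by apply/colP => k; rewrite -(pair_ordK k) E yK !mxE.
Qed.

Lemma bvec_bij : bijective bvec.
Proof.
exists (fun x : {ffun 'I_r -> 'cV[R]_m} => \col_k x (ord_fst k) (ord_snd k) 0) => [y|x].
  by apply/colP => k; rewrite !mxE ffunE mxE pair_ordK.
by apply/ffunP => i; apply/colP => k; rewrite ffunE !mxE ord_fstK ord_sndK.
Qed.

End BlockKernel.

Lemma kercount_blow q (A : comNzRingType) m r (rep : {rmorphism A -> 'M[int]_m})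
    (M : 'M[A]_r) :
  kercount q (blow rep M) = #|[set x | bker (R := 'Z_q) rep M x]|.
Proof.
rewrite /kercount -[LHS](card_imset _ (bij_inj (bvec_bij 'Z_q m r))); apply: eq_card => x.
have [g fK gK] := bvec_bij 'Z_q m r.
apply/imsetP/idP => [[y + ->]|]; rewrite !inE.
  by rewrite -bker_blow.
by move=> xK; exists (g x); rewrite ?gK // inE bker_blow gK.
Qed.

Section BlockSplit.
Variables (A : comNzRingType) (n n' t r : nat) (M : 'M[A]_r).
Variables (rS : {rmorphism A -> 'M[int]_n}) (rT : {rmorphism A -> 'M[int]_n'}).
Variables (Res : 'M[int]_(t, n)) (Iota : 'M[int]_(n, t)).
Variables (Q : 'M[int]_(n', n)) (J : 'M[int]_(n, n')) (N : 'M[int]_(n, n')) (c : int).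
Hypotheses (ResIota : Res *m Iota = 1%:M) (QJ : Q *m J = 1%:M).
Hypothesis split1 : Iota *m Res + J *m Q = 1%:M.
Hypothesis Qrho : forall F, Q *m rS F = rT F *m Q.
Hypothesis rhoN : forall F, rS F *m N = N *m rT F.
Hypothesis QN : Q *m N = c%:M.
Let rI := repI ResIota QJ split1 Qrho.

(** Once c is invertible, [N] divided by c is an equivariant section of [Q], and the kernel becomes
    a direct sum. Over Z there is in general no such section. *)
Lemma bker_split q : (c%:~R : 'Z_q) \is a GRing.unit ->
  #|[set x | bker (R := 'Z_q) rS M x]| =
  (#|[set x | bker (R := 'Z_q) rI M x]| * #|[set x | bker (R := 'Z_q) rT M x]|)%N.
Proof.
set R := 'Z_q => cu; pose c' : R := (c%:~R)^-1.
pose z := fun M => zmx R M.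
have QIo : z _ _ Q *m z _ _ Iota = 0 by rewrite /z -zmx_mul (QIota ResIota QJ split1) map_mx0.
have ResIo : z _ _ Res *m z _ _ Iota = 1%:M by rewrite /z -zmx_mul ResIota zmx1.
have QNc (y : 'cV[R]_n') : z _ _ Q *m (c' *: (z _ _ N *m y)) = y.
  rewrite -scalemxAr mulmxA /z -zmx_mul QN map_scalar_mx mul_scalar_mx scalerA.
  by rewrite mulVr // scale1r.
pose g (u : {ffun 'I_r -> 'cV[R]_t} * {ffun 'I_r -> 'cV[R]_n'}) : {ffun 'I_r -> 'cV[R]_n} :=
  [ffun i => z _ _ Iota *m u.1 i + c' *: (z _ _ N *m u.2 i)].
have Qg u i : z _ _ Q *m g u i = u.2 i.
  by rewrite ffunE mulmxDr mulmxA QIo mul0mx add0r QNc.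
have g_inj : injective g.
  move=> u v uv; have uv2 : u.2 = v.2 by apply/ffunP => i; rewrite -!Qg uv.
  have uv1 : u.1 = v.1.
    apply/ffunP => i; have /ffunP/(_ i) := uv; rewrite !ffunE uv2 => /addIr.
    by move/(congr1 (mulmx (z _ _ Res))); rewrite !mulmxA ResIo !mul1mx.
  by case: u v uv1 uv2 {uv} => ? ? [? ?] /= -> ->.
rewrite -cardsX -(card_imset _ g_inj); apply: eq_card => x.
have zI F (y : 'cV[R]_t) : z _ _ (rS F) *m (z _ _ Iota *m y) = z _ _ Iota *m (z _ _ (rI F) *m y).
  by rewrite !mulmxA /z -!zmx_mul Iota_repI.
have zN F (y : 'cV[R]_n') :
    z _ _ (rS F) *m (c' *: (z _ _ N *m y)) = c' *: (z _ _ N *m (z _ _ (rT F) *m y)).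
  by rewrite -scalemxAr !mulmxA /z -!zmx_mul rhoN.
have sumg u i : \sum_j z _ _ (rS (M i j)) *m g u j =
    z _ _ Iota *m (\sum_j z _ _ (rI (M i j)) *m u.1 j) +
    c' *: (z _ _ N *m (\sum_j z _ _ (rT (M i j)) *m u.2 j)).
  rewrite !mulmx_sumr scaler_sumr -big_split; apply: eq_bigr => j _ /=.
  by rewrite ffunE mulmxDr zI zN.
rewrite inE; apply/bkerP/imsetP => [xK|[u + ->]]; last first.
  rewrite inE /= !inE => /andP[/bkerP u1 /bkerP u2] i.
  by rewrite sumg u1 u2 !mulmx0 scaler0 addr0.
pose y := [ffun i => z _ _ Q *m x i].
pose w := [ffun i => z _ _ Res *m (x i - c' *: (z _ _ N *m y i))].
have xE : x = g (w, y).
  apply/ffunP => i; rewrite !ffunE /= (Iota_Res split1) ?subrK //.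
  by rewrite mulmxBr QNc subrr.
have yK i : \sum_j z _ _ (rT (M i j)) *m y j = 0.
  rewrite -[RHS](mulmx0 _ (z _ _ Q)) -(xK i) mulmx_sumr; apply: eq_bigr => j _.
  by rewrite ffunE !mulmxA /z -!zmx_mul Qrho.
exists (w, y) => //; rewrite !inE /=; apply/andP; split; apply/bkerP => // i.
have := xK i; rewrite {1}xE sumg /= yK mulmx0 scaler0 addr0.
by move/(congr1 (mulmx (z _ _ Res))); rewrite mulmxA ResIo mul1mx mulmx0.
Qed.

End BlockSplit.

(** Expanding the right side gives a sum over all self-maps of the index set; the Leibniz formula
    uses only the permutations among them. *)
Lemma normr_det_le n (B : 'M[int]_n) : `|\det B| <= \prod_i \sum_j `|B i j|.
Proof.
rewrite bigA_distr_bigA /=.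
apply: (@le_trans _ _ (\sum_(s : 'S_n) \prod_i `|B i (s i)|)).
  apply: le_trans (ler_norm_sum _ _ _) _; apply: ler_sum => s _.
  by rewrite normrM normrX normrN1 expr1n mul1r normr_prod.
pose f (s : 'S_n) : {ffun 'I_n -> 'I_n} := [ffun i => s i].
have f_inj : injective f.
  by move=> s t /ffunP st; apply/permP => i; have := st i; rewrite !ffunE.
rewrite (eq_bigr (fun s => \prod_i `|B i (f s i)|)) => [|s _]; last first.
  by apply: eq_bigr => i _; rewrite ffunE.
have -> : \sum_s \prod_i `|B i (f s i)| =
    \sum_(g in f @: [set: 'S_n]) \prod_i `|B i (g i)|.
  rewrite big_imset /=; last by move=> s t _ _; exact: f_inj.
  by apply: eq_bigl => s; rewrite inE.
rewrite [leRHS](bigID [in f @: [set: 'S_n]]) /= lerDl.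
by apply: sumr_ge0 => g _; apply: prodr_ge0.
Qed.

(** * The kernel of Z[S] -> Z[T] and the size of its determinants *)

Section RelRep.
Variables (G : zmodType) (S T : gset G) (f : S -> T) (j : T -> S).
Hypotheses (jK : cancel j f) (fP : forall g s, f (gact g s) = gact g (f s)).

Definition relbase := {s : S | s != j (f s)}.

(* The columns of rel_iota form a basis of the kernel of Z[S] -> Z[T].  Unlike
   the projector onto it, they have bounded entries, which is what makes the
   bound on the determinant independent of the size of the fibers. *)
Definition rel_res : 'M[int]_(#|{: relbase}|, #|S|) := (push (val : relbase -> S))^T.
Definition rel_iota : 'M[int]_(#|S|, #|{: relbase}|) :=
  push (val : relbase -> S) - push (fun u : relbase => j (f (val u))).

Let pull_push (U V : finType) (h : U -> S) (k : V -> S) :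
  (push h)^T *m push k = \matrix_(i, i') (h (enum_val i) == k (enum_val i'))%:R.
Proof.
apply/matrixP => u v; rewrite !mxE (bigD1 (enum_rank (k (enum_val v)))) //= big1.
  by rewrite !mxE !enum_rankK eqxx mulr1 addr0.
move=> s sv; rewrite !mxE; have /negPf -> : k (enum_val v) != enum_val s.
  by apply: contraNneq sv => ->; rewrite enum_valK.
by rewrite mulr0.
Qed.

Lemma rel_res_iota : rel_res *m rel_iota = 1%:M.
Proof.
rewrite mulmxBr !pull_push; apply/matrixP => u v; rewrite !mxE.
have /negPf -> : val (enum_val u) != j (f (val (enum_val v))).
  apply/eqP => uv; have := valP (enum_val u); rewrite uv jK.
  by rewrite eqxx.
by rewrite subr0 (inj_eq val_inj) (inj_eq enum_val_inj).
Qed.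

Lemma push_section : push f *m push j = 1%:M.
Proof. by rewrite -push_comp -push_id; apply: eq_push. Qed.

(** Matrix form of s = (s - j (f s)) + j (f s), where the difference vanishes exactly for the points
    of the section left out of [relbase]. *)
Lemma rel_split1 : rel_iota *m rel_res + push j *m push f = 1%:M.
Proof.
apply/matrixP => s s'; rewrite -push_comp mxE [X in X + _]mxE.
under eq_bigr do rewrite !mxE.
rewrite (sum_enum_val (fun u : relbase => ((val u == enum_val s)%:R -
  (j (f (val u)) == enum_val s)%:R) * (val u == enum_val s')%:R)).
rewrite !mxE; have -> : (s == s') = (enum_val s' == enum_val s).
  by rewrite (inj_eq enum_val_inj) eq_sym.
set t := enum_val s'; set t' := enum_val s => /=.
have [tU|tU] := boolP (t != j (f t)).
  rewrite (bigD1 (exist _ t tU : relbase)) //= big1 ?addr0 => [|u ut].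
    by rewrite eqxx mulr1 subrK.
  by rewrite (negPf (_ : val u != t)) ?mulr0.
rewrite big1 => [|u _]; last first.
  rewrite (negPf (_ : val u != t)) ?mulr0 //.
  by apply: contraNneq tU => <-; exact: (valP u).
by rewrite add0r; move: tU; rewrite negbK => /eqP {2}->.
Qed.

Definition relrep : {rmorphism grpring G -> 'M[int]_#|{: relbase}|} :=
  repI rel_res_iota push_section rel_split1 (push_rho fP).

Lemma relrep_iota F : rel_iota *m relrep F = rho S F *m rel_iota.
Proof. exact: Iota_repI. Qed.

Lemma push_iota0 : push f *m rel_iota = 0.
Proof. exact: QIota rel_res_iota push_section rel_split1. Qed.

Definition l1norm (F : grpring G) : nat := (\sum_(g <- msupp F) `|F@_g|)%N.

(** A group element g sends the basis vector s - j (f s) to a difference of two points, and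
    [rel_res] only forgets coordinates. Each g thus contributes at most two entries of absolute
    value 1 to a column. *)
Lemma relrep_col F v : (\sum_u `|relrep F u v| <= (2 * l1norm F)%:Z).
Proof.
have -> : relrep F = \sum_(g <- msupp F) F@_g *: (rel_res *m push (fun u : relbase => gact g (val u)) -
    rel_res *m push (fun u : relbase => gact g (j (f (val u))))).
  rewrite /relrep /= /rhoI rhoE mulmx_sumr mulmx_suml; apply: eq_bigr => g _.
  by rewrite -scalemxAr -scalemxAl -mulmxA mulmxBr -!push_comp -mulmxBr.
have col1 (k : relbase -> S) : \sum_u `|(rel_res *m push k) u v| <= 1.
  rewrite pull_push; under eq_bigr do rewrite mxE normr_nat.
  rewrite -natr_sum (sum_enum_val (fun u : relbase => nat_of_bool (val u == k (enum_val v)))).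
  rewrite -[leRHS]/(1%:R) ler_nat -(big_mkcond (fun u => val u == _) (fun=> 1%N)) /= sum1_card.
  apply/card_le1_eqP => x y; rewrite ![_ \in _]unfold_in => /eqP xE /eqP yE.
  by apply: val_inj; exact: etrans yE (esym xE).
rewrite (eq_bigr (fun u => `|\sum_(g <- msupp F) (F@_g *: (rel_res *m push (fun u : relbase => gact g (val u)) -
    rel_res *m push (fun u : relbase => gact g (j (f (val u)))))) u v|)); last first.
  by move=> u _; rewrite summxE.
apply: le_trans (ler_sum _ (fun u _ => ler_norm_sum _ _ _)) _.
rewrite exchange_big /= /l1norm big_distrr /= -natz natr_sum; apply: ler_sum => g _.
rewrite (eq_bigr (fun u => `|F@_g| * `|(rel_res *m push (fun u : relbase => gact g (val u)) -
    rel_res *m push (fun u : relbase => gact g (j (f (val u))))) u v|)); last first.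
  by move=> u _; rewrite mxE normrM.
rewrite -mulr_sumr mulnC natrM natz abszE; apply: ler_wpM2l => //.
apply: (@le_trans _ _ (1 + 1)); last by [].
apply: le_trans (lerD (col1 _) (col1 _)); rewrite -big_split /=; apply: ler_sum => u _.
by rewrite mxE [X in `|_ + X|]mxE; exact: ler_normB.
Qed.

Lemma normr_det_relrep F : `|\det (relrep F)| <= (2 * l1norm F)%:Z ^+ #|{: relbase}|.
Proof.
rewrite -det_tr; apply: le_trans (normr_det_le _) _.
rewrite -[in leRHS](card_ord #|{: relbase}|) -prodr_const.
apply: ler_prod => v _; rewrite sumr_ge0 //=.
by under eq_bigr do rewrite mxE; exact: relrep_col.
Qed.

End RelRep.

(** * Comparison of determinants *)

Lemma int_det_neq0P n (B : 'M[int]_n) (v : 'cV[int]_n) :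
  \det B != 0 -> B *m v = 0 -> v = 0.
Proof.
move=> B0 Bv; have : \adj B *m (B *m v) = 0 by rewrite Bv mulmx0.
rewrite mulmxA mul_adj_mx mul_scalar_mx => /colP dv; apply/colP => i.
have /eqP := dv i; rewrite !mxE mulf_eq0 (negPf B0) /= => /eqP ->.
by [].
Qed.

Lemma int_det0P n (B : 'M[int]_n) : \det B = 0 ->
  exists2 v : 'cV[int]_n, v != 0 & B *m v = 0.
Proof.
move=> B0; have : \det (zmx rat B)^T = 0 by rewrite det_tr det_map_mx B0.
move/eqP/det0P => [v v0 vB].
pose D := \prod_i denq (v 0 i).
pose w := \col_i (numq (v 0 i) * \prod_(k | k != i) denq (v 0 k)).
have wE i : (w i 0)%:~R = D%:~R * v 0 i :> rat.
  have DE : D = denq (v 0 i) * \prod_(k | k != i) denq (v 0 k) by rewrite /D (bigD1 i).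
  rewrite mxE DE !intrM mulrAC; congr (_ * _).
  by rewrite numqE mulrC.
have D0 : D%:~R != 0 :> rat.
  by rewrite intr_eq0; apply/prodf_neq0 => i _; rewrite denq_eq0.
exists w.
  apply: contra_neq v0 => w0; apply/rowP => i; have := wE i.
  by rewrite w0 !mxE => /esym/eqP; rewrite mulf_eq0 (negPf D0) => /eqP.
apply/colP => i; apply: (@intr_inj rat); rewrite !mxE rmorph_sum /=.
have /rowP/(_ i) := vB; rewrite !mxE => vBi.
rewrite -[RHS](mulr0 D%:~R) -[X in _ = _ * X]vBi mulr_sumr; apply: eq_bigr => k _.
by rewrite intrM wE !mxE mulrCA [_ * v 0 k]mulrC.
Qed.

Definition dvdv (m : nat) n (x : 'cV[int]_n) := forall i, (m %| x i 0%R)%Z.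

Lemma dvdvP m n (x : 'cV[int]_n) : dvdv m x -> exists y, x = m%:Z *: y.
Proof.
move=> mx; exists (\col_i (x i 0%R %/ m)%Z); apply/colP => i; rewrite !mxE.
by rewrite mulrC divzK.
Qed.

Lemma dvdv_zmx q n (x : 'cV[int]_n) : (1 < q)%N -> (zmx 'Z_q x == 0) <-> dvdv q x.
Proof.
move=> q1; split=> [/eqP/colP x0 i|qx].
  by have /eqP := x0 i; rewrite !mxE Zq_intr_eq0.
by apply/eqP/colP => i; apply/eqP; rewrite !mxE Zq_intr_eq0 //; exact: qx.
Qed.

(** The criterion modulo l shows that x is divisible by l; divide and repeat. This is why the
    vanishing argument is needed only modulo l. *)
Lemma dvdv_lift k l (n : nat) (I : Type) (m : I -> nat) (B : forall i, 'M[int]_(m i, n)) :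
  (0 < l)%N ->
  (forall x : 'cV_n, (forall i, dvdv l (B i *m x)) -> dvdv l x) ->
  forall x : 'cV_n, (forall i, dvdv (l ^ k) (B i *m x)) -> dvdv (l ^ k) x.
Proof.
move=> l0 key; elim: k => [|k IHk] x xB; first by move=> i; rewrite dvd1z.
have lx : dvdv l x.
  by apply: key => i i'; apply: dvdz_trans (xB i i'); rewrite expnS PoszM dvdz_mulr.
have ln0 : l%:Z != 0 by rewrite eqz_nat -lt0n.
have [y xE] := dvdvP lx; rewrite xE => i; rewrite mxE expnS PoszM dvdz_mul2l //.
apply: IHk => i' j; have := xB i' j; rewrite xE -scalemxAr mxE expnS PoszM.
by rewrite dvdz_mul2l.
Qed.

Lemma zmx_lift q m n (x : 'M['Z_q]_(m, n)) :
  zmx 'Z_q (map_mx (fun a : 'Z_q => (val a)%:Z) x) = x.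
Proof. by apply/matrixP => i j; rewrite !mxE -pmulrn natr_Zp. Qed.

Section Compare.
Variables (G : zmodType) (F : grpring G) (l : nat) (l_pr : prime l).
Variables (S T : gset G) (f : S -> T) (j : T -> S).
Hypotheses (jK : cancel j f) (fP : forall g s, f (gact g s) = gact g (f s)).

Section QuotientDet.
Variables (S' : gset G) (h : S -> S') (f' : S' -> T) (j' : T -> S') (c : nat).
Hypotheses (jK' : cancel j' f') (fP' : forall g s, f' (gact g s) = gact g (f' s)).
Hypotheses (hP : forall g s, h (gact g s) = gact g (h s)) (f'h : forall s, f' (h s) = f s).

Lemma push_fiber : (forall s', #|[set s | h s == s']| = c) ->
  push h *m (push h)^T = (c%:Z)%:M.
Proof.
move=> hc; apply/matrixP => s s'; rewrite !mxE.
under eq_bigr do rewrite !mxE.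
rewrite (sum_enum_val (fun u : S => (h u == enum_val s)%:R * (h u == enum_val s')%:R)).
have [->|ss'] := eqVneq s s'.
  rewrite mulr1n -(hc (enum_val s')) -sum1_card -natz natr_sum [RHS]big_mkcond.
  by apply: eq_bigr => u _; rewrite inE; case: eqP.
rewrite big1 ?mulr0n // => u _; case: eqP => [->|]; last by rewrite mul0r.
by rewrite (inj_eq enum_val_inj) (negPf ss') mulr0.
Qed.

(** A kernel vector for S' pulls back to one for S. It stays nonzero because pulling back and
    pushing forward again multiplies by c. *)
Lemma relrep_det_quotient : (0 < c)%N -> (forall s', #|[set s | h s == s']| = c) ->
  \det (relrep jK fP F) != 0 -> \det (relrep jK' fP' F) != 0.
Proof.
move=> c0 hc dS; apply/eqP => /int_det0P[v v0 vF].
pose x := (push h)^T *m (rel_iota f' j' *m v).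
have Fx : rho S F *m x = 0.
  rewrite /x mulmxA (pull_rho hP) -mulmxA (mulmxA (rho S' F)) -(relrep_iota jK' fP').
  by rewrite -mulmxA vF !mulmx0.
have hx : push h *m x = c%:Z *: (rel_iota f' j' *m v).
  by rewrite /x mulmxA push_fiber // mul_scalar_mx.
have fE : push f = push f' *m push h by rewrite -push_comp; apply: eq_push => s; rewrite /= f'h.
have fx : push f *m x = 0.
  by rewrite fE -mulmxA hx -scalemxAr mulmxA (push_iota0 jK') mul0mx scaler0.
have xE : rel_iota f j *m (rel_res f j *m x) = x.
  rewrite mulmxA -(addrK (push j *m push f) (rel_iota f j *m _)) rel_split1 //.
  by rewrite mulmxBl mul1mx -mulmxA fx mulmx0 subr0.
have : relrep jK fP F *m (rel_res f j *m x) = 0.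
  rewrite -[LHS]mul1mx -(rel_res_iota jK) -mulmxA (mulmxA (rel_iota f j)) relrep_iota.
  by rewrite -mulmxA xE Fx mulmx0.
move/(int_det_neq0P dS) => rx0; move: hx; rewrite -xE rx0 !mulmx0 => /esym/colP cv.
have iv : rel_iota f' j' *m v = 0.
  apply/colP => i; have := cv i; rewrite [LHS]mxE [RHS]mxE => /eqP.
  by rewrite mulf_eq0 eqz_nat eqn0Ngt c0 /= => /eqP ->; rewrite mxE.
move/(congr1 (mulmx (rel_res f' j'))): iv.
by rewrite mulmxA (rel_res_iota jK') mul1mx mulmx0 => v00; rewrite v00 eqxx in v0.
Qed.

End QuotientDet.

Variables (I : finType) (S_ : I -> gset G) (h_ : forall i, S -> S_ i).
Variables (k_ : forall i, S_ i -> S) (f_ : forall i, S_ i -> T) (j_ : forall i, T -> S_ i).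
Hypotheses (kK_ : forall i, cancel (@k_ i) (@h_ i)) (jK_ : forall i, cancel (@j_ i) (@f_ i)).
Hypotheses (hP_ : forall i g s, h_ i (gact g s) = gact g (h_ i s)).
Hypotheses (fP_ : forall i g s, @f_ i (gact g s) = gact g (f_ s)).
Hypotheses (f_h_ : forall i s, f_ (h_ i s) = f s).
Hypothesis key : forall x : 'cV[int]_#|S|, dvdv l (rho S F *m x) ->
  (forall i, dvdv l (push (h_ i) *m x)) -> dvdv l x.

(** Modulo l^k, pushing forward to all the [S_ i] is injective on the kernel of [F] by [key] and
    [dvdv_lift], and lands in the kernels attached to the quotients. Counting both sides for large k
    compares the valuations. *)
Lemma ordz_det_compare : \det (relrep jK fP F) != 0 ->
  (forall i, \det (relrep (@jK_ i) (@fP_ i) F) != 0) ->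
  (ordz l (\det (relrep jK fP F)) <= \sum_i ordz l (\det (relrep (@jK_ i) (@fP_ i) F)))%N.
Proof.
move=> d0 di0.
have tor_ordK n (B : 'M[int]_n) : \det B != 0 -> exists k0,
    forall k, (k0 <= k)%N -> kercount (l ^ k) B = (l ^ ordz l (\det B))%N.
  move=> B0; have [z [k0 [_ kE /(_ B0)[z0 tor_ordE]]]] := kercount_tor_ord l_pr B.
  by exists k0 => k /kE ->; rewrite z0 muln0 addn0 tor_ordE.
have [k0 k0P] := tor_ordK _ _ d0.
have [ki kiP] := choice (fun i => tor_ordK _ _ (di0 i)).
(* Large enough for every count to be stable; the successor ensures l^k > 1. *)
pose k := (k0 + \sum_i ki i).+1.
have kk0 : (k0 <= k)%N by rewrite /k -addnS leq_addr.
have kki i : (ki i <= k)%N by rewrite /k (bigD1 i) //=; lia.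
have l1 : (1 < l ^ k)%N by exact: ltn_exp1.
rewrite -(leq_exp2l _ _ (prime_gt1 l_pr)) -(k0P k kk0) expn_sum.
rewrite (eq_bigr (fun i => kercount (l ^ k) (relrep (@jK_ i) (@fP_ i) F))); last first.
  by move=> i _; rewrite (kiP i k (kki i)).
set R := 'Z_(l ^ k).
pose K i := [set x : 'cV[R]__ | zmx R (relrep (@jK_ i) (@fP_ i) F) *m x == 0].
(* The kernels [K i] live in different spaces. Pulling them back to Z[S] gives a family in a single
   type, and nothing is lost because [k_] provides a left inverse. *)
pose g i (y : 'cV[R]_#|{: relbase (@f_ i) (@j_ i)}|) : 'cV[R]_#|S| :=
  zmx R ((push (h_ i))^T) *m (zmx R (rel_iota (@f_ i) (@j_ i)) *m y).
apply: (@leq_trans (\prod_i #|@g i @: K i|)); last by apply: leq_prod => i _; exact: leq_imset_card.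
pose psi (x : 'cV[R]_#|{: relbase f j}|) : {ffun I -> 'cV[R]_#|S|} :=
  [ffun i => zmx R ((push (h_ i))^T) *m (zmx R (push (h_ i)) *m (zmx R (rel_iota f j) *m x))].
have -> : (\prod_i #|@g i @: K i| =
    #|(family (fun i => @g i @: K i) : pred {ffun I -> 'cV[R]_#|S|})|)%N.
  by rewrite card_family foldrE big_map big_enum.
rewrite /kercount -(card_in_imset (f := psi)); last first.
  move=> x y; rewrite !inE => /eqP xK /eqP yK xy.
  pose w := zmx R (rel_iota f j) *m (x - y).
  have Fw : zmx R (rho S F) *m w = 0.
    rewrite /w mulmxA -zmx_mul -(relrep_iota jK fP) zmx_mul -mulmxA.
    by rewrite mulmxBr xK yK subrr mulmx0.
  have hw i : zmx R (push (h_ i)) *m w = 0.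
    have /ffunP/(_ i) := xy; rewrite !ffunE => /eqP.
    rewrite -subr_eq0 -mulmxBr -mulmxBr -mulmxBr -/w => /eqP.
    have KH : zmx R ((push (@k_ i))^T) *m zmx R ((push (h_ i))^T) = 1%:M.
      by rewrite -zmx_mul -trmx_mul push_section // trmx1 zmx1.
    move/(congr1 (mulmx (zmx R ((push (@k_ i))^T)))).
    by rewrite (mulmxA (zmx R ((push (@k_ i))^T))) KH mul1mx mulmx0.
  pose w' := map_mx (fun a : R => (val a)%:Z) w.
  have w'E : zmx R w' = w by exact: zmx_lift.
  have dw : dvdv (l ^ k) w'.
    pose m (o : option I) := if o is Some i then #|S_ i| else #|S|.
    pose B (o : option I) : 'M[int]_(m o, #|S|) :=
      if o is Some i return 'M[int]_(m o, #|S|) then push (h_ i) else rho S F.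
    apply: (@dvdv_lift k l _ _ m B); first exact: prime_gt0.
      by move=> x' x'B; apply: key => [|i]; [exact: (x'B None) | exact: (x'B (Some i))].
    case=> [i|]; apply/(dvdv_zmx _ l1); rewrite /= zmx_mul w'E ?hw ?Fw //.
  have w0 : w = 0 by apply/eqP; rewrite -w'E; apply/(dvdv_zmx _ l1).
  apply/eqP; rewrite -subr_eq0 -[x - y]mul1mx -zmx1 -(rel_res_iota jK) zmx_mul -mulmxA.
  by rewrite -/w w0 mulmx0.
apply: subset_leq_card; apply/fintype.subsetP => _ /imsetP[x + ->]; rewrite inE => /eqP xK.
apply/familyP => i; rewrite ffunE; apply/imsetP.
pose u := zmx R (push (h_ i)) *m (zmx R (rel_iota f j) *m x).
have fE : push (@f_ i) *m push (h_ i) = push f 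
  by rewrite -push_comp; apply: eq_push => s; exact: f_h_.
have uE : zmx R (rel_iota (@f_ i) (@j_ i)) *m (zmx R (rel_res (@f_ i) (@j_ i)) *m u) = u.
  apply: (Iota_Res (rel_split1 (@f_ i) (@j_ i))).
  by rewrite /u !mulmxA -!zmx_mul fE (push_iota0 jK) map_mx0 mul0mx.
exists (zmx R (rel_res (@f_ i) (@j_ i)) *m u); last by rewrite /g uE.
rewrite inE -[X in X == _]mul1mx -zmx1 -(rel_res_iota (@jK_ i)) zmx_mul -mulmxA.
rewrite [X in _ *m X]mulmxA -zmx_mul relrep_iota zmx_mul -mulmxA uE.
rewrite [zmx R (rho _ _) *m _]mulmxA -zmx_mul -(push_rho (@hP_ i)) zmx_mul -mulmxA.
rewrite (mulmxA (zmx R (rho S F))) -zmx_mul -(relrep_iota jK fP) zmx_mul -mulmxA xK.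
by rewrite !mulmx0.
Qed.

End Compare.

(** * Powers modulo a prime power *)

Lemma expn1D (y e : nat) : exists z, ((1 + y) ^ e = 1 + e * y + y ^ 2 * z)%N.
Proof.
elim: e => [|e [z IHe]]; first by exists 0%N; rewrite muln0.
by exists (e + z + y * z)%N; rewrite expnS IHe; ring.
Qed.

Section PowersModPrimePower.
Variables (p : nat) (p_pr : prime p).

Lemma expn_unit_coprime m w e : (0 < m)%N -> ~~ (p %| w)%N -> ~~ (p %| e)%N ->
  exists2 w', ((1 + p ^ m * w) ^ e = 1 + p ^ m * w')%N & ~~ (p %| w')%N.
Proof.
move=> m0 pw pe; have [z ->] := expn1D (p ^ m * w) e.
exists (e * w + p ^ m * w ^ 2 * z)%N; first by rewrite expnMn; ring.
rewrite dvdn_addl; first by rewrite Euclid_dvdM // negb_or pe.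
by rewrite -mulnA dvdn_mulr // dvdn_exp.
Qed.

(** With m > 1 the quadratic term, divisible by p^(2m), does not disturb the exact level m + 1. For
    p = 2 and m = 1 the level can jump, as in 3^2 = 1 + 2^3. *)
Lemma expn_unit_prime m w : (1 < m)%N -> ~~ (p %| w)%N ->
  exists2 w', ((1 + p ^ m * w) ^ p = 1 + p ^ m.+1 * w')%N & ~~ (p %| w')%N.
Proof.
case: m => [//|m] m0 pw; have [z ->] := expn1D (p ^ m.+1 * w) p.
exists (w + p ^ m * w ^ 2 * z)%N; first by rewrite !expnS expn0; ring.
by rewrite dvdn_addl // -mulnA dvdn_mulr // dvdn_exp.
Qed.

Lemma expn_unit_ppow m w i : (1 < m)%N -> ~~ (p %| w)%N ->
  exists2 w', ((1 + p ^ m * w) ^ (p ^ i) = 1 + p ^ (m + i) * w')%N & ~~ (p %| w')%N.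
Proof.
move=> m1 pw; elim: i => [|i [w' IHi pw']]; first by exists w; rewrite ?addn0 ?expn1.
rewrite expnSr expnM IHi addnS; apply: expn_unit_prime => //.
exact: leq_trans m1 (leq_addr _ _).
Qed.

(** Write e = p^i e' with e' prime to p: the p-part raises the level of 1 + p^m w by exactly i, the
    rest leaves it unchanged, so m + i must reach n. *)
Lemma expn_unit_modn m w e n : (1 < m <= n)%N -> ~~ (p %| w)%N ->
  ((1 + p ^ m * w) ^ e = 1 %[mod p ^ n])%N -> (p ^ (n - m) %| e)%N.
Proof.
move=> /andP[m1 mn] pw; case: (posnP e) => [-> //|e0].
have [e' pe' eE] := pfactor_coprime p_pr e0; set i := logn p e in eE *.
have [w1 E1 pw1] := expn_unit_ppow i m1 pw.
rewrite mulnC in eE; rewrite eE expnM E1.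
have pe'' : ~~ (p %| e')%N by rewrite -prime_coprime.
have mi0 : (0 < m + i)%N by rewrite addn_gt0 (ltnW m1).
have [w2 -> pw2] := expn_unit_coprime mi0 pw1 pe''.
move/eqP; rewrite -[X in (_ == X %[mod _])%N]addn0 eqn_modDl mod0n -/(dvdn _ _).
have w20 : (0 < w2)%N by case: (w2) pw2; rewrite ?dvdn0.
rewrite pfactor_dvdn ?muln_gt0 ?expn_gt0 ?(prime_gt0 p_pr) // lognM ?expn_gt0 ?(prime_gt0 p_pr) //.
rewrite pfactorK // (_ : logn p w2 = 0%N); last first.
  by apply/eqP; rewrite -leqn0 leqNgt logn_gt0 mem_primes p_pr w20.
by rewrite addn0 => nmi; rewrite dvdn_mulr // dvdn_exp2l // leq_subLR.
Qed.

(** The first p^(n - m) powers are distinct modulo p^n and all lie in the p^(n - m) classes 1 + p^m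
    t, so they exhaust them. *)
Lemma sum_powers_mod (V : nmodType) (Psi : nat -> V) m w n :
  (1 < m <= n)%N -> ~~ (p %| w)%N ->
  (forall a b, a = b %[mod p ^ n] -> Psi a = Psi b) ->
  \sum_(i < p ^ (n - m)) Psi ((1 + p ^ m * w) ^ i)%N =
  \sum_(t < p ^ (n - m)) Psi (1 + p ^ m * t)%N.
Proof.
move=> mn pw Psi_mod; have /andP[m1 mn'] := mn; set W := (p ^ (n - m))%N.
have W0 : (0 < W)%N by rewrite expn_gt0 prime_gt0.
have pmW : (p ^ m * W = p ^ n)%N by rewrite -expnD subnKC.
have /choice[t tE] i : exists t, ((1 + p ^ m * w) ^ i = 1 + p ^ m * t)%N.
  have [z ->] := expn1D (p ^ m * w) i.
  by exists (i * w + p ^ m * w ^ 2 * z)%N; rewrite expnMn; ring.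
have lt_t (i : 'I_W) : (t i %% W < W)%N by rewrite ltn_mod.
have modE k : (1 + p ^ m * (k %% W) = 1 + p ^ m * k %[mod p ^ n])%N.
  by rewrite -pmW muln_modr modnDmr.
pose f (i : 'I_W) := Ordinal (lt_t i).
have f_inj : injective f.
  suff W_inj (i i' : 'I_W) : (i <= i')%N -> f i = f i' -> i = i'.
    move=> i i' fE; case: (leqP i i') => [le|/ltnW le]; first exact: W_inj.
    exact/esym/W_inj.
  move=> le /(congr1 val) /= tt; apply: val_inj; apply/eqP; rewrite eqn_leq le /= -subn_eq0.
  have : (1 + p ^ m * t i = 1 + p ^ m * t i' %[mod p ^ n])%N by rewrite -modE tt modE.
  rewrite -!tE -(subnKC le) expnD -{1}[((1 + p ^ m * w) ^ i)%N]muln1 => /eqP.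
  rewrite eq_sym eqn_mod_dvd; last by rewrite leq_mul // expn_gt0.
  rewrite -mulnBr Gauss_dvdr; last first.
    rewrite coprimeXl // prime_coprime // tE -[p in (p %| _)%N]expn1.
    apply/negP => p1; suff : (p %| 1)%N.
      by rewrite dvdn1 => /eqP p1'; move: (prime_gt1 p_pr); rewrite p1'.
    by rewrite -(dvdn_addl 1 (_ : p %| p ^ m * t i)%N) ?dvdn_mulr ?dvdn_exp ?(ltnW m1).
  rewrite -eqn_mod_dvd ?expn_gt0 // => /eqP/(expn_unit_modn mn pw) Wd.
  rewrite (subnKC le); case: (posnP (i' - i)%N) => [d0|d0]; first exact/eqP; have := dvdn_leq d0 Wd.
  by rewrite leqNgt (leq_ltn_trans (leq_subr _ _) (ltn_ord i')).
rewrite [RHS](reindex_inj f_inj) /=; apply: eq_bigr => i _.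
by apply: Psi_mod; rewrite tE modE.
Qed.

End PowersModPrimePower.

(** * Frobenius and the vanishing criterion modulo l *)

Section Frobenius.
Variables (A : comNzRingType) (l : nat) (l_pr : prime l).
Implicit Types x y : A.

Definition congl x y := exists z, x = y + z *+ l.

Lemma congl_refl x : congl x x.
Proof. by exists 0; rewrite mul0rn addr0. Qed.

Lemma congl_trans x y z : congl x y -> congl y z -> congl x z.
Proof. by move=> [u ->] [v ->]; exists (v + u); rewrite mulrnDl addrA. Qed.

Lemma congl_sym x y : congl x y -> congl y x.
Proof. by move=> [u ->]; exists (- u); rewrite mulNrn addrK. Qed.

Lemma conglD x y x' y' : congl x y -> congl x' y' -> congl (x + x') (y + y').
Proof. by move=> [u ->] [v ->]; exists (u + v); rewrite mulrnDl addrACA. Qed.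

Lemma conglM x y x' y' : congl x y -> congl x' y' -> congl (x * x') (y * y').
Proof.
move=> [u ->] [v ->]; exists (y * v + u * y' + u * v *+ l).
by rewrite !mulrDl !mulrDr !mulrnAr !mulrnAl !mulrnDl !addrA; ring.
Qed.

Lemma conglX x y n : congl x y -> congl (x ^+ n) (y ^+ n).
Proof.
move=> xy; elim: n => [|n IHn]; first exact: congl_refl.
by rewrite !exprS; exact: conglM.
Qed.

Lemma congl_exprD x y : congl ((x + y) ^+ l) (x ^+ l + y ^+ l).
Proof.
rewrite /congl; case: (l) l_pr => [|l'] // lp; rewrite exprDn big_ord_recl big_ord_recr /=.
rewrite -[bump 0 l']/(l'.+1) subn0 subnn !expr0 mulr1 mul1r bin0 binn !mulr1n.
suff [z ->] : exists z, \sum_(i < l')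
    x ^+ (l'.+1 - bump 0 i) * y ^+ bump 0 i *+ 'C(l'.+1, bump 0 i) = z *+ l'.+1.
  by exists z; rewrite [z *+ _ + _]addrC addrA.
elim/big_ind: _ => [|_ _ [u ->] [v ->]|i _].
- by exists 0; rewrite mul0rn.
- by exists (u + v); rewrite mulrnDl.
have /dvdnP[k ->] : (l'.+1 %| 'C(l'.+1, bump 0 i))%N.
  by apply: prime_dvd_bin => //=; rewrite ltnS ltn_ord.
by eexists; rewrite mulrnA; reflexivity.
Qed.

Lemma congl_expr_sum (I : Type) (s : seq I) (a : I -> A) k :
  congl ((\sum_(i <- s) a i) ^+ (l ^ k)) (\sum_(i <- s) a i ^+ (l ^ k)).
Proof.
elim: k => [|k IHk].
  by rewrite expn0 expr1 (eq_bigr _ (fun i _ => expr1 (a i))); exact: congl_refl.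
rewrite expnSr exprM; apply: congl_trans (conglX _ IHk) _.
under [X in congl _ X]eq_bigr do rewrite exprM.
elim: s {IHk} => [|i s IHs]; 
  first by rewrite !big_nil expr0n -[l]prednK ?prime_gt0 //; exact: congl_refl.
rewrite !big_cons; apply: congl_trans (congl_exprD _ _) _.
by apply: conglD IHs; exact: congl_refl.
Qed.

End Frobenius.

Lemma congl_int_expr l (l_pr : prime l) (c : int) k : congl l (c ^+ (l ^ k)) c.
Proof.
have l0 : l%:Z != 0 by rewrite eqz_nat -lt0n prime_gt0.
have cc : congl l c (c %% l)%Z.
  by exists (c %/ l)%Z; rewrite -mulr_natr natz addrC -divz_eq.
apply: congl_trans (conglX _ cc) _; apply: congl_trans (congl_sym cc).
have : (0 <= c %% l)%Z by exact: modz_ge0.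
case: (c %% l)%Z => n // _.
(* Fermat's little theorem, by applying Frobenius to a sum of n ones. *)
have := @congl_expr_sum int l l_pr 'I_n (index_enum 'I_n) (fun=> 1) k.
under [X in congl _ _ X]eq_bigr do rewrite expr1n.
by rewrite sumr_const card_ord natz.
Qed.

Section QuotientByElement.
Variables (H : finZmodType) (h : H).

Let e x := x + h.
Let e_inj : injective e. Proof. exact: addIr. Qed.

(* Orbits of x |-> x + h, that is cosets of the subgroup generated by h, are
   represented by canonical elements. *)
Definition qroot x := froot e x.
Definition quot := {x : H | qroot x == x}.

Lemma iter_addr t x : iter t e x = x + h *+ t.
Proof. by elim: t => [|t IHt]; rewrite ?addr0 // iterS IHt mulrSr addrA. Qed.

Lemma qrootP x y : reflect (exists t, y = x + h *+ t) (qroot x == qroot y).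
Proof.
rewrite root_connect; last exact: fconnect_sym.
apply: (iffP idP) => [xy|[t ->]]; last by rewrite -iter_addr fconnect_iter.
by exists (findex e x y); rewrite -iter_addr iter_findex.
Qed.

Lemma qroot_id x : qroot (qroot x) = qroot x.
Proof. by rewrite /qroot root_root //; exact: fconnect_sym. Qed.

Lemma qrootD x y : qroot (qroot x + y) = qroot (x + y).
Proof.
apply/eqP/qrootP; have /eqP/qrootP[t xE] := qroot_id x.
by exists t; rewrite addrAC -xE.
Qed.

Definition quot_pi x : quot := exist _ (qroot x) (introT eqP (qroot_id x)).

Lemma quot_piK : cancel (val : quot -> H) quot_pi.
Proof. by move=> s; apply: val_inj; apply/eqP; exact: (valP s). Qed.

Lemma quot_pi_eq x y : (quot_pi x == quot_pi y) = (qroot x == qroot y).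
Proof. by []. Qed.

Variables (W : nat) (l : nat).
Hypotheses (W0 : (0 < W)%N) (hW : h *+ W = 0).

(** [W] need only be a multiple of the order of [h]. The W steps visit every point of the coset of s
    equally often, since translation by [h] shifts the index t cyclically. *)
Lemma quot_sum (X : H -> int) (s : H) :
  (l %| \sum_(u | quot_pi u == quot_pi s) X u)%Z ->
  (l %| \sum_(t < W) X (s + h *+ t))%Z.
Proof.
move=> lX; pose c u := #|[set t : 'I_W | s + h *+ t == u]|.
have hmod k : h *+ (k %% W) = h *+ k.
  by rewrite {2}(divn_eq k W) mulrnDr mulnC mulrnA hW mul0rn add0r.
have cS u : c (u + h) = c u.
  have lt_t (t : 'I_W) : (t.+1 %% W < W)%N by rewrite ltn_mod.
  pose f (t : 'I_W) := Ordinal (lt_t t).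
  have f_inj : injective f.
    move=> t t' /(congr1 val) /= /eqP; rewrite -(addn1 t) -(addn1 t') eqn_modDr.
    by rewrite !modn_small // => /eqP tt; apply: val_inj.
  rewrite /c -(on_card_preimset (onW_bij _ (injF_bij f_inj))).
  apply: eq_card => t; rewrite !inE /= hmod mulrSr addrA.
  by rewrite (inj_eq (addIr h)).
have cE u : quot_pi u == quot_pi s -> c u = c s.
  rewrite quot_pi_eq eq_sym => /qrootP[t ->].
  by elim: t => [|t IHt]; rewrite ?addr0 // mulrSr addrA cS.
have c0 u : quot_pi u != quot_pi s -> c u = 0%N.
  move=> us; apply: eq_card0 => t; rewrite inE; apply: contraNF us => /eqP <-.
  by rewrite quot_pi_eq eq_sym; apply/qrootP; exists t.
rewrite (partition_big (fun t : 'I_W => s + h *+ t) predT) //=.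
rewrite (eq_bigr (fun u => X u *+ c u)) => [|u _]; last first.
  rewrite (eq_bigr (fun=> X u)) => [|t /eqP -> //].
  by rewrite sumr_const; congr (_ *+ _); apply: eq_card => t; rewrite inE.
rewrite (bigID (fun u => quot_pi u == quot_pi s)) /= [X in _ + X]big1 ?addr0; last first.
  by move=> u /c0 ->.
rewrite (eq_bigr (fun u => X u *+ c s)) => [|u /cE -> //].
by rewrite sumrMnl -mulr_natr dvdz_mulr.
Qed.

End QuotientByElement.

Lemma dvdz_sumr (l : int) (I : Type) (r : seq I) (P : pred I) (F : I -> int) :
  (forall i, P i -> (l %| F i)%Z) -> (l %| (\sum_(i <- r | P i) F i)%R)%Z.
Proof.
by move=> lF; apply: rpred_sum.
Qed.

Section TranslationGSet.
Variables (G : zmodType) (H : finZmodType) (red : {additive G -> H}).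

Definition tact (g : G) (s : H) : H := s + red g.
Fact tact0 s : tact 0 s = s. Proof. by rewrite /tact raddf0 addr0. Qed.
Fact tactD g h s : tact (g + h) s = tact g (tact h s).
Proof. by rewrite /tact raddfD addrAC addrA. Qed.
Definition tset := GSet tact0 tactD.

Section Quotient.
Variable h : H.

Definition qact (g : G) (s : quot h) : quot h := quot_pi h (val s + red g).
Fact qact0 s : qact 0 s = s. Proof. by rewrite /qact raddf0 addr0 quot_piK. Qed.
Fact qactD g g' s : qact (g + g') s = qact g (qact g' s).
Proof. by apply: val_inj; rewrite /= qrootD raddfD addrAC addrA. Qed.
Definition qset := GSet qact0 qactD.

Lemma quot_pi_act g (s : tset) : quot_pi h (gact g s) = gact g (quot_pi h s : qset).
Proof. by apply: val_inj; rewrite /= qrootD. Qed.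

Lemma quot_pi_fiber (s : quot h) :
  #|[set x | quot_pi h x == s]| = #|[set x | quot_pi h x == quot_pi h 0]|.
Proof.
rewrite -(card_imset _ (addIr (- val s))); apply: eq_card => x.
have shift (u v w : H) : (quot_pi h (u + w) == quot_pi h (v + w)) = (quot_pi h u == quot_pi h v).
  apply/qrootP/qrootP => -[t E]; exists t.
    by apply: (addIr w); rewrite E addrAC.
  by rewrite E addrAC.
rewrite inE; apply/imsetP/idP => [[y + ->]|x0]; rewrite ?inE.
  by rewrite -{1}(quot_piK s) -[in X in _ -> X](shift _ _ (val s)) subrK add0r.
by exists (x + val s); rewrite ?addrK // inE -{2}(quot_piK s) -{2}[val s]add0r shift.
Qed.

Section Factor.
Variables (T : gset G) (f : tset -> T) (j : T -> tset).
Hypotheses (jK : cancel j f) (fP : forall g s, f (gact g s) = gact g (f s)).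
Hypothesis fh : forall s, f (s + h) = f s.

Definition qfactor (s : qset) : T := f (val s).
Definition qsection (t : T) : qset := quot_pi h (j t).

Lemma qfactor_pi s : qfactor (quot_pi h s) = f s.
Proof.
rewrite /qfactor /=; have /eqP/qrootP[t E] := qroot_id h s.
rewrite [in RHS]E; move: (qroot h s) => u {E}.
by elim: t => [|t IHt]; rewrite ?addr0 // mulrSr addrA fh.
Qed.

Lemma qsectionK : cancel qsection qfactor.
Proof. by move=> t; rewrite qfactor_pi jK. Qed.

Lemma qfactor_act g s : qfactor (gact g s) = gact g (qfactor s).
Proof. by rewrite qfactor_pi -fP. Qed.

End Factor.
End Quotient.

Section Key.
Variables (F : grpring G) (g1 : G) (l p n m w a : nat).
Hypotheses (l_pr : prime l) (p_pr : prime p) (l_neq_p : l <> p).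
Hypotheses (mn : (1 < m <= n)%N) (laE : (l ^ a = 1 + p ^ m * w)%N) (pw : ~~ (p %| w)%N).
Hypothesis pnH : forall x : H, x *+ p ^ n = 0.
Hypothesis Fg1 : ~~ (l %| F@_g1)%Z.

(** The sign is that of the action on coefficients: the coefficient of g x at s is the one of x at s
    - [red g]. *)
Definition qshift (g : G) : H := - (red (g - g1) *+ p ^ m).

Variable x : 'cV[int]_#|tset|.
Hypothesis Fx : dvdv l (rho tset F *m x).
Hypothesis qx : forall g, g \in msupp F -> g != g1 ->
  dvdv l (push (quot_pi (qshift g)) *m x).

Let X (u : H) := x (enum_rank u) 0.
Let W := (p ^ (n - m))%N.

Let W0 : (0 < W)%N. Proof. by rewrite expn_gt0 prime_gt0. Qed.

Let pushE (U : finType) (f : H -> U) s : (push f *m x) (enum_rank s) 0 = \sum_(u | f u == s) X u.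
Proof.
rewrite mxE [RHS]big_mkcond -[RHS]sum_enum_val; apply: eq_bigr => i _.
by rewrite !mxE enum_rankK /X enum_valK; case: ifP; rewrite ?mul1r ?mul0r.
Qed.

Let actE g s : (push (@gact G tset g) *m x) (enum_rank s) 0 = X (s - red g).
Proof.
rewrite pushE (big_pred1 (s - red g)) // => u /=.
by rewrite -(inj_eq (addIr (- red g))) addrK.
Qed.

(** The translation moves the distinguished coefficient to the group element 0, which is fixed under
    multiplication by l^k. *)
Let F1 : grpring G := grp_elt (- g1) * F.

Let F1E : F1 = \sum_(g <- msupp F) << F@_g *g (g - g1) >>.
Proof.
rewrite /F1 {1}[F]monalgE mulr_sumr; apply: eq_bigr => g _.
by rewrite [LHS]grp_mulUU mul1r addrC.
Qed.

Let monoX (c : int) (g : G) N : (<< c *g g >> : grpring G) ^+ N = << c ^+ N *g (g *+ N) >>.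
Proof.
elim: N => [|N IHN]; first by rewrite !expr0 mulr0n.
by rewrite !exprS IHN mulrS; exact: grp_mulUU.
Qed.

(* Coefficient at s of F1^(l^k) x, reduced modulo l. *)
Let term k s : (l %| \sum_(g <- msupp F) F@_g * X (s - red (g - g1) *+ l ^ k))%Z.
Proof.
set N := (l ^ k)%N; have N0 : (0 < N)%N by rewrite expn_gt0 prime_gt0.
have FN : dvdv l (rho tset (F1 ^+ N) *m x).
  rewrite -(prednK N0) exprSr /F1 mulrA (rmorphM (rho tset)) -mulmxA.
  move=> i; rewrite mxE; apply: dvdz_sumr => i' _.
  by apply: dvdz_mull; exact: Fx.
have [z zE] := congl_expr_sum l_pr (msupp F) (fun g => << F@_g *g (g - g1) >> : grpring G) k.
have NE : \sum_(g <- msupp F) F@_g ^+ N * X (s - red (g - g1) *+ N) =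
    (rho tset (F1 ^+ N) *m x) (enum_rank s) 0 - (rho tset z *m x) (enum_rank s) 0 *+ l.
  rewrite F1E zE (rmorphD (rho tset)) (rmorphMn (rho tset)) mulmxDl.
  rewrite -[rho tset z *+ l]scaler_nat -scalemxAl scaler_nat.
  rewrite [in RHS]mxE mulmxnE addrK (rmorph_sum (rho tset)).
  rewrite mulmx_suml summxE; apply: eq_bigr => g _; rewrite monoX.
  have -> : rho tset << F@_g ^+ N *g ((g - g1) *+ N) >> =
      F@_g ^+ N *: push (@gact G tset ((g - g1) *+ N)).
    by rewrite /= gliftU -scaler_int intz.
  by rewrite -scalemxAl mxE actE (raddfMn red).
(* Frobenius also raises the coefficients to the power N; by Fermat this changes the sum only by a
   multiple of l. *)
have -> : \sum_(g <- msupp F) F@_g * X (s - red (g - g1) *+ N) =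
  \sum_(g <- msupp F) F@_g ^+ N * X (s - red (g - g1) *+ N) +
  \sum_(g <- msupp F) (F@_g - F@_g ^+ N) * X (s - red (g - g1) *+ N).
  by rewrite -big_split; apply: eq_bigr => g _ /=; rewrite mulrBl addrC subrK.
apply: rpredD.
  by rewrite NE; apply: rpredB; [exact: FN | rewrite -mulr_natr natz dvdz_mull].
apply: dvdz_sumr => g _.
have [u ->] := congl_int_expr l_pr (F@_g) k.
by rewrite opprD addrA subrr sub0r -mulr_natr natz dvdz_mulr // rpredN dvdz_mull.
Qed.

Lemma dvdv_key : dvdv l x.
Proof.
move=> i; rewrite -(enum_valK i); set s := enum_val i; change (l %| X s)%Z.
have [m1 mn'] := andP mn.
have Wm : (p ^ m * W = p ^ n)%N by rewrite -expnD subnKC.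
pose Psi g b := X (s - red (g - g1) *+ b).
have PsiP g b b' : b = b' %[mod p ^ n] -> Psi g b = Psi g b'.
  move=> bb; congr (X (_ - _)); rewrite (divn_eq b (p ^ n)) (divn_eq b' (p ^ n)) bb.
  by rewrite !mulrnDr ![(_ * p ^ n)%N]mulnC !mulrnA !pnH !mul0rn !add0r.
have sum_dvd : (l %| \sum_(g <- msupp F) F@_g * \sum_(t < W) Psi g (1 + p ^ m * t)%N)%Z.
  under eq_bigr do rewrite -(sum_powers_mod p_pr mn pw (PsiP _)) mulr_sumr.
  rewrite exchange_big /=; apply: dvdz_sumr => t _.
  by have := term (a * t) s; rewrite expnM laE.
have g1F : g1 \in msupp F by rewrite -mcoeff_neq0; apply: contraNneq Fg1 => ->; rewrite dvdz0.
move: sum_dvd; rewrite (bigD1_seq g1 g1F (fset_uniq _)) /=.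
rewrite rpredDr; last first.
  rewrite big_seq_cond; apply: dvdz_sumr => g /andP[gF gg1].
  apply: dvdz_mull; rewrite (eq_bigr (fun t : 'I_W => X (s - red (g - g1) + qshift g *+ t))).
    apply: quot_sum => //.
      by rewrite /qshift mulNrn -mulrnA Wm pnH oppr0.
    by have := qx gF gg1 (enum_rank (quot_pi (qshift g) (s - red (g - g1)))); rewrite pushE.
  by move=> t _; rewrite /Psi /qshift mulrnDr opprD addrA mulr1n mulNrn -mulrnA.
(* Only g1 is left, with contribution [F@_g1 * W * X s]. Both [F@_g1] and the power [W] of p are
   prime to l. *)
rewrite (eq_bigr (fun=> X s)) => [|t _]; last by rewrite /Psi subrr raddf0 mul0rn subr0.
rewrite sumr_const card_ord -mulr_natr mulrCA => lFX.
have coW : coprime l W.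
  rewrite prime_coprime // Euclid_dvdX // (dvdn_prime2 l_pr p_pr).
  by apply/negP => /andP[/eqP].
move: lFX; rewrite natz !dvdzE !abszM mulnA !Gauss_dvdl //.
by rewrite prime_coprime // -[_ %| _]/(l%:Z %| F@_g1)%Z.
Qed.

End Key.
End TranslationGSet.

(** * The bound on the determinant of F0 *)

Section GammaSets.
Variables (p : nat) (p_pr : prime p) (d : nat).
Local Notation Gamma := (Gam p_pr d).

Fact Gam_red_is_zmod_morphism n : zmod_morphism (@Gam_red p p_pr d n).
Proof. by move=> x y; apply/rowP => i; rewrite !mxE. Qed.
HB.instance Definition _ n :=
  GRing.isZmodMorphism.Build Gamma (Gamq p n d) (@Gam_red p p_pr d n) (@Gam_red_is_zmod_morphism n).

Lemma Gamq_mulrn n (x : Gamq p n d) k i : ((x *+ k) 0%R i = k * x 0%R i %% p ^ n :> nat)%N.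
Proof.
by rewrite mulmxnE Zp_mulrn /= mulnC; congr modn; rewrite (ppow_prednK p_pr).
Qed.

Lemma Gamq_ann n (x : Gamq p n d) : x *+ p ^ n = 0.
Proof. by apply/rowP => i; apply: val_inj; rewrite /= Gamq_mulrn modnMr mxE. Qed.

Definition Gamq_gset n : gset Gamma := tset (@Gam_red p p_pr d n).

(** One formula with two uses: the reduction homomorphism if n' <= n, and its set-theoretic section
    by least residues if n <= n'. *)
Definition Gamq_map n n' (s : Gamq p n d) : Gamq p n' d := map_mx (fun x => inZp (val x)) s.

Lemma Gamq_mapK n n' : (n <= n')%N -> cancel (@Gamq_map n n') (@Gamq_map n' n).
Proof.
move=> nn' s; apply/rowP => i; rewrite !mxE -[RHS]valZpK /=.
exact/inZp_modn/ppow_dvd.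
Qed.

Lemma Gamq_mapD n n' (x y : Gamq p n' d) : (n <= n')%N ->
  Gamq_map n (x + y) = Gamq_map n x + Gamq_map n y.
Proof.
move=> nn'; apply/rowP => i; rewrite !mxE; apply: val_inj => /=.
by rewrite modn_dvdm ?ppow_dvd // modnDm.
Qed.

Lemma Gamq_map_red n n' (g : Gamma) : (n <= n')%N -> Gamq_map n (Gam_red n' g) = Gam_red n g.
Proof. by move=> nn'; apply/rowP => i; rewrite !mxE padic_res_le. Qed.

Lemma Gamq_map_act n n' (g : Gamma) (s : Gamq_gset n') : (n <= n')%N ->
  Gamq_map n (gact g s) = gact g (Gamq_map n s : Gamq_gset n).
Proof. by move=> nn'; rewrite /= /tact Gamq_mapD // Gamq_map_red. Qed.

Lemma Gam_red_surj n (s : Gamq p n d) : exists g : Gamma, Gam_red n g = s.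
Proof.
exists (\row_i (nat_of_ord (s 0 i))%:R); apply/rowP => i; rewrite !mxE.
apply: val_inj; rewrite /= padic_nat_res modn_small //.
by rewrite -[X in (_ < X)%N](ppow_prednK p_pr n) ltn_ord.
Qed.

Lemma Gamq_map_shift n n' (h s : Gamq p n' d) : (n <= n')%N -> Gamq_map n h = 0 ->
  Gamq_map n (s + h) = Gamq_map n s.
Proof. by move=> nn' h0; rewrite Gamq_mapD // h0 addr0. Qed.

Lemma card_Gamq n : #|{: Gamq p n d}| = (p ^ (n * d))%N.
Proof. by rewrite card_mx card_ord (ppow_prednK p_pr) mul1n expnM. Qed.

(** Take a level v at which some coordinate of g is nonzero: its valuation is less than v, uniformly
    in n. Truncated subtraction makes the claim trivial for n <= m + v. *)
Lemma Gam_order (g : Gamma) : g != 0 -> exists v, forall n m k,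
  Gam_red n g *+ p ^ m *+ k = 0 -> (p ^ (n - m - v) %| k)%N.
Proof.
move=> g0; have [i gi] : exists i, g 0 i != 0.
  apply/existsP; apply: contraR g0 => /existsPn g0; apply/eqP/rowP => i.
  by rewrite mxE; apply/eqP; rewrite -[_ == _]negbK g0.
have [v gv] := padic_neq0P gi; exists v => n m k.
rewrite -mulrnA => /rowP/(_ i)/(congr1 val); rewrite [LHS]Gamq_mulrn !mxE /= => E.
case: (leqP n (m + v)) => nmv.
  by rewrite -subnDA (eqP nmv) dvd1n.
case: (posnP k) => [-> //|k0].
have vn : (v <= n)%N by apply: leq_trans (ltnW nmv); exact: leq_addl.
have := padic_res_modn (g 0 i) vn; move: E gv; set y := nat_of_ord (g 0 i n) => E gv yE.
have y0 : (0 < y)%N by rewrite lt0n; apply: contraTneq gv => y0; rewrite -yE y0 mod0n.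
have ly : (logn p y < v)%N.
  rewrite ltnNge -pfactor_dvdn //; apply: contraL gv => /eqP ypv.
  by rewrite -yE ypv.
move/eqP: E; rewrite -/(dvdn _ _) pfactor_dvdn ?muln_gt0 ?expn_gt0 ?(prime_gt0 p_pr) ?k0 //.
rewrite lognM ?muln_gt0 ?expn_gt0 ?(prime_gt0 p_pr) ?k0 //.
rewrite lognM ?expn_gt0 ?(prime_gt0 p_pr) // pfactorK // => nle.
by rewrite pfactor_dvdn //; lia.
Qed.

Lemma card_quot (H : finZmodType) (h : H) e : (0 < e)%N ->
  (forall k, h *+ k = 0 -> (e %| k)%N) -> (#|{: quot h}| * e <= #|{: H}|)%N.
Proof.
move=> e0 he; rewrite -[e in X in (X <= _)%N]card_ord -card_prod.
pose f (u : quot h * 'I_e) := val u.1 + h *+ u.2.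
suff f_inj : injective f by rewrite -(card_imset _ f_inj); exact: max_card.
have f1 u : quot_pi h (f u) = u.1.
  rewrite -[RHS]quot_piK; apply/eqP; rewrite quot_pi_eq eq_sym.
  by apply/qrootP; exists u.2.
move=> u v uv; have uv1 : u.1 = v.1 by rewrite -!f1 uv.
move: uv; rewrite /f uv1 => /addrI uv2.
have wlog_le (a b : 'I_e) : (a <= b)%N -> h *+ a = h *+ b -> a = b.
  move=> ab hab; apply: val_inj; apply/eqP; rewrite eqn_leq ab /= -subn_eq0.
  have /he : h *+ (b - a) = 0 by rewrite mulrnBr // hab subrr.
  case: (posnP (b - a)%N) => [d0 _|d0 /(dvdn_leq d0)]; first exact/eqP.
  by rewrite leqNgt (leq_ltn_trans (leq_subr _ _) (ltn_ord b)).
have uv3 : u.2 = v.2.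
  by case: (leqP u.2 v.2) => [le|/ltnW le]; [exact: wlog_le | exact/esym/wlog_le].
by case: u v uv1 uv3 {uv2} => ? ? [? ?] /= -> ->.
Qed.

(** The l-part of a nonzero integer is at most its absolute value, here at most c^N with c = 2
    [l1norm F]. The crude bound c < l^c replaces a logarithm. *)
Lemma ordz_det_relrep l (l_pr : prime l) (G : zmodType) (S T : gset G) (f : S -> T) (j : T -> S)
    (jK : cancel j f) (fP : forall g s, f (gact g s) = gact g (f s)) F :
  \det (relrep jK fP F) != 0 ->
  (ordz l (\det (relrep jK fP F)) <= 2 * l1norm F * #|S|)%N.
Proof.
move=> d0; set c := (2 * l1norm F)%N; set D := \det _ in d0 *.
have cN : (`|D| <= c ^ #|{: relbase f j}|)%N.
  rewrite -lez_nat abszE -[leRHS]natz natrX natz; exact: normr_det_relrep.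
have D0 : (0 < `|D|)%N by rewrite absz_gt0.
have : (l ^ ordz l D <= (l ^ c) ^ #|{: relbase f j}|)%N.
  apply: leq_trans (dvdn_leq D0 (pfactor_dvdnn _ _)) _.
  apply: leq_trans cN _; case: (#|{: relbase f j}|) => // N.
  by rewrite leq_exp2r // ltnW // ltn_expl // prime_gt1.
rewrite -expnM leq_exp2l ?prime_gt1 // => /leq_trans; apply.
by rewrite leq_mul2l orbC card_sig max_card.
Qed.

End GammaSets.

(** Euler's theorem makes some power of l congruent to 1 modulo p^(M + 1). The level m is the exact
    valuation of l^a - 1, so it can only be bounded below, not prescribed. *)
Lemma prime_power_near1 p l M : prime p -> prime l -> l <> p ->
  exists a m w, [/\ (M < m)%N, (l ^ a = 1 + p ^ m * w)%N & ~~ (p %| w)%N].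
Proof.
move=> p_pr l_pr lp; set a := totient (p ^ M.+1).
have a0 : (0 < a)%N by rewrite totient_gt0 expn_gt0 prime_gt0.
have la : (l ^ a = 1 %[mod p ^ M.+1])%N.
  apply: Euler_exp_totient; rewrite coprimeXr // prime_coprime // dvdn_prime2 //.
  exact/eqP.
have l1 : (1 < l ^ a)%N by exact: ltn_exp1.
have la0 : (0 < l ^ a - 1)%N by rewrite subn_gt0.
have [w pw wE] := pfactor_coprime p_pr la0.
exists a, (logn p (l ^ a - 1)), w; split; last by rewrite -prime_coprime.
  by rewrite -pfactor_dvdn // -eqn_mod_dvd ?(ltnW l1) //; apply/eqP.
by rewrite mulnC -wE subnKC // ltnW.
Qed.

Lemma leq_mul_split n e m v : (0 < e)%N -> (m + v <= n)%N ->
  (n * e <= m + v + (e - 1) * n + (n - m - v))%N.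
Proof. by case: e => // e _ mv; rewrite subn1 /= mulnS mulnC; lia. Qed.

Section DetBound.
Variables (p : nat) (p_pr : prime p) (d : nat) (d0 : (0 < d)%N).
Local Notation Gamma := (Gam p_pr d).
Local Notation red n := (@Gam_red p p_pr d n).
Variables (l : nat) (l_pr : prime l) (l_neq_p : l <> p).

(** The action on the kernel of Z[Gamma_n] -> Z[Gamma_n0], which involves the characters of Gamma_n
    that do not factor through Gamma_n0. *)
Definition relrep_level n0 n (nn : (n0 <= n)%N) :=
  relrep (S := Gamq_gset p_pr d n) (T := Gamq_gset p_pr d n0)
    (Gamq_mapK p_pr (d := d) nn) (fun g (s : Gamq_gset p_pr d n) => Gamq_map_act g s nn).

Lemma ordz_det_bound (F : grpring Gamma) (g1 : Gamma) (n0 : nat) :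
  ~~ (l %| F@_g1)%Z ->
  exists C N, forall n (nn : (n0 <= n)%N), (N <= n)%N -> \det (relrep_level nn F) != 0 ->
    (ordz l (\det (relrep_level nn F)) <= C * p ^ ((d - 1) * n))%N.
Proof.
move=> Fg1.
(* Here m > 1 is for the count of powers, and m >= n0 makes each h_g vanish in Gamma_n0, so that the
   map to Gamma_n0 factors through the quotient by h_g. *)
have [a [m [w [mM laE pw]]]] := prime_power_near1 (maxn 1 n0) p_pr l_pr l_neq_p.
have [m1 mn0] : (1 < m)%N /\ (n0 <= m)%N by lia.
pose I := fset_sub_type (msupp F `\ g1)%fset.
have Ig1 (i : I) : val i - g1 != 0.
  by rewrite subr_eq0; have := fsvalP i; rewrite !inE => /andP[].
have /choice[v vP] (i : I) := Gam_order (Ig1 i).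
(* The quotient for i has at most p^(n d) / p^(n - m - v i) elements, that is p^(m + v i) p^((d - 1)
   n); the threshold keeps n - m - v i nonnegative. *)
exists (\sum_i 2 * l1norm F * p ^ (m + v i))%N, (m + \sum_i v i)%N => n nn Nn dn.
have mn : (m <= n)%N by apply: leq_trans Nn; exact: leq_addr.
pose h (i : I) : Gamq p n d := qshift (red n) g1 p m (val i).
have h0 i : Gamq_map n0 (h i) = 0.
  have -> : h i = red n (- ((val i - g1) *+ p ^ m)).
    by rewrite (raddfN (red n)) (raddfMn (red n)).
  rewrite Gamq_map_red // (raddfN (red n0)) (raddfMn (red n0)) -[m](subnK mn0) expnD.
  by rewrite mulrnA (Gamq_ann p_pr) oppr0.
have fh i (s : Gamq p n d) : Gamq_map n0 (s + h i) = Gamq_map n0 s.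
  exact: Gamq_map_shift.
pose fP g (s : Gamq_gset p_pr d n) := Gamq_map_act g s nn.
pose jK := Gamq_mapK p_pr (d := d) nn.
pose T := Gamq_gset p_pr d n0.
pose f_ (i : I) : qset (red n) (h i) -> T := @qfactor _ _ (red n) (h i) T (Gamq_map n0).
pose j_ (i : I) : T -> qset (red n) (h i) := @qsection _ _ (red n) (h i) T (Gamq_map n).
have jK_ i : cancel (j_ i) (f_ i) 
  by exact: (@qsectionK _ _ (red n) (h i) T (Gamq_map n0) (Gamq_map n) jK (fh i)).
have fP_ i g s : f_ i (gact g s) = gact g (f_ i s) 
  by exact: (@qfactor_act _ _ (red n) (h i) T (Gamq_map n0) fP (fh i)).
have dq i : \det (relrep (jK_ i) (fP_ i) F) != 0.
  apply: (@relrep_det_quotient Gamma F (Gamq_gset p_pr d n) T (Gamq_map n0) (Gamq_map n) jK fP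
    (qset (red n) (h i)) (quot_pi (h i)) (f_ i) (j_ i)
    #|[set x | quot_pi (h i) x == quot_pi (h i) 0]| (jK_ i) (fP_ i)) => //.
  - by move=> g s; exact: quot_pi_act.
  - by move=> s; exact: (@qfactor_pi _ _ (red n) (h i) T (Gamq_map n0) (fh i)).
  - by apply/card_gt0P; exists 0; rewrite inE.
  - by move=> s; exact: quot_pi_fiber.
have key := @dvdv_key _ _ (red n) F g1 l p n m w a l_pr p_pr l_neq_p _ laE pw
  (@Gamq_ann p p_pr d n) Fg1.
have := @ordz_det_compare Gamma F l l_pr (Gamq_gset p_pr d n) T (Gamq_map n0)
  (Gamq_map n) jK fP I (fun i => qset (red n) (h i))
  (fun i => quot_pi (h i)) (fun i => val) f_ j_ (fun i => @quot_piK _ (h i)) jK_.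
move=> /(_ (fun i => @quot_pi_act _ _ (red n) (h i)) fP_
  (fun i => @qfactor_pi _ _ (red n) (h i) T (Gamq_map n0) (fh i))).
move=> cmp; apply: leq_trans (cmp _ dn dq) _ => [x Fx hx|].
  apply: key => //; first by rewrite m1.
  move=> g gF gg1; have gI : g \in (msupp F `\ g1)%fset by rewrite !inE gg1.
  exact: (hx [` gI]%fset).
rewrite big_distrl /=; apply: leq_sum => i _.
apply: leq_trans (ordz_det_relrep l_pr (dq i)) _.
rewrite -[X in (_ <= X)%N]mulnA leq_mul2l; apply/orP; right.
have e0 : (0 < p ^ (n - m - v i))%N by rewrite expn_gt0 prime_gt0.
rewrite -(leq_pmul2r e0); apply: leq_trans (card_quot e0 _) _.
  move=> k hk; apply: (vP i); rewrite /h /qshift in hk.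
  by apply/eqP; rewrite -oppr_eq0 -mulNrn hk.
rewrite (card_Gamq p_pr) -!expnD leq_pexp2l ?(prime_gt0 p_pr) //.
have vin : (m + v i <= n)%N.
  by apply: leq_trans Nn; rewrite leq_add2l (bigD1 i) //= leq_addr.
exact: leq_mul_split.
Qed.

End DetBound.

(** * Asymptotics of the torsion *)

Lemma bigmin_mem (s : seq nat) x0 : \big[minn/x0]_(x <- s) x \in x0 :: s.
Proof.
elim: s => [|y s IHs]; first by rewrite big_nil inE.
rewrite big_cons /minn; case: ifP => _; first by rewrite !inE eqxx orbT.
by move: IHs; rewrite !inE => /orP[->//|->]; rewrite !orbT.
Qed.

Lemma bigmin_le (s : seq nat) x0 y : y \in s -> (\big[minn/x0]_(x <- s) x <= y)%N.
Proof.
elim: s => // x s IHs; rewrite inE big_cons geq_min => /orP[/eqP->|/IHs->];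
  by rewrite ?leqnn ?orbT.
Qed.

(** * The power of l dividing an element of the group ring *)

Section MuDecomposition.
Variables (p : nat) (p_pr : prime p) (d : nat) (l : nat) (l_pr : prime l).

Lemma mu_le (F : Phi p_pr d) g : g \in msupp F -> (mu l F <= ordz l F@_g)%N.
Proof. by move=> gF; apply: bigmin_le; apply/mapP; exists g. Qed.

Lemma mu_attained (F : Phi p_pr d) : F != 0 -> exists2 g, g \in msupp F & mu l F = ordz l F@_g.
Proof.
move=> F0; suff : mu l F \in [seq ordz l F@_g | g <- msupp F].
  by move=> /mapP[g gF ->]; exists g.
(* The default value of the minimum is the first entry of s, so it does not add a new value when s
   is nonempty. *)
rewrite /mu; set s := [seq _ | g <- _]; have := bigmin_mem s (head 0%N s).
have : s != [::].
  apply: contra_neq F0 => /(congr1 size); rewrite size_map => /size0nil s0.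
  apply/(@malgP (Gam p_pr d) int F 0) => g; rewrite mcoeff0; apply: mcoeff_outdom.
  by apply/negP => gF; have : g \in (msupp F : seq _) by []; rewrite s0.
by case: s => // x s _; rewrite !inE /= => /orP[->|]//.
Qed.

Lemma mu_decomposition (F : Phi p_pr d) : F != 0 -> exists (F0 : Phi p_pr d) g1,
  F = F0 *+ l ^ mu l F /\ ~~ (l %| F0@_g1)%Z.
Proof.
move=> Fn0; set m := mu l F; have lm0 : (l ^ m)%:Z != 0.
  by rewrite eqz_nat -lt0n expn_gt0 prime_gt0.
have F_dvd g : g \in msupp F -> ((l ^ m)%:Z %| F@_g)%Z.
  move=> gF; rewrite dvdzE pfactor_dvdn ?absz_gt0 ?mcoeff_neq0 //; exact: mu_le.
pose F0 : Phi p_pr d := \sum_(g <- msupp F) << (F@_g %/ (l ^ m)%:Z)%Z *g g >>.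
have F0E : F = F0 *+ l ^ m.
  rewrite {1}[F]monalgE /F0 -sumrMnl big_seq [RHS]big_seq; apply: eq_bigr => g gF.
  rewrite -[RHS](raddfMn (mkmalgU g)) -mulr_natr natz divzK //; exact: F_dvd.
have [g1 g1F mE] := mu_attained Fn0; exists F0, g1; split=> //.
have F1n0 : F@_g1 != 0 by rewrite mcoeff_neq0.
apply/negP => /dvdzP[c cE]; suff : (m < m)%N by rewrite ltnn.
rewrite {2}/m mE /ordz -pfactor_dvdn ?absz_gt0 // expnS.
have -> : F@_g1 = c * l%:Z * (l ^ m)%:Z by rewrite {1}F0E mcoeffMn cE -mulr_natr natz.
by rewrite !abszM -mulnA dvdn_mull.
Qed.

End MuDecomposition.

Section TauCompare.
Variables (l : nat) (l_pr : prime l).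

(** Two consecutive values of k force equal slopes, hence equal constant terms: the torsion
    exponents agree once the rank part is removed. *)
Lemma exp_affine_inj (K t z t' z' : nat) :
  (forall k, (K <= k)%N -> l ^ (t + k * z) = l ^ (t' + k * z'))%N -> t = t'.
Proof.
move=> E; have E' k : (K <= k)%N -> (t + k * z = t' + k * z')%N.
  by move=> /E/eqP; rewrite eqn_exp2l ?prime_gt1 // => /eqP.
by have := E' K (leqnn K); have := E' K.+1 (leqnSn K); nia.
Qed.

(** Kernel counts determine the torsion exponent, so cokernels over different index sets are
    compared without constructing an isomorphism. *)
Lemma tor_ord_kercount m n (A : 'M[int]_m) (B : 'M[int]_n) :
  (forall q, kercount q A = kercount q B) -> tor_ord l_pr A = tor_ord l_pr B.
Proof.
move=> AB; have [z [k0 [_ kA _]]] := kercount_tor_ord l_pr A.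
have [z' [k0' [_ kB _]]] := kercount_tor_ord l_pr B.
apply: (@exp_affine_inj (k0 + k0') _ z _ z') => k kk.
by rewrite -kA ?AB ?kB //; lia.
Qed.

Lemma kercount_reindex q m n (A : 'M[int]_m) (B : 'M[int]_n) (s : 'I_m -> 'I_n) :
  bijective s -> (forall i j, A i j = B (s i) (s j)) -> kercount q A = kercount q B.
Proof.
move=> [t sK tK] AB.
pose f (x : 'cV['Z_q]_n) : 'cV['Z_q]_m := \col_i x (s i) 0.
have f_inj : injective f.
  by move=> x y /colP xy; apply/colP => i; have := xy (t i); rewrite !mxE tK.
rewrite /kercount -[RHS](card_imset _ f_inj); apply: eq_card => x; rewrite !inE.
have E (y : 'cV['Z_q]_n) i : (zmx 'Z_q A *m f y) i 0 = (zmx 'Z_q B *m y) (s i) 0.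
  rewrite !mxE [RHS](reindex s) /=; last by exists t => k _.
  by apply: eq_bigr => j _; rewrite !mxE AB.
apply/eqP/imsetP => [xA|[y + ->]].
  exists (\col_i x (t i) 0); last by apply/colP => i; rewrite !mxE sK.
  rewrite inE; apply/eqP/colP => i; rewrite -(tK i) -E.
  have -> : f (\col_i x (t i) 0) = x by apply/colP => i'; rewrite !mxE sK.
  by rewrite xA !mxE.
by rewrite inE => /eqP By; apply/colP => i; rewrite E By !mxE.
Qed.

End TauCompare.

Lemma card_relbase (G : zmodType) (S T : gset G) (f : S -> T) (j : T -> S) :
  cancel j f -> (#|{: relbase f j}| + #|T| = #|S|)%N.
Proof.
move=> jK; rewrite -[RHS](cardC (fun s => s != j (f s))) card_sig; congr (_ + _)%N.
rewrite -(card_imset _ (can_inj jK)); apply: eq_card => s; rewrite !inE negbK.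
apply/imsetP/eqP => [[t _ ->]|sE]; first by rewrite jK.
by exists (f s).
Qed.

Section Asymptotics.
Variables (p : nat) (p_pr : prime p) (d : nat) (d0 : (0 < d)%N).
Local Notation Gamma := (Gam p_pr d).
Variables (l : nat) (l_pr : prime l) (l_neq_p : l <> p).
Variables (r : nat) (M : 'M[Phi p_pr d]_r).

Lemma Gamq_map_fiber n0 n (nn : (n0 <= n)%N) (t : Gamq_gset p_pr d n0) :
  #|[set s : Gamq_gset p_pr d n | Gamq_map n0 s == t]| =
  #|[set s : Gamq_gset p_pr d n | Gamq_map n0 s == 0]|.
Proof.
rewrite -(card_imset _ (addIr (- Gamq_map n t : Gamq p n d))); apply: eq_card => x.
have mapB (y : Gamq p n d) : Gamq_map n0 (y + Gamq_map n t) = Gamq_map n0 y + t.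
  by rewrite Gamq_mapD // (Gamq_mapK p_pr nn).
rewrite inE; apply/imsetP/eqP => [[y + ->]|x0].
  rewrite inE => /eqP yt; apply: (addIr t); rewrite -mapB subrK yt add0r.
  by [].
by exists (x + Gamq_map n t); rewrite ?addrK // inE mapB x0 add0r.
Qed.

Lemma tor_ord_blow n0 n (nn : (n0 <= n)%N) : \det (relrep_level p_pr d nn (\det M)) != 0 ->
  tor_ord l_pr (blow (rho (Gamq_gset p_pr d n)) M) =
  (ordz l (\det (relrep_level p_pr d nn (\det M))) +
   tor_ord l_pr (blow (rho (Gamq_gset p_pr d n0)) M))%N.
Proof.
rewrite -det_blow => dn.
set S := Gamq_gset p_pr d n; set T := Gamq_gset p_pr d n0.
have [z [k0 [_ kS _]]] := kercount_tor_ord l_pr (blow (rho S) M).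
have [z' [k0' [_ kT _]]] := kercount_tor_ord l_pr (blow (rho T) M).
have [z'' [k0'' [_ kI /(_ dn)[z''0 tor_ordI]]]] :=
  kercount_tor_ord l_pr (blow (relrep_level p_pr d nn) M).
apply: (@exp_affine_inj _ l_pr (k0 + k0' + k0'').+1 _ z _ z') => k kk.
rewrite -tor_ordI -addnA [RHS]expnD -kT; last by lia.
have <- : kercount (l ^ k) (blow (relrep_level p_pr d nn) M) =
    (l ^ tor_ord l_pr (blow (relrep_level p_pr d nn) M))%N.
  by rewrite kI ?z''0 ?muln0 ?addn0 //; lia.
rewrite -kS; last by lia.
rewrite !kercount_blow.
set c := #|[set s : S | Gamq_map n0 s == 0]|.
(* The fiber sum map is equivariant and becomes the scalar c after pushing forward; c divides #|S|,
   a power of p. *)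
apply: (@bker_split _ _ _ _ _ M (rho S) (rho T) _ _ _ _ (push (Gamq_map n0 : S -> T))^T c%:Z).
- by apply: pull_rho => g s; exact: Gamq_map_act.
- by apply: push_fiber => t; exact: Gamq_map_fiber.
have cT : (c * #|T| = #|S|)%N.
  rewrite -[RHS]sum1_card (partition_big (Gamq_map n0 : S -> T) xpredT) //=.
  rewrite mulnC -sum_nat_const; apply: eq_bigr => t _.
  by rewrite sum1_card /c -(Gamq_map_fiber nn t); apply: eq_card => s; rewrite !inE.
have k1 : (0 < k)%N by lia.
rewrite -pmulrn unitZpE ?ltn_exp1 // coprimeXl //.
apply: (@coprime_dvdr c #|S|); first by rewrite -cT dvdn_mulr.
by rewrite (card_Gamq p_pr) coprimeXr // prime_coprime // dvdn_prime2 //; apply/eqP.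
Qed.

Lemma tor_ord_asymptotic n0 :
  (forall n (nn : (n0 <= n)%N), (n0 < n)%N -> \det (relrep_level p_pr d nn (\det M)) != 0) ->
  bigO_oo (fun n => (tor_ord l_pr (blow (rho (Gamq_gset p_pr d n)) M))%:Z
                    - (p ^ (n * d) * mu l (\det M))%N%:Z)
          (fun n => p ^ ((d - 1) * n))%N.
Proof.
move=> dn; set F := \det M in dn *; set m := mu l F.
have cardT n (nn : (n0 <= n)%N) :
    (#|{: relbase (S := Gamq_gset p_pr d n) (T := Gamq_gset p_pr d n0) (Gamq_map n0) (Gamq_map n)}|
     + p ^ (n0 * d) = p ^ (n * d))%N.
  by rewrite -!(card_Gamq p_pr); exact: (@card_relbase _ (Gamq_gset p_pr d n)
    (Gamq_gset p_pr d n0) (Gamq_map n0) (Gamq_map n) (Gamq_mapK p_pr nn)).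
(* At level n0 + 1 the kernel of Z[Gamma_n] -> Z[Gamma_n0] has positive rank because d > 0, so [F] =
   0 would give determinant 0 there. *)
have Fn0 : F != 0.
  apply: contraTneq (dn _ (leqnSn n0) (ltnSn n0)) => ->.
  have := cardT _ (leqnSn n0); rewrite (raddf0 (relrep_level _ _ _)) negbK.
  case: #|_| => [E|N _]; last by rewrite det0.
  have : (p ^ (n0 * d) < p ^ (n0.+1 * d))%N by rewrite ltn_exp2l ?prime_gt1 // mulSn; lia.
  by rewrite -E ltnn.
have [F0 [g1 [FE Fg1]]] := mu_decomposition l_pr Fn0; rewrite -/m in FE.
have [C [N CN]] := ordz_det_bound d0 l_pr l_neq_p n0 Fg1.
(* The last summand corrects the main term: the relative kernel has rank p^(n d) - p^(n0 d) only,
   and l^m contributes m for each dimension. *)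
exists (C + tor_ord l_pr (blow (rho (Gamq_gset p_pr d n0)) M) + p ^ (n0 * d) * m)%N, (maxn N n0.+1).
move=> n; rewrite geq_max => /andP[Nn n0n]; have nn := ltnW n0n.
rewrite (tor_ord_blow (dn n nn n0n)) -/F; have := dn n nn n0n.
have -> : relrep_level p_pr d nn F = (l ^ m)%:Z *: relrep_level p_pr d nn F0.
  by rewrite {1}FE (raddfMn (relrep_level p_pr d nn)) -scaler_nat natz.
rewrite detZ mulf_eq0 negb_or => /andP[lm0 dF0].
rewrite ordzM //; have := CN n nn Nn dF0; set v := ordz l (\det _) => vC.
have -> t : ordz l ((l ^ m)%:Z ^+ t) = (t * m)%N.
  by rewrite /ordz abszX /= -expnM pfactorK // mulnC.
have := cardT n nn; set t := #|_| => <-; set tor_ord0 := tor_ord _ _.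
have P0 : (0 < p ^ ((d - 1) * n))%N by rewrite expn_gt0 prime_gt0.
set P := (p ^ ((d - 1) * n))%N in vC P0 *; set Q := (p ^ (n0 * d))%N.
have -> : (t * m + v + tor_ord0)%N%:Z - ((t + Q) * m)%N%:Z = (v + tor_ord0)%N%:Z - (Q * m)%N%:Z.
  by rewrite !PoszD !PoszM !PoszD; ring.
have : (tor_ord0 <= tor_ord0 * P)%N by rewrite leq_pmulr.
have : (Q * m <= Q * m * P)%N by rewrite leq_pmulr.
rewrite !mulnDl; lia.
Qed.

End Asymptotics.

(** * Derived digraphs *)

Lemma blowB (A : comNzRingType) m (rep : {rmorphism A -> 'M[int]_m}) r (M N : 'M[A]_r) :
  blow rep (M - N) = blow rep M - blow rep N.
Proof. by apply/matrixP => i j; rewrite !mxE (raddfB rep) !mxE. Qed.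

Lemma blow1 (A : comNzRingType) m (rep : {rmorphism A -> 'M[int]_m}) r :
  blow rep (1%:M : 'M[A]_r) = 1%:M.
Proof.
apply/matrixP => i j; rewrite !mxE (rmorph_nat rep) mulmxnE mxE.
rewrite -mulrnA mulnb; congr (_ *+ nat_of_bool _).
apply/andP/eqP => [[/eqP ij2 /eqP ij1]|->]; last by rewrite !eqxx.
by rewrite -(pair_ordK i) -(pair_ordK j) ij1 ij2.
Qed.

Section DigraphTransport.
Variables (p : nat) (p_pr : prime p) (d : nat) (X Y : digraph).
Variables (alpha : edge X -> Gam p_pr d) (n : nat) (phi : dmorph Y (derived alpha n)).
Hypothesis phi_iso : is_iso phi.
Local Notation S := (Gamq_gset p_pr d n).

Definition vindex (v : vertex (derived alpha n)) : 'I_(#|vertex X| * #|S|) :=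
  pair_ord (enum_rank v.1) (enum_rank (v.2 : S)).

Definition yindex (i : 'I_#|vertex Y|) := vindex (vmap phi (enum_val i)).

Lemma yindex_bij : bijective yindex.
Proof.
have [[g gK Kg] _] := phi_iso.
exists (fun k => enum_rank (g (enum_val (ord_fst k), enum_val (ord_snd k)))) => [i|k].
  rewrite ord_fstK ord_sndK !enum_rankK -[(_, _)]surjective_pairing gK.
  exact: enum_valK.
by rewrite /yindex /vindex enum_rankK Kg /= !enum_valK pair_ordK.
Qed.

Lemma vmap_eq v w : (vmap phi v == vmap phi w) = (v == w).
Proof. by have [/bij_inj/inj_eq] := phi_iso. Qed.

Lemma sum_edge (V : nmodType) (P : pred (edge (derived alpha n)))
    (F : edge (derived alpha n) -> V) :
  \sum_(e : edge Y | P (emap phi e)) F (emap phi e) =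
  \sum_(e : edge X) \sum_(t : S | P (e, t)) F (e, t).
Proof.
have [_ [g gK Kg]] := phi_iso.
rewrite (pair_big_dep xpredT (fun e t => P (e, t)) (fun e t => F (e, t))) /=.
rewrite [RHS](reindex (emap phi)) /=; last by exists g => e _.
by apply: eq_big => e; rewrite -surjective_pairing.
Qed.

Lemma card_natr_sum (T : finType) (P : pred T) : #|[set e | P e]|%:R = \sum_(e | P e) 1 :> int.
Proof. by rewrite sumr_const; congr (_ %:R); apply: eq_card => e; rewrite inE. Qed.

Lemma deg_blow i j : deg_mx Y i j =
  blow (rho S) (map_mx intr (deg_mx X) : 'M[Phi p_pr d]_#|vertex X|) (yindex i) (yindex j).
Proof.
rewrite !mxE /yindex /vindex !ord_fstK !ord_sndK (inj_eq enum_rank_inj) !enum_rankK.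
set v := vmap phi (enum_val i); set w := vmap phi (enum_val j).
have ij : (i == j) = (v.1 == w.1) && (v.2 == w.2).
  by rewrite -(inj_eq enum_val_inj) -vmap_eq -/v -/w -pair_eqE.
have intrE (c : nat) (b : bool) : ((c%:R *+ b)%:~R : Phi p_pr d) = (c * b)%:R.
  by rewrite -mulrnA natz -pmulrn.
rewrite intrE (rmorph_nat (rho S)) mulmxnE mxE (inj_eq enum_rank_inj).
rewrite -mulrnA mulnC -mulnA mulnb -ij.
rewrite mulrnA; congr (_ *+ _).
rewrite !card_natr_sum (eq_bigl (fun e : edge Y => org (emap phi e) == v)); last first.
  by move=> e; rewrite -vmap_org vmap_eq.
rewrite (sum_edge (fun e => org e == v) (fun=> 1)) [RHS]big_mkcond; apply: eq_bigr => e _.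
rewrite (eq_bigl (fun t => (org e == v.1) && (t == v.2))) => [|t]; last by rewrite -pair_eqE.
case: eqP => _ /=; last by rewrite big_pred0.
by rewrite big_pred1_eq.
Qed.

(** Above an edge e of X, the origin w of a lift fixes its group component, and its terminus is then
    w translated by the voltage: the permutation matrix of [alpha e] records exactly this. *)
Lemma adj_blow i j : adj_mx Y i j = blow (rho S) (volt_adj_mx alpha) (yindex i) (yindex j).
Proof.
rewrite !mxE /yindex /vindex !ord_fstK !ord_sndK !enum_rankK.
set v := vmap phi (enum_val i); set w := vmap phi (enum_val j).
rewrite card_natr_sum (eq_bigl (fun e : edge Y =>
  (org (emap phi e) == w) && (ter (emap phi e) == v))); last first.
  by move=> e; rewrite -vmap_org -vmap_ter !vmap_eq.
rewrite (sum_edge (fun e => (org e == w) && (ter e == v)) (fun=> 1)).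
rewrite (rmorph_sum (rho S)) summxE [RHS]big_mkcond; apply: eq_bigr => e _ /=.
rewrite prod_Tpow.
have -> : glift (fun g => push (tact (@Gam_red p p_pr d n) g)) (grp_elt (alpha e)) =
    push (@gact _ S (alpha e)) by rewrite gliftU mulr1z.
rewrite mxE !enum_rankK /= /tact.
rewrite (eq_bigl (fun t => (((org e == w.1) && (ter e == v.1)) &&
   (w.2 + Gam_red n (alpha e) == v.2)) && (t == w.2))) => [|t]; last first.
  rewrite -!pair_eqE /pair_eq /= -!andbA; case: (org e == w.1) => //=.
  by case: eqP => [->|]; rewrite ?andbT ?andbF.
case: (org e == w.1) => /=; last by rewrite big_pred0.
case: (ter e == v.1) => /=; last by rewrite big_pred0.
by case: (_ == v.2) => /=; [rewrite big_pred1_eq | rewrite big_pred0].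
Qed.

End DigraphTransport.

(** * Strong connectivity *)

Section Harmonic.
Variable Y : digraph.
Hypothesis Y_sc : strongly_connected Y.
Local Notation deg v := (#|[set e : edge Y | org e == v]|%:Z).

(** The kernel condition for [deg_mx - adj_mx]. Out-degrees meet incoming edges, so the columns of
    this matrix sum to 0 but its rows need not, and constants need not be balanced. *)
Definition balanced (U : vertex Y -> int) :=
  forall v, deg v * U v = \sum_(e : edge Y | ter e == v) U (org e).

(** Positivity propagates along edges: at the terminus the incoming sum of nonnegative values has a
    positive term. *)
Lemma balanced_pos (U : vertex Y -> int) a :
  balanced U -> (forall v, 0 <= U v) -> 0 < U a -> forall b, 0 < U b.
Proof.
move=> UH U0 Ua b; have /connectP[s ps ->] := Y_sc a b.
elim: s a Ua ps => //= c s IHs a Ua /andP[/existsP[e /andP[/eqP ea /eqP ec]] ps].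
apply: IHs ps; have : 0 < deg c * U c.
  rewrite UH (bigD1 e) /= ?ec // ea; apply: ltr_wpDr => //.
  by apply: sumr_ge0 => e' _.
move=> degU; rewrite lt_neqAle U0 andbT.
by apply: contraTneq degU => <-; rewrite mulr0 ltxx.
Qed.

(* The triangle inequality at every vertex sums up to an equality. *)
Lemma balanced_norm (U : vertex Y -> int) : balanced U -> balanced (fun v => `|U v|).
Proof.
move=> UH.
pose D v := \sum_(e : edge Y | ter e == v) `|U (org e)| - deg v * `|U v|.
have D0 v : 0 <= D v.
  rewrite subr_ge0 -[deg v]ger0_norm // -normrM UH; exact: ler_norm_sum.
have sumD : \sum_v D v = 0.
  rewrite sumrB; apply/eqP; rewrite subr_eq0; apply/eqP.
  transitivity (\sum_(e : edge Y) `|U (org e)|).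
    by rewrite (partition_big (@ter Y) xpredT).
  rewrite (partition_big (@org Y) xpredT) //=; apply: eq_bigr => v _.
  rewrite (eq_bigr (fun=> `|U v|)) => [|e /eqP -> //].
  rewrite sumr_const -mulr_natl natz; congr (_%:Z * _).
  by apply: eq_card => e; rewrite inE.
move=> v; apply/eqP; rewrite eq_sym -subr_eq0.
have Dv : D v = 0 by apply: (psumr_eq0P _ sumD) => // w _; exact: D0.
by rewrite -[X in X == 0]/(D v) Dv.
Qed.

(** Perron-Frobenius in elementary form: |U| + U and |U| - U are balanced and nonnegative, so each
    is positive everywhere once it is positive somewhere. *)
Lemma balanced_sign (U : vertex Y -> int) : balanced U ->
  [\/ forall v, U v = 0, forall v, 0 < U v | forall v, U v < 0].
Proof.
move=> UH; have NH := balanced_norm UH.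
have [/forallP U0|] := boolP [forall v, U v == 0]; first by constructor 1 => v; exact/eqP.
rewrite negb_forall => /existsP[a]; rewrite neq_lt => /orP[Ua|Ua].
  constructor 3 => b; have : 0 < `|U b| - U b.
    apply: (@balanced_pos (fun v => `|U v| - U v) a) => [v|v|].
    - by rewrite mulrBr NH UH sumrB.
    - by rewrite subr_ge0 ler_norm.
    - by rewrite subr_gt0 (lt_le_trans Ua).
  by rewrite subr_gt0 !ltNge; apply: contraNN => Ub0; rewrite ger0_norm.
constructor 2 => b; have : 0 < `|U b| + U b.
  apply: (@balanced_pos (fun v => `|U v| + U v) a) => [v|v|].
  - by rewrite mulrDr NH UH big_split.
  - by rewrite -[X in _ + X]opprK subr_ge0 -normrN ler_norm.
  - by rewrite ltr_wpDl.
by rewrite !ltNge; apply: contraNN => Ub0; rewrite ler0_norm // addNr.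
Qed.

Lemma laplacian_balanced (u : 'cV[int]_#|vertex Y|) : (deg_mx Y - adj_mx Y) *m u = 0 ->
  balanced (fun v => u (enum_rank v) 0).
Proof.
move=> /colP Lu v; have := Lu (enum_rank v); rewrite mulmxBl !mxE => /eqP.
rewrite subr_eq0 => /eqP E.
transitivity (\sum_j deg_mx Y (enum_rank v) j * u j 0).
  rewrite (bigD1 (enum_rank v)) //= big1 ?addr0 => [|j jv].
    by rewrite !mxE eqxx enum_rankK natz mulr1n.
  by rewrite !mxE eq_sym (negPf jv) mul0r.
rewrite {}E [RHS](partition_big (@org Y) xpredT) //=.
rewrite -[RHS]sum_enum_val; apply: eq_bigr => j _; rewrite mxE enum_rankK.
rewrite (eq_bigr (fun=> u j 0)) => [|e /andP[_ /eqP ->]]; last by rewrite enum_valK.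
rewrite sumr_const mulr_natl; congr (_ *+ _).
by apply: eq_card => e; rewrite !inE andbC.
Qed.

End Harmonic.

Section PicNonvanishing.
Variables (p : nat) (p_pr : prime p) (d : nat) (X Y : digraph).
Variables (alpha : edge X -> Gam p_pr d) (n : nat) (phi : dmorph Y (derived alpha n)).
Hypotheses (phi_iso : is_iso phi) (Y_sc : strongly_connected Y).

Definition volt_lap : 'M[Phi p_pr d]_#|vertex X| := map_mx intr (deg_mx X) - volt_adj_mx alpha.

Lemma zmx_int m k (B : 'M[int]_(m, k)) : zmx int B = B.
Proof. by apply/matrixP => i j; rewrite mxE intz. Qed.

Lemma subr_mxE (V : zmodType) m k (A B : 'M[V]_(m, k)) i j : (A - B) i j = A i j - B i j.
Proof. by rewrite !mxE. Qed.

Lemma rel_blow_kernel r n0 (nn : (n0 <= n)%N) (M : 'M[Phi p_pr d]_r) :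
  \det (blow (relrep_level p_pr d nn) M) = 0 ->
  exists x : {ffun 'I_r -> 'cV[int]_#|Gamq_gset p_pr d n|},
    [/\ exists i, x i != 0, bker (rho (Gamq_gset p_pr d n)) M x
      & forall i, push (Gamq_map n0 : Gamq_gset p_pr d n -> Gamq_gset p_pr d n0) *m x i = 0].
Proof.
set S := Gamq_gset p_pr d n; set T := Gamq_gset p_pr d n0.
set f : S -> T := Gamq_map n0; set j : T -> S := Gamq_map n.
have jK : cancel j f := Gamq_mapK p_pr nn.
move=> /int_det0P[y y0 yB].
have /bkerP yK : bker (relrep_level p_pr d nn) M (bvec y) by rewrite -bker_blow zmx_int yB.
exists [ffun i => rel_iota f j *m bvec y i]; split.
- apply/existsP; apply: contraR y0 => /existsPn x0.
  have y0 i : bvec y i = 0.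
    have := x0 i; rewrite negbK ffunE => /eqP/(congr1 (mulmx (rel_res f j))).
    by rewrite mulmxA (rel_res_iota jK) mul1mx mulmx0.
  apply/eqP/colP => k; rewrite -(pair_ordK k) [RHS]mxE.
  by have /colP/(_ (ord_snd k)) := y0 (ord_fst k); rewrite ffunE !mxE.
- apply/bkerP => i; rewrite -[RHS](mulmx0 _ (rel_iota f j)) -(yK i) mulmx_sumr.
  apply: eq_bigr => k _; rewrite ffunE !zmx_int [LHS]mulmxA [RHS]mulmxA; congr (_ *m _).
  exact/esym/(@relrep_iota _ S T f j jK (fun g (s : S) => Gamq_map_act g s nn)).
- by move=> i; rewrite ffunE mulmxA (push_iota0 jK) mul0mx.
Qed.

(** A kernel vector would be a balanced function on X_n of constant sign. Since Gamma_0 is trivial,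
    its sum over each fiber of X_n -> X vanishes, so it would be 0. *)
Lemma Lp_nonvanishing (n0 := 0%N) (nn : (n0 <= n)%N) :
  \det (relrep_level p_pr d nn (\det volt_lap)) != 0.
Proof.
rewrite -det_blow; apply/eqP => /rel_blow_kernel[x [[i0 xi0] xK xf]].
set S := Gamq_gset p_pr d n in x xi0 xK xf.
pose z : 'cV[int]_(#|vertex X| * #|S|) := \col_k x (ord_fst k) (ord_snd k) 0.
have zK : blow (rho S) volt_lap *m z = 0.
  apply/eqP; rewrite -[blow _ _]zmx_int bker_blow.
  suff -> : bvec z = x by [].
  by apply/ffunP => i; apply/colP => k; rewrite ffunE !mxE ord_fstK ord_sndK.
pose u : 'cV[int]_#|vertex Y| := \col_i z (yindex phi i) 0.
have uK : (deg_mx Y - adj_mx Y) *m u = 0.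
  apply/colP => i; transitivity ((blow (rho S) volt_lap *m z) (yindex phi i) 0); last first.
    by rewrite zK !mxE.
  rewrite [LHS]mxE [RHS]mxE [RHS](reindex _ (onW_bij _ (yindex_bij phi_iso))) /=.
  apply: eq_bigr => j _; rewrite [u j 0]mxE; congr (_ * _).
  by rewrite /volt_lap blowB !subr_mxE (deg_blow phi_iso) (adj_blow phi_iso).
have [g gK Kg] := yindex_bij phi_iso.
pose U v := u (enum_rank v) 0.
have zE k : z k 0 = U (enum_val (g k)) by rewrite /U enum_valK [RHS]mxE Kg.
have sum0 w : \sum_(s < #|S|) z (pair_ord w s) 0 = 0.
  have /colP/(_ (enum_rank (0 : Gamq_gset p_pr d 0))) := xf w; rewrite !mxE => E.
  rewrite -[RHS]E; apply: eq_bigr => s _; rewrite !mxE ord_fstK ord_sndK enum_rankK.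
  have -> : Gamq_map 0 (enum_val s) == 0 :> Gamq p 0 d.
    by apply/eqP/rowP => k; rewrite [LHS]ord1 [RHS]ord1.
  by rewrite mul1r.
have s0 : 'I_#|S| := enum_rank (0 : S).
have sum_pos (V : 'I_#|S| -> int) : (forall s, 0 < V s) -> 0 < \sum_s V s.
  move=> V0; rewrite (bigD1 s0) //=; apply: ltr_wpDr; last exact: V0.
  by apply: sumr_ge0 => s _; exact: ltW.
have [U0|Upos|Uneg] := balanced_sign Y_sc (laplacian_balanced uK).
- case/negP: xi0; apply/eqP/colP => s; rewrite mxE.
  by have := zE (pair_ord i0 s); rewrite [LHS]mxE ord_fstK ord_sndK => ->; exact: U0.
- suff : 0 < \sum_s z (pair_ord i0 s) 0 by rewrite sum0 ltxx.
  by apply: sum_pos => s; rewrite zE; exact: Upos.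
- suff : 0 < \sum_s - z (pair_ord i0 s) 0 by rewrite sumrN sum0 oppr0 ltxx.
  by apply: sum_pos => s; rewrite zE oppr_gt0; exact: Uneg.
Qed.

End PicNonvanishing.

(** * Characters *)

Lemma closed_prim_root (K : closedFieldType) n : n%:R != 0 :> K ->
  exists z : K, n.-primitive_root z.
Proof.
move=> nK; have n0 : (0 < n)%N by rewrite lt0n; apply: contraNneq nK => ->.
have [r Dp] := closed_field_poly_normal ('X^n - 1 : {poly K}).
rewrite (monicP _) ?monicXnsubC // scale1r in Dp.
have rn1 : all n.-unity_root r by apply/allP=> z; rewrite -root_prod_XsubC -Dp.
have sz_r : (n < (size r).+1)%N by rewrite -(size_prod_XsubC r id) -Dp size_XnsubC.
have [|z] := hasP (has_prim_root n0 rn1 _ sz_r); last by exists z.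
by rewrite -separable_prod_XsubC -Dp separable_Xn_sub_1.
Qed.

Section Fourier.
Variables (p : nat) (p_pr : prime p) (d n : nat) (K : fieldType) (zeta : K).
Hypothesis zetaP : (p ^ n).-primitive_root zeta.
Hypothesis pnK : (p ^ n)%:R != 0 :> K.
Local Notation H := (Gamq p n d).

Definition chi (c s : H) : K := \prod_i zeta ^+ (c 0%R i * s 0%R i).

Lemma chiC c s : chi c s = chi s c.
Proof. by apply: eq_bigr => i _; rewrite mulnC. Qed.

Lemma chiD c s t : chi c (s + t) = chi c s * chi c t.
Proof.
rewrite /chi -big_split; apply: eq_bigr => i _; rewrite /= mxE /=.
move: (nat_of_ord (c 0 i)) (nat_of_ord (s 0 i)) (nat_of_ord (t 0 i)) => a b e.
rewrite (ppow_prednK p_pr) mulnC exprM (prim_expr_mod zetaP) -exprM mulnC mulnDr.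
by rewrite exprD.
Qed.

Lemma chi0 c : chi c 0 = 1.
Proof. by apply: big1 => i _; rewrite mxE muln0. Qed.

Lemma chi_expr c s : chi c s ^+ (p ^ n) = 1.
Proof.
by rewrite -prodrXl big1 // => i _; rewrite exprAC (prim_expr_order zetaP) expr1n.
Qed.

Lemma sum_chi h : h != 0 -> \sum_c chi c h = 0.
Proof.
move=> h0; have [i hi] : exists i, h 0 i != 0.
  apply/existsP; apply: contraR h0 => /existsPn h0; apply/eqP/rowP => i.
  by rewrite mxE; apply/eqP; rewrite -[_ == _]negbK h0.
have pn1 : (1 < p ^ n)%N.
  have := ltn_ord (h 0 i); rewrite [X in (_ < X)%N](ppow_prednK p_pr); apply: leq_ltn_trans.
  by rewrite lt0n.
pose c0 : H := \row_k if k == i then inZp 1 else 0.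
have c01 : chi c0 h != 1.
  rewrite /chi (bigD1 i) //= big1 ?mulr1 => [|k ki]; last first.
    by rewrite mxE (negPf ki) /= mul0n.
  rewrite mxE eqxx /= [in (1 %% _)%N](ppow_prednK p_pr) modn_small // mul1n.
  rewrite -(prim_order_dvd zetaP) gtnNdvd ?lt0n //.
  by have := ltn_ord (h 0 i); rewrite [X in (_ < X)%N](ppow_prednK p_pr).
have : \sum_c chi c h = chi c0 h * \sum_c chi c h.
  rewrite {1}(reindex_inj (addIr c0)) mulr_sumr; apply: eq_bigr => c _ /=.
  by rewrite chiC chiD mulrC !(chiC h).
move/eqP; rewrite -subr_eq0 -[X in X - _]mul1r -mulrBl mulf_eq0 subr_eq0 eq_sym.
by rewrite (negPf c01) => /eqP.
Qed.

Lemma fourier_inj (x : H -> K) : (forall c, \sum_s chi c s * x s = 0) -> forall s, x s = 0.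
Proof.
move=> x0 s0; have : \sum_c chi c (- s0) * (\sum_s chi c s * x s) = 0.
  by apply: big1 => c _; rewrite x0 mulr0.
under eq_bigr do rewrite mulr_sumr.
rewrite exchange_big /= (bigD1 s0) //= [X in _ + X]big1 ?addr0 => [|s ss0].
  rewrite (eq_bigr (fun=> x s0)) => [|c _]; last by rewrite mulrA -chiD addNr chi0 mul1r.
  rewrite sumr_const (card_Gamq p_pr) expnM -mulr_natr natrX => /eqP.
  by rewrite mulf_eq0 expf_eq0 (negPf pnK) andbF orbF => /eqP.
rewrite (eq_bigr (fun c => chi c (- s0 + s) * x s)) => [|c _]; last by rewrite mulrA -chiD.
by rewrite -mulr_suml sum_chi ?mul0r // addrC subr_eq0.
Qed.

End Fourier.

(** * Nonvanishing away from finitely many characters *)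

Section CharacterNonvanishing.
Variables (p : nat) (p_pr : prime p) (d : nat) (K : closedFieldType).
Hypothesis charK : forall c : int, c%:~R = 0 :> K -> c = 0.
Variable F : Phi p_pr d.
Local Notation Gamma := (Gam p_pr d).

Lemma Gam_red_eq0 n m (g : Gamma) : (logn p m <= n)%N -> (0 < m)%N -> Gam_red n g = 0 ->
  exists h : Gamma, g = h *+ m.
Proof.
move=> mn m0 /rowP gn.
have /choice[h hE] i : exists y, g 0 i = y *+ m.
  apply: padic_divn => //; rewrite -(padic_res_le (g 0 i) mn).
  by have /(congr1 val) := gn i; rewrite !mxE /= => ->; rewrite mod0n.
by exists (\row_i h i); apply/rowP => i; rewrite mulmxnE mxE.
Qed.

Definition trivial_from (w : Gamma -> K) (n0 : nat) : Prop :=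
  forall g, Gam_red n0 g = 0 -> w g = 1.

(** No continuity is assumed. The part of m prime to p is invertible in Z_p, so p^n Gamma lies in m
    Gamma for n >= ord_p(m), and w^m = 1 kills it. *)
Lemma fin_character_trivial (w : Gamma -> K) : is_fin_character w ->
  exists n0, forall n, (n0 <= n)%N -> trivial_from w n.
Proof.
move=> [w0 wD [m m0 wm]]; exists (logn p m) => n mn g /(Gam_red_eq0 mn m0)[h ->].
suff -> : w (h *+ m) = w h ^+ m by [].
by elim: (m) => [|k IHk]; rewrite ?w0 // mulrS exprS wD IHk.
Qed.

Lemma bad_level :
  finite_set [set w : Gamma -> K | is_fin_character w /\ char_eval w F = 0]%classic ->
  exists n0, forall w : Gamma -> K, is_fin_character w -> char_eval w F = 0 -> trivial_from w n0.
Proof.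
move=> Bfin.
have /choice[lev levP] (w : Gamma -> K) : exists n0,
    is_fin_character w -> forall n, (n0 <= n)%N -> trivial_from w n.
  have [/fin_character_trivial[n0 w0]|nw] := pselect (is_fin_character w); first by exists n0.
  by exists 0%N.
have /finite_seqP[s sE] := finite_image lev Bfin.
exists (\max_(i <- s) i) => w wfin wF; apply: levP => //.
have ws : [set` s]%classic (lev w) by rewrite -sE; exists w.
by rewrite (big_rem _ ws) /= leq_max leqnn.
Qed.

(** Summation against a character is an eigenvector for the transposed action of [F]. *)
Lemma rho_char n (x : 'cV[int]_#|Gamq_gset p_pr d n|) (X : Gamq p n d -> K) :
  (forall s t, X (s + t) = X s * X t) ->
  \sum_s X s * ((rho (Gamq_gset p_pr d n) F *m x) (enum_rank s) 0)%:~R =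
  char_eval (fun g => X (Gam_red n g)) F * \sum_s X s * (x (enum_rank s) 0)%:~R.
Proof.
move=> XD; rewrite /char_eval mulr_suml.
under eq_bigr do rewrite rhoE mulmx_suml summxE rmorph_sum mulr_sumr.
rewrite exchange_big /=; apply: eq_bigr => g _.
rewrite (reindex_inj (addIr (Gam_red n g))) mulr_sumr; apply: eq_bigr => s _ /=.
rewrite -scalemxAl mxE mxE (bigD1 (enum_rank (s : Gamq_gset p_pr d n))) //= big1 ?addr0 => [|t ts].
  by rewrite !mxE !enum_rankK eqxx mul1r intrM XD; ring.
rewrite !mxE enum_rankK /= /tact (inj_eq (addIr (Gam_red n g))).
have /negPf -> : enum_val t != s by apply: contraNneq ts => <-; rewrite enum_valK.
by rewrite mul0r.
Qed.

(** All Fourier coefficients of a kernel vector x vanish. If w(F) is nonzero, this follows from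
    [rho_char]; otherwise w is constant on the fibers over Gamma_n0, where x sums to 0. *)
Lemma relrep_level_nonvanishing n0 : 
  (forall w : Gamma -> K, is_fin_character w -> char_eval w F = 0 -> trivial_from w n0) ->
  forall n (nn : (n0 <= n)%N), \det (relrep_level p_pr d nn F) != 0.
Proof.
move=> bad n nn; set S := Gamq_gset p_pr d n; set T := Gamq_gset p_pr d n0.
set f : S -> T := Gamq_map n0; set j : T -> S := Gamq_map n.
have jK : cancel j f := Gamq_mapK p_pr nn.
apply/eqP => /int_det0P[y y0 yF].
pose x := rel_iota f j *m y.
have Fx : rho S F *m x = 0.
  rewrite /x mulmxA -(@relrep_iota _ S T f j jK (fun g (s : S) => Gamq_map_act g s nn)).
  by rewrite -mulmxA [X in _ *m X]yF mulmx0.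
have fx : push f *m x = 0 by rewrite mulmxA (push_iota0 jK) mul0mx.
have pnK : (p ^ n)%:R != 0 :> K.
  apply/eqP => /(charK (c := (p ^ n)%N)) /eqP.
  by rewrite eqz_nat expn_eq0 eqn0Ngt prime_gt0.
have [zeta zetaP] := closed_prim_root pnK.
have x0 c : \sum_(s : Gamq p n d) chi zeta c s * (x (enum_rank (s : S)) 0)%:~R = 0.
  pose w g := chi zeta c (Gam_red n (g : Gamma)).
  have wfin : is_fin_character w.
    split; first by rewrite /w raddf0 chi0.
      by move=> g h; rewrite /w raddfD (chiD p_pr zetaP).
    by exists (p ^ n)%N => [|g]; [rewrite expn_gt0 prime_gt0 | exact: chi_expr].
  have [wF|wF] := eqVneq (char_eval w F) 0; last first.
    have := rho_char x (chiD p_pr zetaP c); rewrite Fx.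
    rewrite big1 => [/esym/eqP|s _]; last by rewrite mxE mulr0z mulr0.
    by rewrite mulf_eq0 (negPf wF) /= => /eqP.
  have chi_f (s : S) : chi zeta c s = chi zeta c (j (f s)).
    have [g gE] := Gam_red_surj p_pr s; have [h hE] := Gam_red_surj p_pr (j (f s)).
    have : w (g - h) = 1.
      apply: (bad w wfin wF); rewrite raddfB /= -(Gamq_map_red g nn) -(Gamq_map_red h nn).
      have E : Gamq_map n0 (j (f s)) = f s by exact: jK.
      by rewrite gE hE E subrr.
    have -> : chi zeta c s = w g by rewrite /w gE.
    have -> : chi zeta c (j (f s)) = w h by rewrite /w hE.
    by case: wfin => _ wD _ gh1; rewrite -(subrK h g) wD gh1 mul1r.
  rewrite (partition_big f xpredT) //= big1 // => t _.
  rewrite (eq_bigr (fun s : S => chi zeta c (j t) * (x (enum_rank s) 0)%:~R)); last first.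
    by move=> s /eqP st; rewrite chi_f st.
  rewrite -mulr_sumr -rmorph_sum /=.
  suff -> : \sum_(s | f s == t) x (enum_rank s) 0 = 0 by rewrite mulr0.
  have /colP/(_ (enum_rank t)) := fx; rewrite mxE [RHS]mxE => E.
  rewrite -[RHS]E [LHS]big_mkcond -[LHS]sum_enum_val; apply: eq_bigr => i _.
  by rewrite !mxE enum_rankK enum_valK; case: ifP; rewrite ?mul1r ?mul0r.
have x00 : x = 0.
  apply/colP => i; rewrite [RHS]mxE; apply: charK.
  by have := fourier_inj p_pr zetaP pnK x0 (enum_val i); rewrite enum_valK.
move: y0; apply/negP; rewrite negbK; apply/eqP.
by rewrite -[y]mul1mx -(rel_res_iota jK) -mulmxA -/x x00 mulmx0.
Qed.

End CharacterNonvanishing.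

(** * The theorem *)

Lemma tor_ord_transport p (p_pr : prime p) d (X Y : digraph) (alpha : edge X -> Gam p_pr d) n
    (phi : dmorph Y (derived alpha n)) l (l_pr : prime l) (D : 'M[int]_#|vertex Y|)
    (D' : 'M[Phi p_pr d]_#|vertex X|) :
  is_iso phi ->
  (forall i j, D i j = blow (rho (Gamq_gset p_pr d n)) D' (yindex phi i) (yindex phi j)) ->
  tor_ord l_pr (D - adj_mx Y) =
  tor_ord l_pr (blow (rho (Gamq_gset p_pr d n)) (D' - volt_adj_mx alpha)).
Proof.
move=> phi_iso DE; apply: tor_ord_kercount => q.
apply: kercount_reindex (yindex_bij phi_iso) _ => i j.
by rewrite blowB !subr_mxE DE (adj_blow phi_iso).
Qed.

Lemma padic_extension_char0 l (l_pr : prime l) (K : fieldType)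
    (iota : {rmorphism {fraction padic_int l_pr} -> K}) (c : int) : c%:~R = 0 :> K -> c = 0.
Proof.
suff nat0 n : n%:R = 0 :> K -> n = 0%N.
  case: c => n; rewrite ?NegzE ?mulrNz -pmulrn; first by move/nat0->.
  by move/eqP; rewrite oppr_eq0 => /eqP/nat0.
move/eqP; rewrite -(rmorph_nat iota) fmorph_eq0 -(rmorph_nat (@tofrac (padic_int l_pr))) tofrac_eq0.
by case: n => // n; rewrite (negPf (padic_natr_neq0 l_pr (ltn0Sn n))).
Qed.

Lemma bigO_oo_ext (f g : nat -> int) h : (forall n, f n = g n) -> bigO_oo g h -> bigO_oo f h.
Proof. by move=> fg [C [N gh]]; exists C, N => n /gh; rewrite fg. Qed.

Unset Implicit Arguments.

Theorem theoremB (p : nat) (p_pr : prime p) (d : nat) (d_gt0 : (0 < d)%N)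
    (T : tower) (T_Zpd : is_Zpd_tower p d T)
    (T_sc : forall n, strongly_connected (T n))
    (alpha : edge (T 0%N) -> Gam p_pr d) (T_alpha : is_voltage_of alpha)
    (l : nat) (l_pr : prime l) (l_neq_p : l <> p) :
  bigO_oo
    (fun n => (logn l (card_tensor_tor l_pr (Pic (T n))))%:Z
              - (p ^ (n * d) * mu l (Lp alpha))%N%:Z)
    (fun n => p ^ ((d - 1) * n))%N
  /\
  forall (Qlbar : closedFieldType)
    (iota : {rmorphism {fraction padic_int l_pr} -> Qlbar}),
    is_algebraic_closure iota ->
    finite_set [set w : Gam p_pr d -> Qlbar |
      is_fin_character w /\ char_eval w (Lp_BF alpha) = 0]%classic ->
    bigO_oo
      (fun n => (logn l (card_tensor_tor l_pr (BF (T n))))%:Z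
                - (p ^ (n * d) * mu l (Lp_BF alpha))%N%:Z)
      (fun n => p ^ ((d - 1) * n))%N.
Proof.
have [phi [phi_iso _ _]] := T_alpha; split.
  apply: bigO_oo_ext (tor_ord_asymptotic d_gt0 l_pr l_neq_p (M := volt_lap alpha) (n0 := 0) _).
    move=> n; congr (_%:Z - _).
    apply: (tor_ord_transport l_pr (phi_iso n)); exact: deg_blow.
  by move=> n nn _; apply: Lp_nonvanishing (phi_iso n) (T_sc n) nn.
move=> K iota _ /bad_level[n0 bad].
apply: bigO_oo_ext (tor_ord_asymptotic d_gt0 l_pr l_neq_p
  (M := 1%:M - volt_adj_mx alpha) (n0 := n0) _).
  move=> n; congr (_%:Z - _).
  apply: (tor_ord_transport l_pr (phi_iso n)) => i j.
  by rewrite blow1 !mxE (inj_eq (bij_inj (yindex_bij (phi_iso n)))).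
move=> n nn _; apply: relrep_level_nonvanishing bad n nn.
by move=> c; exact: padic_extension_char0 iota c.
Qed.
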